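(* Let $1\le p\le 2$, $s\le 0$, $p_1,\dots,p_{2d}\in[2,\infty]$, $p_{2d+1},\dots,p_{4d}\in[p,\infty]$, and let $c$ be a slice permutation of $\{1,\dots,4d\}$. Assume at least one of the following is true: (a) $s<0$; (b) at least one of $p_1,\dots,p_{2d}$ is larger than $2$; (c) at least one of $p_{2d+1},\dots,p_{4d}$ is larger than $p$. Then there are pseudodifferential operators with kernels in $M(c)_{v_s}^{p_1,p_2,\dots,p_{4d}}$ that are not in $\mathcal{I}_p(L^2(\mathbb{R}^d))$, and there are pseudodifferential operators with Kohn-Nirenberg symbols in $M(c)_{v_s}^{p_1,p_2,\dots,p_{4d}}$ that are not in $\mathcal{I}_p(L^2(\mathbb{R}^d))$.
   Context: Weight: $v_s(z)=(1+|z|)^s$ for $z\in\mathbb{R}^{4d}$. Pseudodifferential operators: the pseudodifferential operator with Kohn-Nirenberg symbol $\tau$ (on $\mathbb{R}^{2d}$) is $K_\tau f(t)=\iint_{\mathbb{R}^{2d}}\hat\tau(\xi,x)\,M_\xi T_{-x}f(t)\,dx\,d\xi$, where $T_xf(t)=f(t-x)$ and $M_\xi f(t)=e^{2\pi i t\cdot\xi}f(t)$. It is an integral operator $Af(t)=\int_{\mathbb{R}^d}k(t,y)f(y)\,dy$ with kernel $k=(\mathcal{F}_2^{-1}\tau)\circ N$, where $N(x,y)=(x,x-y)$ and $(\mathcal{F}_2F)(x,w)=\int_{\mathbb{R}^d}F(x,y)e^{-2\pi i y\cdot w}\,dy$. For $k,\tau$ tempered distributions these formulas are understood in the distributional sense: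 $A:S(\mathbb{R}^d)\to S'(\mathbb{R}^d)$ with $\langle Af,g\rangle=\langle k,g\otimes\bar f\rangle$. Mixed modulation spaces on $\mathbb{R}^{2d}$: fix a nonzero $\phi\in S(\mathbb{R}^{2d})$ (Schwartz class). For $f\in S'(\mathbb{R}^{2d})$ the Gabor transform is $V_\phi f(x,\xi)=\langle f,M_\xi T_x\phi\rangle$, $x,\xi\in\mathbb{R}^{2d}$, regarded as a function on $\mathbb{R}^{4d}$; the pairing extends $\langle f,g\rangle=\int f\bar g$. For a permutation $c$ of $\{1,\dots,4d\}$ let $\mathfrak{c}(x_1,\dots,x_{4d})=(x_{c(1)},\dots,x_{c(4d)})$. For $p_1,\dots,p_{4d}\in[1,\infty]$ and a weight $w$ on $\mathbb{R}^{4d}$, $M(c)_w^{p_1,\dots,p_{4d}}$ is the space of $f\in S'(\mathbb{R}^{2d})$ with $\|f\|_{M(c)_w^{p_1,\dots,p_{4d}}}=\|V_\phi f\circ\mathfrak{c}\|_{L_w^{p_1,\dots,p_{4d}}}<\infty$, where $$\|F\|_{L_w^{p_1,\dots,p_{4d}}}=\biggl(\int_{\mathbb{R}}\cdots\biggl(\int_{\mathbb{R}}|F(x_1,\dots,x_{4d})\,w(x_1,\dots,x_{4d})|^{p_1}\,dx_1\biggr)^{p_2/p_1}\cdots\,dx_{4d}\biggr)^{1/p_{4d}}$$ (usual modification for exponents $\infty$). Different windows $\phi$ give equivalent norms. Slice permutation: a permutation $c$ of $\{1,\dots,4d\}$ such that (a) $c$ maps $\{1,\dots,d\}\cup\{2d+1,\dots,3d\}$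 bijectively onto $\{1,\dots,2d\}$, and (b) $c$ maps $\{d+1,\dots,2d\}\cup\{3d+1,\dots,4d\}$ bijectively onto $\{2d+1,\dots,4d\}$. A linear operator $A:H\to H$ on a Hilbert space is Schatten $p$-class ($A\in\mathcal{I}_p(H)$) if $\sup\bigl(\sum_{n\in\mathbb{N}}|\langle Af_n,g_n\rangle|^p\bigr)^{1/p}<\infty$, the supremum being over all pairs of orthonormal sequences $\{f_n\},\{g_n\}$ in $H$. In particular an operator that does not define a bounded operator from $L^2(\mathbb{R}^d)$ to itself is not in $\mathcal{I}_p(L^2(\mathbb{R}^d))$. *)

(* Defs.v *)
From HB Require Import structures.
From mathcomp Require Import all_boot all_order all_algebra.
From mathcomp Require Import perm complex.
From mathcomp Require Import all_classical all_reals all_analysis.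

Set Implicit Arguments.
Unset Strict Implicit.
Unset Printing Implicit Defensive.

Import Order.TTheory GRing.Theory Num.Theory.
Import numFieldNormedType.Exports.

Local Open Scope classical_set_scope.
Local Open Scope ring_scope.
Local Open Scope complex_scope.

Notation cmod := ComplexField.Normc.normc.

(* 'rV[R]_n carries a topology but no sigma-algebra in the library; the one
   generated by the coordinates is the Borel sigma-algebra. *)
Section RowMeasurable.
Context {R : realType} (n : nat).

Let coord (i : 'I_n) (x : 'rV[R]_n) : measurableTypeR R := x 0 i.

Let row_set0 : g_sigma_preimage coord set0.
Proof. exact: sigma_algebra0. Qed.

Let row_setC A : g_sigma_preimage coord A -> g_sigma_preimage coord (~` A).
Proof. exact: sigma_algebraC. Qed.

Let row_bigcup (F : (set 'rV[R]_n)^nat) :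
  (forall i, g_sigma_preimage coord (F i)) ->
  g_sigma_preimage coord (\bigcup_i (F i)).
Proof. exact: sigma_algebra_bigcup. Qed.

HB.instance Definition _ := @isMeasurable.Build default_measure_display
  'rV[R]_n (g_sigma_preimage coord) row_set0 row_setC row_bigcup.

Lemma measurable_coord (i : 'I_n) :
  measurable_fun setT (fun x : 'rV[R]_n => x 0 i).
Proof.
move=> _ Y mY; rewrite setTI; apply: sub_sigma_algebra => /=.
rewrite -bigcup_seq/=; exists i => /=; first by rewrite mem_index_enum.
by exists Y => //; rewrite setTI.
Qed.

End RowMeasurable.

Section LebesgueRow.
Context {R : realType}.

Definition row_cons n (p : measurableTypeR R * 'rV[R]_n) : 'rV[R]_n.+1 :=
  row_mx (p.1)%:M p.2 : 'rV[R]_(1 + n).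

Lemma measurable_row_cons n : measurable_fun setT (@row_cons n).
Proof.
have H i : measurable_fun setT (fun p => @row_cons n p 0 i : measurableTypeR R).
  case: (split_ordP (i : 'I_(1 + n))) => j ->.
    apply: (eq_measurable_fun fst); last exact: measurable_fst.
    by move=> p _; rewrite /row_cons (row_mxEl _ _ 0 j) mxE !ord1.
  apply: (eq_measurable_fun ((fun x : 'rV[R]_n => x 0 j) \o snd)).
    by move=> p _; exact/esym/(row_mxEr (p.1)%:M).
  apply: measurableT_comp; first exact: measurable_coord.
  exact: measurable_snd.
move=> _ Y mY.
suff : g_sigma_preimage (fun (i : 'I_n.+1) (x : 'rV[R]_n.+1) =>
         (x 0 i : measurableTypeR R)) `<=`
       [set A | measurable (@row_cons n @^-1` A)].
  by rewrite setTI; apply.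
apply: smallest_sub.
  split.
  - by rewrite /= preimage_set0; exact: measurable0.
  - by move=> A mA; rewrite /= setTD preimage_setC; exact: measurableC.
  - move=> A mA; rewrite /= preimage_bigcup.
    by apply: bigcup_measurable => k _; exact: mA.
rewrite -bigcup_mkord_ord => A [i _ [B mB <-]] /=; rewrite setTI.
by have := H (inord i) measurableT B mB; rewrite setTI.
Qed.

(* Lebesgue measure on R^n.  The measure structure on [pushforward] needs the
   measurability proof, which is therefore passed explicitly. *)
Fixpoint leb n : {measure set 'rV[R]_n -> \bar R} :=
  match n with
  | 0 => \d_(0 : 'rV[R]_0)
  | n'.+1 => measure_function_pushforward__canonical__measure_function_Measure
      (lebesgue_measure \x^ leb n')%E (@measurable_row_cons n')
  end.

Lemma lebS n A :
  leb n.+1 A = pushforward (lebesgue_measure \x^ leb n)%E (@row_cons n) A.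
Proof. by []. Qed.

End LebesgueRow.

Section Schwartz.
Context {R : realType} (n : nat).
Implicit Types (f g : 'rV[R]_n -> R[i]) (l : seq 'I_n).

Definition enorm (x : 'rV[R]_n) : R := Num.sqrt (\sum_i x 0 i ^+ 2).

Definition dotrv (x y : 'rV[R]_n) : R := \sum_i x 0 i * y 0 i.

Definition partials l (f : 'rV[R]_n -> R) : 'rV[R]_n -> R :=
  foldr (fun i h x => 'D_(delta_mx 0 i) h x) f l.

Definition cpartials l f (x : 'rV[R]_n) : R[i] :=
  partials l (fun y => complex.Re (f y)) x +i*
  partials l (fun y => complex.Im (f y)) x.

Definition smooth f : Prop := forall l x,
  differentiable (partials l (fun y => complex.Re (f y))) x /\
  differentiable (partials l (fun y => complex.Im (f y))) x.

Definition seminorm (N : nat) f : \bar R :=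
  ereal_sup [set y | exists l x, (size l <= N)%N /\
    y = ((1 + enorm x) ^+ N * cmod (cpartials l f x))%:E].

Definition schwartz f : Prop :=
  smooth f /\ forall N, (seminorm N f < +oo)%E.

(* S'(R^n).  A functional is a total function on ['rV[R]_n -> R[i]], but only
   its values on Schwartz functions are constrained or used.  A distribution u
   is complex-linear, [u f] standing for the integral of u times f; the
   sesquilinear bracket <u, f> is [pairing u f]. *)
Definition tempered (u : ('rV[R]_n -> R[i]) -> R[i]) : Prop :=
  (forall (a : R[i]) f g, schwartz f -> schwartz g ->
     u (fun x => a * f x + g x) = a * u f + u g) /\
  (exists (C : R) (N : nat), forall f, schwartz f ->
     ((cmod (u f))%:E <= C%:E * seminorm N f)%E).

Definition pairing (u : ('rV[R]_n -> R[i]) -> R[i]) f : R[i] :=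
  u (fun x => (f x)^*).

Definition e2pi (x : R) : R[i] := cos (2 * pi * x) +i* sin (2 * pi * x).

Definition transl (x : 'rV[R]_n) f : 'rV[R]_n -> R[i] := fun t => f (t - x).

Definition modul (xi : 'rV[R]_n) f : 'rV[R]_n -> R[i] :=
  fun t => e2pi (dotrv t xi) * f t.

Definition cint f : R[i] :=
  (\int[leb n]_x complex.Re (f x)) +i* (\int[leb n]_x complex.Im (f x)).

End Schwartz.

Section Modulation.
Context {R : realType}.

(* The norm of L^{q_1,...,q_n}: the first coordinate is innermost. *)
Fixpoint mixed_norm n :
    ('I_n -> \bar R) -> ('rV[R]_n -> \bar R) -> \bar R :=
  match n with
  | 0 => fun _ F => F 0
  | n'.+1 => fun q F =>
      mixed_norm (fun i => q (lift ord0 i))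
        (fun y => Lnorm lebesgue_measure (q ord0) (fun x => F (row_cons (x, y))))
  end.

Definition weight n (s : R) (z : 'rV[R]_n) : R := (1 + enorm z) `^ s.

Definition gabor n (phi : 'rV[R]_n -> R[i])
    (u : ('rV[R]_n -> R[i]) -> R[i]) (z : 'rV[R]_(n + n)) : R[i] :=
  pairing u (modul (rsubmx z) (transl (lsubmx z) phi)).

Definition modulation_norm n (phi : 'rV[R]_n -> R[i]) (c : 'S_(n + n))
    (q : 'I_(n + n) -> \bar R) (w : 'rV[R]_(n + n) -> R)
    (u : ('rV[R]_n -> R[i]) -> R[i]) : \bar R :=
  mixed_norm q (fun z => (cmod (gabor phi u (col_perm c z)) * w z)%:E).

Definition in_modulation n (phi : 'rV[R]_n -> R[i]) (c : 'S_(n + n))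
    (q : 'I_(n + n) -> \bar R) (w : 'rV[R]_(n + n) -> R)
    (u : ('rV[R]_n -> R[i]) -> R[i]) : Prop :=
  tempered u /\ (modulation_norm phi c q w u < +oo)%E.

End Modulation.

(* Indices are 0-based: {1..d} is [i < d], {2d+1..3d} is [2d <= i < 3d], etc. *)
Definition slice_perm d (c : 'S_((d + d) + (d + d))) : Prop :=
  c @: [set i : 'I_((d + d) + (d + d)) |
         (i < d)%N || (2 * d <= i < 3 * d)%N]%SET
    = [set i : 'I_((d + d) + (d + d)) | (i < 2 * d)%N]%SET /\
  c @: [set i : 'I_((d + d) + (d + d)) |
         (d <= i < 2 * d)%N || (3 * d <= i)%N]%SET
    = [set i : 'I_((d + d) + (d + d)) | (2 * d <= i)%N]%SET.

Section L2.
Context {R : realType} (d : nat).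
Implicit Types (f g : 'rV[R]_d -> R[i]).
Implicit Types (T : ('rV[R]_d -> R[i]) -> ('rV[R]_d -> R[i])).
Implicit Types (A : ('rV[R]_d -> R[i]) -> (('rV[R]_d -> R[i]) -> R[i])).

Definition L2norm f : \bar R := Lnorm (leb d) 2%:E (fun x => (cmod (f x))%:E).

Definition L2 f : Prop :=
  [/\ measurable_fun setT (fun x => complex.Re (f x)),
      measurable_fun setT (fun x => complex.Im (f x)) & (L2norm f < +oo)%E].

Definition L2dot f g : R[i] := cint (fun x => f x * (g x)^*).

(* Elements of L^2(R^d) are represented by functions, so operators are linear
   up to null sets; with the bound this also makes them compatible with almost
   everywhere equality. *)
Definition L2_bounded_op T : Prop :=
  [/\ forall f, L2 f -> L2 (T f),
      forall (a : R[i]) f g, L2 f -> L2 g ->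
        \forall x \ae leb d, T (fun y => a * f y + g y) x = a * T f x + T g x
    & exists B : R, forall f, L2 f -> (L2norm (T f) <= B%:E * L2norm f)%E].

Definition orthonormal_seq (f : nat -> 'rV[R]_d -> R[i]) : Prop :=
  (forall m, L2 (f m)) /\ forall m k, L2dot (f m) (f k) = (m == k)%:R.

Definition schatten_norm (p : R) T : \bar R :=
  ereal_sup [set y | exists f g : nat -> 'rV[R]_d -> R[i],
    [/\ orthonormal_seq f, orthonormal_seq g &
    y = ((\sum_(0 <= k <oo) ((cmod (L2dot (T (f k)) (g k))) `^ p)%:E)
           `^ p^-1)%E]].

(* A : S(R^d) -> S'(R^d) belongs to I_p(L^2(R^d)): it defines a bounded operator
   on L^2(R^d), and that operator is Schatten p-class. *)
Definition in_schatten (p : R) A : Prop :=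
  exists T, [/\ L2_bounded_op T,
    forall f g, schwartz f -> schwartz g -> L2dot (T f) g = pairing (A f) g
    & (schatten_norm p T < +oo)%E].

End L2.

Section PseudoDifferential.
Context {R : realType} (d : nat).
Implicit Types (k tau : ('rV[R]_(d + d) -> R[i]) -> R[i]).
Implicit Types (f g : 'rV[R]_d -> R[i]) (F : 'rV[R]_(d + d) -> R[i]).

Definition tensor f g : 'rV[R]_(d + d) -> R[i] :=
  fun z => f (lsubmx z) * g (rsubmx z).

Definition F2inv F : 'rV[R]_(d + d) -> R[i] :=
  fun z => cint (fun y : 'rV[R]_d =>
    F (row_mx (lsubmx z) y) * e2pi (dotrv y (rsubmx z))).

Definition Nmap (z : 'rV[R]_(d + d)) : 'rV[R]_(d + d) :=
  row_mx (lsubmx z) (lsubmx z - rsubmx z).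

(* F2inv is symmetric for the bilinear pairing, so it acts on distributions by
   duality; so does composition with Nmap, an involution of determinant +-1. *)
Definition dist_F2inv tau : ('rV[R]_(d + d) -> R[i]) -> R[i] :=
  fun F => tau (F2inv F).

Definition dist_compN k : ('rV[R]_(d + d) -> R[i]) -> R[i] :=
  fun F => k (fun z => F (Nmap z)).

Definition kn_kernel tau : ('rV[R]_(d + d) -> R[i]) -> R[i] :=
  dist_compN (dist_F2inv tau).

(* Bilinear form of <A f, g> = <k, g (x) conj f>; see the lemma below. *)
Definition integral_op k f : ('rV[R]_d -> R[i]) -> R[i] :=
  fun g => k (tensor g f).

Lemma pairing_integral_op k f g :
  pairing (integral_op k f) g = pairing k (tensor g (fun y => (f y)^*)).
Proof.
rewrite /pairing /integral_op; congr k; apply/funext => z.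
by rewrite /tensor rmorphM /= conjcK.
Qed.

(* K_tau f(t) = \iint \hat tau(xi, x) M_xi T_{-x} f(t) dx dxi has the integral
   kernel (F_2^{-1} tau) o N, which is what defines it for distributional tau. *)
Definition psido tau := integral_op (kn_kernel tau).

End PseudoDifferential.

(* Main.v *)
(* A counterexample is the operator with kernel [sum_n a_n k_n], where
   [a_n = (1 + n)^-r] and [k_n(t, y) = h_n(t) h'_n(y)] with [h_n], [h'_n] Gaussians
   moved [n] steps along fixed vectors of phase space.  Its symbol is, up to a
   constant, [sum_n a_n tau_n] with [tau_n] a modulated translate of the chirped
   Gaussian [e^(-2 pi i x.w) gamma(x) gamma(w)].  In both cases the Gabor transform
   concentrates near the points [n v] of a line, hence decays like [|z_i|^-r] in one
   coordinate and quadratically in the others after a shear; so its mixed norm is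
   finite when [(r - s) q > 1] for the exponent [q] carried by coordinate [i].

   - If [i] is an outer coordinate, take [r = 1/p] and move both variables.  The
     operator is then nearly diagonal: on orthonormal boxes moved [2n] steps its
     matrix elements are at least [c (1 + 2n)^-(1/p)], whose [p]-th powers diverge.
   - If [i] is an inner coordinate, take [r = 1/2] and move the first variable only.
     The operator sends one Gaussian to [sum_n a_n h_n], which is not in [L^2]
     because [sum_n a_n^2] diverges.  For the symbol in the position case both
     variables move again, which suffices since [p <= 2].

   All overlaps are nonnegative, so that off-diagonal terms can be dropped.  Boxes
   are not Schwartz functions; they are [L^2] limits of
   [exp (- sum_k (M + 1) (2 t_k)^(2 M + 2))]. *)

Require Import Defs.
From HB Require Import structures.
From mathcomp Require Import all_boot all_order all_algebra.
From mathcomp Require Import perm complex.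
From mathcomp Require Import all_classical all_reals all_analysis.
From mathcomp Require Import measurable_realfun ess_sup_inf ring lra zify.

Set Implicit Arguments.
Unset Strict Implicit.
Unset Printing Implicit Defensive.

Import Order.TTheory GRing.Theory Num.Theory.
Import numFieldNormedType.Exports.

Local Open Scope ring_scope.

(** * Integration on row vectors *)

(** The exponent [r] is critical: [(1 + n)^-r] just fails to lie in l^p for [r = 1/p] and in l^2 for
    [r = 1/2], while [(r - s) q > 1] holds as soon as (a), (b) or (c) makes one of [s <= 0],
    [q >= 2], [q >= p] strict at the chosen coordinate. The obstacle is that a moving pair of
    Gaussians may leave its trace in two coordinates of the Gabor transform, of which only one
    carries this borderline exponent. The other must be integrated earlier, so that a shear removes
    its dependence on the first. The slice condition places the coordinates of the first variable
    before those of the second, and this decides which steps are admissible. For symbols, kernel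
    steps [(x1, x2, y1, y2)] become [(x1, -y2, y1 + y2, x2 - x1)], and unwanted components are
    cancelled by the choice of [x2] and [y2]. A hypothetical Schatten operator is tied to the kernel
    only through its matrix elements between Schwartz functions. Lower bounds are therefore proved
    for smooth bumps, uniformly in the degree of approximation, and boundedness on L^2 carries them
    over to the boxes, whose shifts are exactly orthonormal. *)

Section RowMeasure.
Local Open Scope classical_set_scope.
Context {R : realType}.

Lemma measurable_rowP d (T : measurableType d) n (f : T -> 'rV[R]_n) :
  (forall i, measurable_fun setT (fun t => f t 0 i : measurableTypeR R)) ->
  measurable_fun setT f.
Proof.
move=> mf _ Y mY; rewrite setTI.
suff : g_sigma_preimage (fun (i : 'I_n) (x : 'rV[R]_n) =>
    (x 0 i : measurableTypeR R)) `<=` [set A | measurable (f @^-1` A)].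
  exact.
apply: smallest_sub.
  split.
  - by rewrite /= preimage_set0; exact: measurable0.
  - by move=> A mA; rewrite /= setTD preimage_setC; exact: measurableC.
  - move=> A mA; rewrite /= preimage_bigcup.
    by apply: bigcup_measurable => k _; exact: mA.
rewrite -bigcup_seq => A [i _ [B mB <-]] /=; rewrite setTI.
by have := mf i measurableT B mB; rewrite setTI.
Qed.

(* A continuous f is the pointwise limit of its compositions with roundings to
   finer and finer grids; these are measurable since they take countably many
   values. *)
Lemma continuous_row_measurable n (f : 'rV[R]_n -> R) :
  continuous f -> measurable_fun setT (f : _ -> measurableTypeR R).
Proof.
move=> cf.
pose fl m (x : 'rV[R]_n) : 'rV[int]_n := \row_i Num.floor (x 0 i * m.+1%:R).
pose q m (z : 'rV[int]_n) : 'rV[R]_n := \row_i ((z 0 i)%:~R / m.+1%:R).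
apply: (@measurable_fun_cvg _ _ _ setT (fun m x => f (q m (fl m x)))).
  move=> m _ Y mY; rewrite setTI.
  rewrite (_ : _ @^-1` _ = \bigcup_(z in [set z | Y (f (q m z))])
     \bigcap_(i in [set: 'I_n])
       [set x : 'rV[R]_n | Num.floor (x 0 i * m.+1%:R) = z 0 i]).
    rewrite bigcup_mkcond; apply: countable_bigcupT_measurable => // z.
    case: ifPn => // _; apply: fin_bigcap_measurable => // i _.
    rewrite (_ : [set _ | _] = (fun x : 'rV[R]_n => x 0 i) @^-1`
       `[(z 0 i)%:~R / m.+1%:R, (z 0 i + 1)%:~R / m.+1%:R[).
      by rewrite -[X in measurable X]setTI; exact: measurable_coord.
    apply/seteqP; split => x /=; rewrite in_itv/= ler_pdivrMr// ltr_pdivlMr//.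
      by move=> <-; rewrite floor_itv.
    by move=> H; apply/eqP; rewrite floor_eq.
  apply/seteqP; split => x /=.
    by move=> Yx; exists (fl m x) => // i _ /=; rewrite mxE.
  move=> [z /= Yz H]; suff -> : fl m x = z by [].
  by apply/rowP => i; rewrite mxE; exact: H.
move=> x _; apply: (@cvg_comp _ _ _ (fun m => q m (fl m x)) f _ (nbhs x)).
  apply/cvg_ballP => e e0.
  have := @cvg_harmonic R => /cvgrPdist_lt /(_ _ e0) [N _ HN].
  exists N => // m /HN /=; rewrite sub0r normrN => me; split => // i j.
  rewrite (ord1 i) !mxE /ball/= distrC; apply: le_lt_trans me.
  have /andP[l1 l2] := floor_itv (x 0 j * m.+1%:R).
  rewrite /harmonic /= [leRHS]ger0_norm ?invr_ge0// ler_norml.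
  rewrite lerBrDr -(@ler_pM2r _ m.+1%:R)// mulrDl mulNr mulVf ?pnatr_eq0// divfK ?pnatr_eq0//.
  rewrite lerBlDr -(@ler_pM2r _ m.+1%:R _ (_ / _))// mulrDl mulVf ?pnatr_eq0// divfK ?pnatr_eq0//.
  move: l2; rewrite rmorphD/= => l2.
  by apply/andP; split; lra.
exact: cf.
Qed.

Lemma measurable_row_mx n m :
  measurable_fun setT (fun p : 'rV[R]_n * 'rV[R]_m => row_mx p.1 p.2).
Proof.
apply: measurable_rowP => i; case: (split_ordP i) => j ->.
- under eq_fun do rewrite row_mxEl.
  by apply: (measurableT_comp (measurable_coord j)); exact: measurable_fst.
- under eq_fun do rewrite row_mxEr.
  by apply: (measurableT_comp (measurable_coord j)); exact: measurable_snd.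
Qed.

End RowMeasure.

(** * Sigma-finiteness and Tonelli's theorem for Lebesgue measure on rows *)

Section Tonelli.
Local Open Scope classical_set_scope.
Local Open Scope ereal_scope.
Context {R : realType}.
Local Notation mu := (@lebesgue_measure R).

Lemma row_consE n (x : R) (y : 'rV[R]_n) i :
  row_cons (x, y) 0%R i = if unlift ord0 i is Some j then y 0%R j else x.
Proof.
case: (split_ordP (i : 'I_(1 + n))) => j ->.
- rewrite /row_cons (row_mxEl _ _ 0%R j) mxE !ord1.
  have -> : lshift n (0%R : 'I_1) = (ord0 : 'I_n.+1) by exact/val_inj.
  by rewrite unlift_none.
- transitivity (y 0%R j); first exact: (row_mxEr x%:M y).
  have -> : rshift 1 j = (lift ord0 j : 'I_n.+1) by exact/val_inj.
  by rewrite liftK.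
Qed.

Lemma row_cons0 n (x : R) (y : 'rV[R]_n) : row_cons (x, y) 0%R ord0 = x.
Proof. by rewrite row_consE unlift_none. Qed.

Lemma row_consS n (x : R) (y : 'rV[R]_n) j : row_cons (x, y) 0%R (lift ord0 j) = y 0%R j.
Proof. by rewrite row_consE liftK. Qed.

Lemma measurable_row_box n (A : 'I_n -> set (measurableTypeR R)) :
  (forall i, measurable (A i)) ->
  measurable [set x : 'rV[R]_n | forall i, A i (x 0%R i)].
Proof.
move=> mA.
rewrite (_ : [set _ | _] = \bigcap_(i in [set: 'I_n])
    (fun x : 'rV[R]_n => x 0%R i) @^-1` A i).
  apply: fin_bigcap_measurable => // i _.
  by rewrite -[X in measurable X]setTI; apply: measurable_coord => //; exact: mA.
by apply/seteqP; split => x /= H i; [move=> _|]; exact: H.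
Qed.

Lemma sigma_finite_leb n : sigma_finite [set: 'rV[R]_n] (leb n).
Proof.
pose I k : set (measurableTypeR R) := `[(- k%:R)%R, k%:R%R]%classic.
exists (fun k => [set x : 'rV[R]_n | forall i, I k (x 0%R i)]).
  apply/esym; rewrite -subTset => x _.
  pose M := (\sum_i `|x 0%R i|)%R.
  have HM i : (`|x 0%R i| <= M)%R.
    by rewrite /M (bigD1 i)//= lerDl; exact: sumr_ge0.
  exists (Num.truncn M).+1 => // i; rewrite /I/= in_itv/= -ler_norml.
  by rewrite (le_trans (HM i))// ltW// truncnS_gt.
have mI k : measurable (I k) by exact: measurable_itv.
move=> k; split; first exact: (@measurable_row_box n (fun=> I k)).

elim: n => [|m IH].
  by rewrite /= diracE; case: (_ \in _); rewrite ltry.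
rewrite lebS /pushforward.
rewrite (_ : _ @^-1` _ = I k `*`
    [set x : 'rV[R]_m | forall i, I k (x 0%R i)]); last first.
  apply/seteqP; split => -[x y] /=.
    move=> H; split.
      by have := H ord0; rewrite row_cons0.
    by move=> i; have := H (lift ord0 i); rewrite row_consS.
  move=> [Hx Hy] i; rewrite row_consE; case: unliftP => [j _|_] //.
rewrite product_measure2E//; last exact: (@measurable_row_box m (fun=> I k)).
rewrite lte_mul_pinfty//.
suff: lebesgue_measure (I k) \is a fin_num by [].
by rewrite /I lebesgue_measure_itv/=; case: ifP.
Qed.

(* An alias of [leb n] to which the sigma-finiteness structure needed by
   Fubini-Tonelli can be attached. *)
Definition lebs n : set 'rV[R]_n -> \bar R := leb n.
HB.instance Definition _ n := Measure.copy (@lebs n) (leb n).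
HB.instance Definition _ n :=
  @Measure_isSigmaFinite.Build _ _ _ (@lebs n) (sigma_finite_leb n).

Lemma leb_tonelli n (f : 'rV[R]_n.+1 -> \bar R) :
  measurable_fun setT f -> (forall x, 0 <= f x) ->
  \int[leb n.+1]_z f z = \int[mu]_x \int[leb n]_y f (row_cons (x, y)).
Proof.
move=> mf f0.
have mg : measurable_fun setT (f \o @row_cons R n).
  by apply: measurableT_comp => //; exact: measurable_row_cons.
have /= H := @fubini_tonelli1 _ _ _ _ R mu (@lebs n) _ mg (fun z => f0 (row_cons z)).
rewrite [RHS](_ : _ = \int[mu \x lebs (n:=n)]_z (f \o @row_cons R n) z); last by rewrite H.
transitivity (\int[pushforward (lebesgue_measure \x^ lebs (n:=n)) (@row_cons R n)]_z f z).
  by [].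
rewrite ge0_integral_pushforward//; [|exact: measurable_row_cons].
(* The product [\x^] used to define [leb] and the product [\x] of Tonelli's theorem agree on
   rectangles, hence on all measurable sets. *)
rewrite preimage_setT; apply: eq_measure_integral => A mA _.
apply/esym/product_measure_unique => // B C mB mC.
by rewrite [LHS]product_measure2E.
Qed.

End Tonelli.

Section RowIntegral.
Local Open Scope classical_set_scope.
Local Open Scope ereal_scope.
Context {R : realType}.
Local Notation mu := (@lebesgue_measure R).

Lemma measurable_row_mxr n m (x : 'rV[R]_n) :
  measurable_fun setT (fun y : 'rV[R]_m => row_mx x y).
Proof.
apply: measurable_rowP => i; case: (split_ordP i) => j ->.
- by under eq_fun do rewrite row_mxEl; exact: measurable_cst.
- by under eq_fun do rewrite row_mxEr; exact: measurable_coord.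
Qed.

Lemma measurable_row_consr n (x : R) :
  measurable_fun setT (fun y : 'rV[R]_n => row_cons (x, y)).
Proof.
apply: measurable_rowP => i; case: (unliftP ord0 i) => [j ->|->].
- by under eq_fun do rewrite row_consS; exact: measurable_coord.
- by under eq_fun do rewrite row_cons0; exact: measurable_cst.
Qed.

Lemma row_cons_mx m n (x : R) (u : 'rV[R]_m) (y : 'rV[R]_n) :
  row_cons (x, row_mx u y) = row_mx (row_cons (x, u)) y.
Proof.
apply/rowP => i; rewrite (row_consE x (row_mx u y) i).
case: (split_ordP (i : 'I_(m.+1 + n))) => j ->.
- rewrite (row_mxEl (row_cons (x, u)) y); case: (unliftP ord0 j) => [k ->|->].
  + rewrite row_consS.
    have -> : lshift n (lift ord0 k) = lift ord0 (lshift n k) :> 'I_(m + n).+1.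
      exact/val_inj.
    by rewrite liftK row_mxEl.
  + rewrite row_cons0.
    have -> : lshift n (ord0 : 'I_m.+1) = ord0 :> 'I_(m + n).+1 by exact/val_inj.
    by rewrite unlift_none.
- rewrite (row_mxEr (row_cons (x, u)) y).
  have -> : rshift m.+1 j = lift ord0 (rshift m j) :> 'I_(m + n).+1.
    exact/val_inj.
  by rewrite liftK row_mxEr.
Qed.

Lemma leb_split m n (f : 'rV[R]_(m + n) -> \bar R) :
  measurable_fun setT f -> (forall x, 0 <= f x) ->
  \int[leb (m + n)]_z f z = \int[leb m]_x \int[leb n]_y f (row_mx x y).
Proof.
elim: m f => [|m IH] f mf f0.
  rewrite [RHS]integral_dirac//; last first.
   move=> _ Y mY; rewrite setTI.
   have [H|H] := pselect (Y (\int[leb n]_y f (row_mx (0%R : 'rV_0) y))).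
     rewrite (_ : _ @^-1` _ = setT)//; apply/seteqP; split => // x _ /=.
     by rewrite thinmx0.
   rewrite (_ : _ @^-1` _ = set0)//; apply/seteqP; split => // x /=.
   by rewrite thinmx0.
  by rewrite diracT mul1e; apply: eq_integral => y _; rewrite row_thin_mx.
rewrite (@leb_tonelli R (m + n) f)// [RHS]leb_tonelli//; first last.
- by move=> x; exact: integral_ge0.
- apply: (@measurable_fun_fubini_tonelli_F _ _ _ _ R (@lebs R n) (f \o (fun p => row_mx p.1 p.2))).
    by apply: measurableT_comp => //; exact: measurable_row_mx.
  by move=> ? /=.
apply: eq_integral => x _; rewrite (IH (fun z => f (row_cons (x, z)))).
- by apply: eq_integral => u _; apply: eq_integral => y _; rewrite row_cons_mx.
- exact: (measurableT_comp mf (measurable_row_consr x)).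
- by move=> z; exact: f0.
Qed.

Lemma leb_prodE m n A : measurable A ->
  leb (m + n) A = (@lebs R m \x @lebs R n) ((fun p => row_mx p.1 p.2) @^-1` A).
Proof.
move=> mA.
have mB : measurable ((fun p : 'rV[R]_m * 'rV[R]_n => row_mx p.1 p.2) @^-1` A).
  by rewrite -[X in measurable X]setTI; apply: measurable_row_mx.
have indic_ge0 (A' : set 'rV[R]_(m + n)) z : 0%:E <= (\1_A' z : R)%:E.
  by rewrite lee_fin.
have mA1 : measurable_fun setT (fun z : 'rV[R]_(m + n) => (\1_A z : R)%:E).
  by apply/measurable_EFinP; exact: measurable_indic.
have mB1 : measurable_fun setT (fun p : 'rV[R]_m * 'rV[R]_n =>
    (\1_A (row_mx p.1 p.2) : R)%:E).
  by apply: (measurableT_comp mA1); exact: measurable_row_mx.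
have := leb_split mA1 (fun x => indic_ge0 A x).
rewrite integral_indic// setIT => ->.
rewrite -(@fubini_tonelli1 _ _ _ _ R (@lebs R m) (@lebs R n) _ mB1)//.
transitivity (\int[lebs (n:=m) \x lebs (n:=n)]_z
    (\1_((fun p => row_mx p.1 p.2) @^-1` A) z : R)%:E); first by [].
by rewrite integral_indic// setIT.
Qed.

(** Lebesgue measure is determined by its values on half-open intervals, whose lengths a translation
    preserves. *)
Lemma mu_shift (a : R) (f : R -> \bar R) : measurable_fun setT f ->
  (forall x, 0 <= f x) -> \int[mu]_x f (x + a)%R = \int[mu]_x f x.
Proof.
move=> mf f0.
have ms : measurable_fun setT ((fun x => x + a)%R : measurableTypeR R -> measurableTypeR R).
  by apply: measurable_funD.
rewrite [RHS](_ : _ = \int[pushforward mu ((fun x => x + a)%R : measurableTypeR R -> measurableTypeR R)]_x f x).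
  by rewrite ge0_integral_pushforward// preimage_setT.
apply: eq_measure_integral => A mA _.
apply: lebesgue_measure_unique => // _ [[b c]] _ <-.
transitivity (lebesgue_measure `](b - a)%R, (c - a)%R]%classic).
  rewrite !lebesgue_measure_itv/= !lte_fin ltrD2r; case: ifP => // _.
  by rewrite -!EFinD; congr EFin; lra.
rewrite /= /pushforward; congr (lebesgue_measure _).
by apply/seteqP; split => x /=; rewrite !in_itv/= ltrBlDr lerBrDr.
Qed.

Lemma mu_opp (f : R -> \bar R) : measurable_fun setT f ->
  (forall x, 0 <= f x) -> \int[mu]_x f (- x)%R = \int[mu]_x f x.
Proof.
move=> mf f0.
rewrite [RHS](_ : _ = \int[pushforward mu (-%R : measurableTypeR R -> measurableTypeR R)]_x f x).
  by rewrite ge0_integral_pushforward// preimage_setT.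
by apply: eq_measure_integral => A mA _; apply/esym/lebesgue_measureN.
Qed.

Lemma measurable_shift n (a : 'rV[R]_n) : measurable_fun setT (fun x : 'rV[R]_n => x + a)%R.
Proof.
apply: measurable_rowP => i; under eq_fun do rewrite mxE.
apply: measurable_funD; [exact: measurable_coord|exact: measurable_cst].
Qed.

Lemma measurable_row_opp n : measurable_fun setT (fun x : 'rV[R]_n => - x)%R.
Proof.
apply: measurable_rowP => i; under eq_fun do rewrite mxE.
by apply: measurableT_comp => //; exact: measurable_coord.
Qed.

Let ge0_leb_shift n (a : 'rV[R]_n) (f : 'rV[R]_n -> \bar R) :
  measurable_fun setT f -> (forall x, 0 <= f x) ->
  \int[leb n]_x f (x + a)%R = \int[leb n]_x f x.
Proof.
elim: n a f => [|n IH] a f mf f0.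
  by apply: eq_integral => x _; rewrite !thinmx0.
rewrite [LHS]leb_tonelli//; last exact: (measurableT_comp mf (measurable_shift a)).
rewrite [RHS](leb_tonelli mf f0).
pose a' := \row_j a 0%R (lift ord0 j).
transitivity (\int[mu]_x \int[leb n]_y f (row_cons (x + a 0 ord0, y + a'))%R).
  apply: eq_integral => x _; apply: eq_integral => y _; congr f.
  apply/rowP => i; rewrite mxE !row_consE; case: unliftP => [j ->|->] //.
  by rewrite !mxE.
rewrite (@mu_shift (a 0%R ord0) (fun x => \int[leb n]_y f (row_cons (x, y + a'))%R)).
- apply: eq_integral => x _.
  apply: (IH a' (fun y => f (row_cons (x, y)))) => //.
  exact: (measurableT_comp mf (measurable_row_consr x)).
- apply: (@measurable_fun_fubini_tonelli_F _ _ _ _ R (@lebs R n) (fun p => f (row_cons (p.1, p.2 + a')%R))) => //.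
  apply: (measurableT_comp mf); apply: measurable_rowP => i.
  case: (unliftP ord0 i) => [j ->|->].
  + under eq_fun do rewrite row_consS.
    apply: (measurableT_comp (measurable_coord j)).
    by apply: (measurableT_comp (measurable_shift a')); exact: measurable_snd.
  + by under eq_fun do rewrite row_cons0; exact: measurable_fst.
- by move=> x; exact: integral_ge0.
Qed.

Let ge0_leb_opp n (f : 'rV[R]_n -> \bar R) :
  measurable_fun setT f -> (forall x, 0 <= f x) ->
  \int[leb n]_x f (- x)%R = \int[leb n]_x f x.
Proof.
elim: n f => [|n IH] f mf f0.
  by apply: eq_integral => x _; rewrite !thinmx0.
rewrite [LHS]leb_tonelli//; last exact: (measurableT_comp mf (@measurable_row_opp _)).
rewrite [RHS](leb_tonelli mf f0).
transitivity (\int[mu]_x \int[leb n]_y f (row_cons (- x, - y))%R).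
  apply: eq_integral => x _; apply: eq_integral => y _; congr f.
  apply/rowP => i; rewrite mxE; case: (unliftP ord0 i) => [j ->|->].
    by rewrite !row_consS mxE.
  by rewrite !row_cons0.
rewrite (@mu_opp (fun x => \int[leb n]_y f (row_cons (x, - y))%R)).
- apply: eq_integral => x _.
  apply: (IH (fun y => f (row_cons (x, y)))) => //.
  exact: (measurableT_comp mf (measurable_row_consr x)).
- apply: (@measurable_fun_fubini_tonelli_F _ _ _ _ R (@lebs R n) (fun p => f (row_cons (p.1, - p.2)%R))) => //.
  apply: (measurableT_comp mf); apply: measurable_rowP => i.
  case: (unliftP ord0 i) => [j ->|->].
  + under eq_fun do rewrite row_consS.
    apply: (measurableT_comp (measurable_coord j)).
    by apply: (measurableT_comp (@measurable_row_opp _)); exact: measurable_snd.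
  + by under eq_fun do rewrite row_cons0; exact: measurable_fst.
- by move=> x; exact: integral_ge0.
Qed.

Lemma leb_shift n (a : 'rV[R]_n) (f : 'rV[R]_n -> \bar R) :
  measurable_fun setT f -> \int[leb n]_x f (x + a)%R = \int[leb n]_x f x.
Proof.
move=> mf; rewrite integralE [RHS]integralE; congr (_ - _).
- transitivity (\int[leb n]_x f^\+ (x + a)%R).
    by apply: eq_integral => x _; rewrite !funeposE.
  by apply: ge0_leb_shift => //; exact: measurable_funepos.
- transitivity (\int[leb n]_x f^\- (x + a)%R).
    by apply: eq_integral => x _; rewrite !funenegE.
  by apply: ge0_leb_shift => //; exact: measurable_funeneg.
Qed.

Lemma leb_opp n (f : 'rV[R]_n -> \bar R) :
  measurable_fun setT f -> \int[leb n]_x f (- x)%R = \int[leb n]_x f x.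
Proof.
move=> mf; rewrite integralE [RHS]integralE; congr (_ - _).
- transitivity (\int[leb n]_x f^\+ (- x)%R).
    by apply: eq_integral => x _; rewrite !funeposE.
  by apply: ge0_leb_opp => //; exact: measurable_funepos.
- transitivity (\int[leb n]_x f^\- (- x)%R).
    by apply: eq_integral => x _; rewrite !funenegE.
  by apply: ge0_leb_opp => //; exact: measurable_funeneg.
Qed.

Lemma measurable_prodr n (f : 'I_n -> R -> R) :
  (forall i, measurable_fun setT (f i)) ->
  measurable_fun setT (fun t : 'rV[R]_n => \prod_i f i (t 0 i))%R.
Proof.
move=> mf; apply: measurable_prod => i _.
apply: (measurableT_comp (mf i)); exact: measurable_coord.
Qed.

Lemma leb_prod_ge0 n (f : 'I_n -> R -> R) :
  (forall i, measurable_fun setT (f i)) -> (forall i x, (0 <= f i x)%R) ->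
  \int[leb n]_t (\prod_i f i (t 0 i))%R%:E = \prod_i \int[mu]_x (f i x)%:E.
Proof.
elim: n f => [|n IH] f mf f0.
  rewrite integral_dirac//; last first.
    by under eq_fun do rewrite big_ord0; exact: measurable_cst.
  by rewrite diracT mul1e !big_ord0.
rewrite leb_tonelli; last 2 first.
- by apply/measurable_EFinP; exact: measurable_prodr.
- by move=> t; rewrite lee_fin; apply: prodr_ge0.
rewrite big_ord_recl -ge0_integralZr//; last 3 first.
- by apply/measurable_EFinP; exact: mf.
- by move=> x _; rewrite lee_fin.
- by apply: prode_ge0 => i _; apply: integral_ge0 => x _; rewrite lee_fin.
apply: eq_integral => x _; rewrite -IH// -ge0_integralZl_EFin//; last 2 first.
- by move=> t _; rewrite lee_fin; apply: prodr_ge0.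
- apply/measurable_EFinP.
  by apply: (@measurable_prodr _ (fun i => f (lift ord0 i))) => i; exact: mf.
apply: eq_integral => y _; rewrite big_ord_recl row_cons0 EFinM; congr (_ * (_)%:E).
by apply: eq_bigr => i _; rewrite row_consS.
Qed.

End RowIntegral.

(** * Polynomial weights *)

Section Weights.
Local Open Scope classical_set_scope.
Context {R : realType}.
Local Notation mu := (@lebesgue_measure R).
Implicit Types (a x y : R).

(** With [1 + |x|] in place of a smooth substitute such as [1 + x^2], Peetre's inequality below has
    constant 1. The sign makes a larger [a] mean faster decay. *)
Definition pw a x : R := (1 + `|x|) `^ (- a).

Lemma pw_gt0 a x : 0 < pw a x.
Proof. by apply: powR_gt0; rewrite ltr_pwDl. Qed.

Lemma pw_ge0 a x : 0 <= pw a x. Proof. exact/ltW/pw_gt0. Qed.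

Lemma pwD a b x : pw (a + b) x = pw a x * pw b x.
Proof.
rewrite /pw opprD powRD//; apply/implyP => _.
by rewrite gt_eqF// ltr_pwDl.
Qed.

Lemma pw0 x : pw 0 x = 1. Proof. by rewrite /pw oppr0 powRr0. Qed.

Lemma pwN a x : pw a (- x) = pw a x. Proof. by rewrite /pw normrN. Qed.

Lemma pw_anti a b x : a <= b -> pw b x <= pw a x.
Proof. by move=> ab; apply: ler_powR; rewrite ?lerN2// lerDl. Qed.

Lemma pw_le1 a x : 0 <= a -> pw a x <= 1.
Proof. by move=> a0; rewrite -(pw0 x); exact: pw_anti. Qed.

Lemma pw_mono a x y : 0 <= a -> `|y| <= `|x| -> pw a x <= pw a y.
Proof.
move=> a0 yx; rewrite /pw !powRN lef_pV2 ?posrE ?powR_gt0 ?ltr_pwDl//.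
by rewrite ge0_ler_powR ?nnegrE ?addr_ge0// lerD2l.
Qed.

(** Peetre's inequality, from [1 + |x + y| <= (1 + |x|) (1 + |y|)]. It converts decay around one
    point into decay around another. *)
Lemma pw_peetre a x y : 0 <= a -> pw a x * pw a y <= pw a (x + y).
Proof.
move=> a0; rewrite /pw -powRM ?addr_ge0//.
rewrite !powRN lef_pV2 ?posrE ?powR_gt0 ?mulr_gt0 ?ltr_pwDl//.
rewrite ge0_ler_powR ?nnegrE ?mulr_ge0 ?addr_ge0//.
have := ler_normD x y; have := normr_ge0 x; have := normr_ge0 y; nra.
Qed.

Lemma pw_nat n x : pw n%:R x = (1 + `|x|) ^- n.
Proof. by rewrite /pw powR_invn// addr_ge0. Qed.

Lemma continuous_pw a : continuous (pw a).
Proof.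
move=> x; rewrite /pw.
have H : 0 < 1 + `|x| by rewrite ltr_pwDl.
apply: (@continuous_comp _ _ _ (fun x => 1 + `|x|) (fun y => y `^ (- a))).
  by apply: cvgD; [exact: cvg_cst|exact: cvg_norm].
have [+ _] := @is_derive1_powR R (- a) _ H.
by move=> /derivable1_diffP/differentiable_continuous.
Qed.

Lemma measurable_pw a : measurable_fun setT (pw a).
Proof. by apply: continuous_measurable_fun; exact: continuous_pw. Qed.

Lemma integral_pw_lty a : 1 < a -> (\int[mu]_x (pw a x)%:E < +oo)%E.
Proof.
move=> a1.
rewrite ge0_symfun_integralT; last 3 first.
- by move=> x; exact: pw_ge0.
- exact: continuous_pw.
- by move=> x /=; rewrite pwN.
apply: lte_mul_pinfty => //.
have -> : [set x : R | 0 <= x] = `[0, +oo[%classic by rewrite set_itvcy.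
pose F x : R := - (a - 1)^-1 * (1 + x) `^ (1 - a).
have a10 : a - 1 != 0 by rewrite subr_eq0 gt_eqF.
have dF x : 0 <= x -> is_derive x 1 F ((1 + x) `^ (- a)).
  move=> x0; rewrite /F.
  have H : is_derive (1 + x : R) 1 (fun y => y `^ (1 - a)) ((1 - a) * (1 + x) `^ (1 - a - 1)).
    by apply: is_derive1_powR; rewrite ltr_pwDl.
  have H2 : is_derive x 1 (fun x : R => 1 + x) 1.
    by apply: (is_derive_eq (is_deriveD _ _)); rewrite add0r.
  have H3 := @is_derive1_comp _ (fun y => y `^ (1 - a)) (fun x => 1 + x) x _ _ H H2.
  have H4 := is_deriveZ (- (a - 1)^-1) H3.
  apply: (is_derive_eq H4).
  rewrite /GRing.scale/= mulr1 mulrA -[1 - a - 1]addrAC subrr sub0r.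
  by rewrite -[1 - a]opprB mulrNN mulVf// mul1r.
rewrite (@ge0_continuous_FTC2y R (pw a) F 0 0); last 6 first.
- by move=> x _; exact: pw_ge0.
- by apply: continuous_subspaceT; exact: continuous_pw.
- rewrite -[X in _ --> X](mulr0 (- (a - 1)^-1)); apply: cvgM; first exact: cvg_cst.
  apply/cvgrPdist_lt => e e0.
  (* For [x] beyond this threshold, [x^(a-1)] already exceeds [1/e]. *)
  exists (e `^ (- (a - 1)^-1)); split; first exact: num_real.
  move=> x ex; rewrite sub0r normrN ger0_norm ?powR_ge0//.
  have x0 : 0 < x by apply: le_lt_trans ex; exact: powR_ge0.
  have -> : 1 - a = - (a - 1) by rewrite opprB.
  rewrite powRN invf_plt ?posrE ?powR_gt0 ?ltr_pwDl ?ltW//.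
  have -> : e^-1 = (e `^ (- (a - 1)^-1)) `^ (a - 1).
    by rewrite -powRrM mulNr mulVf// powRN powRr1// ltW.
  apply: gt0_ltr_powR; rewrite ?nnegrE ?subr_gt0 ?powR_ge0//.
    by rewrite addr_ge0// ltW.
  by rewrite (lt_le_trans ex)// lerDr.
- by move=> x x0; have := dF x (ltW x0); case.
- have : derivable F 0 1 by have := dF 0 (lexx _); case.
  move=> /derivable1_diffP/differentiable_continuous => cF.
  exact: cvg_at_right_filter.
- move=> x; rewrite in_itv/= andbT => x0; rewrite derive1E.
  by have [_ ->] := dF x (ltW x0); rewrite /pw gtr0_norm.
by rewrite -EFinB ltry.
Qed.

(** A product over the coordinates, not a power of a norm: it factors over [row_mx], and it is
    integrable for every [a > 1] whatever the dimension. *)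
Definition wt n a (t : 'rV[R]_n) : R := \prod_i pw a (t 0 i).

Lemma wt_gt0 n a (t : 'rV[R]_n) : 0 < wt a t.
Proof. by apply: prodr_gt0 => i _; exact: pw_gt0. Qed.

Lemma wt_ge0 n a (t : 'rV[R]_n) : 0 <= wt a t.
Proof. exact/ltW/wt_gt0. Qed.

Lemma wtN n a (t : 'rV[R]_n) : wt a (- t) = wt a t.
Proof. by apply: eq_bigr => i _; rewrite mxE pwN. Qed.

Lemma wtD n a b (t : 'rV[R]_n) : wt (a + b) t = wt a t * wt b t.
Proof. by rewrite /wt -big_split; apply: eq_bigr => i _; exact: pwD. Qed.

Lemma wt_le1 n a (t : 'rV[R]_n) : 0 <= a -> wt a t <= 1.
Proof.
by move=> a0; apply: prodr_ile1 => i _; rewrite pw_ge0 pw_le1.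
Qed.

Lemma wt_peetre n a (x y : 'rV[R]_n) : 0 <= a -> wt a x * wt a y <= wt a (x + y).
Proof.
move=> a0; rewrite /wt -big_split/=; apply: ler_prod => i _.
by rewrite mulr_ge0 ?pw_ge0//= mxE pw_peetre.
Qed.

Lemma wt_row_mx m n a (x : 'rV[R]_m) (y : 'rV[R]_n) :
  wt a (row_mx x y) = wt a x * wt a y.
Proof.
rewrite /wt big_split_ord/=; congr (_ * _); apply: eq_bigr => i _.
  by rewrite row_mxEl.
by rewrite row_mxEr.
Qed.

Lemma measurable_wt n a : measurable_fun setT (@wt n a).
Proof. by apply: (measurable_prodr (f := fun=> pw a)) => i; exact: measurable_pw. Qed.

Lemma integral_wt_lty n a : 1 < a -> (\int[leb n]_t (wt a t)%:E < +oo)%E.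
Proof.
move=> a1; rewrite (leb_prod_ge0 (f := fun=> pw a)); last 2 first.
- by move=> _; exact: measurable_pw.
- by move=> _ x; exact: pw_ge0.
have H : (\int[mu]_x (pw a x)%:E \is a fin_num)%E.
  rewrite ge0_fin_numE ?integral_pw_lty// integral_ge0// => x _.
  by rewrite lee_fin pw_ge0.
by rewrite -(fineK H) prodEFin ltry.
Qed.

Lemma coord_le_enorm n (t : 'rV[R]_n) i : `|t 0 i| <= enorm t.
Proof.
rewrite /enorm -sqrtr_sqr ler_wsqrtr// (bigD1 i)//= lerDl.
by apply: sumr_ge0 => j _; exact: sqr_ge0.
Qed.

(** Each of the [n] factors [1 + |t_i|] is at most [1 + enorm t]. This is the origin of the seminorm
    orders [n * k] below. *)
Lemma enorm_wt n k (t : 'rV[R]_n) : ((1 + enorm t) ^+ (n * k))^-1 <= wt k%:R t.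
Proof.
rewrite /wt.
under eq_bigr do rewrite pw_nat.
rewrite prodfV lef_pV2 ?posrE; last 2 first.
- by apply: exprn_gt0; rewrite ltr_pwDl// sqrtr_ge0.
- by apply: prodr_gt0 => i _; apply: exprn_gt0; rewrite ltr_pwDl.
have -> : (1 + enorm t) ^+ (n * k) = \prod_(i < n) (1 + enorm t) ^+ k.
  by rewrite prodr_const card_ord mulnC exprM.
apply: ler_prod => i _; rewrite exprn_ge0 ?addr_ge0//=.
by rewrite lerXn2r ?nnegrE ?addr_ge0 ?sqrtr_ge0// lerD2l coord_le_enorm.
Qed.

End Weights.

(** * Rapidly decaying complex functions *)

Section RealIntegral.
Local Open Scope classical_set_scope.
Context {R : realType}.
Implicit Types (m n : nat) (C : R).

Lemma le_integrable_wt n (f : 'rV[R]_n -> R) C : measurable_fun setT f ->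
  (forall t, `|f t| <= C * wt 2 t) -> (leb n).-integrable setT (EFin \o f).
Proof.
move=> mf fC; apply/integrableP; split; first exact/measurable_EFinP.
apply: (@le_lt_trans _ _ (\int[leb n]_t (C * wt 2 t)%:E)%E).
  apply: ge0_le_integral => //.
  - by apply/measurable_EFinP; exact: measurableT_comp.
  - apply/measurable_EFinP; apply: measurable_funM; first exact: measurable_cst.
    exact: measurable_wt.
  - by move=> t _; rewrite /= lee_fin.
have C0 : 0 <= C.
  have := le_trans (normr_ge0 _) (fC 0); rewrite pmulr_lge0//; exact: wt_gt0.
under eq_integral do rewrite EFinM.
rewrite ge0_integralZl_EFin//.
- by rewrite lte_mul_pinfty// integral_wt_lty// ltr1n.
- by move=> t _; rewrite lee_fin wt_ge0.
- by apply/measurable_EFinP; exact: measurable_wt.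
Qed.

Definition wt_int n : R := \int[leb n]_t wt 2 t.

Lemma le_Rintegral_wt n (f : 'rV[R]_n -> R) C : measurable_fun setT f ->
  (forall t, `|f t| <= C * wt 2 t) -> `|\int[leb n]_t f t| <= C * wt_int n.
Proof.
move=> mf fC; have fi := le_integrable_wt mf fC.
have wi : (leb n).-integrable setT (EFin \o (@wt R n 2)).
  apply: (@le_integrable_wt _ _ 1); first exact: measurable_wt.
  by move=> t; rewrite mul1r ger0_norm ?wt_ge0.
apply: (le_trans (le_normr_Rintegral _ _)) => //.
rewrite /wt_int -RintegralZl//; apply: le_Rintegral => //.
- by apply: (integrable_norm fi).
- by apply: (integrableZl measurableT C wi).
Qed.

Lemma wt_int_ge0 n : 0 <= wt_int n.
Proof. by apply: Rintegral_ge0 => t _; exact: wt_ge0. Qed.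

Lemma Rintegral_shift n (a : 'rV[R]_n) (f : 'rV[R]_n -> R) : measurable_fun setT f ->
  \int[leb n]_t f (t + a) = \int[leb n]_t f t.
Proof.
move=> mf; congr fine; apply: (leb_shift a (f := EFin \o f)).
exact/measurable_EFinP.
Qed.

Lemma Rintegral_opp n (f : 'rV[R]_n -> R) : measurable_fun setT f ->
  \int[leb n]_t f (- t) = \int[leb n]_t f t.
Proof.
move=> mf; congr fine; apply: (leb_opp (f := EFin \o f)).
exact/measurable_EFinP.
Qed.

Lemma measurable_row_mxl m n (y : 'rV[R]_n) :
  measurable_fun setT (fun x : 'rV[R]_m => row_mx x y).
Proof.
apply: measurable_rowP => i; case: (split_ordP i) => j ->.
- by under eq_fun do rewrite row_mxEl; exact: measurable_coord.
- by under eq_fun do rewrite row_mxEr; exact: measurable_cst.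
Qed.

Section Split.
Variables (m n : nat) (f : 'rV[R]_(m + n) -> R) (C : R).
Hypotheses (mf : measurable_fun setT f) (fC : forall t, `|f t| <= C * wt 2 t).

Let g (p : 'rV[R]_m * 'rV[R]_n) : \bar R := (f (row_mx p.1 p.2))%:E.

Let mg : measurable_fun setT g.
Proof.
by apply/measurable_EFinP; apply: (measurableT_comp mf); exact: measurable_row_mx.
Qed.

Let C0 : 0 <= C.
Proof.
have := le_trans (normr_ge0 _) (fC 0); rewrite pmulr_lge0//; exact: wt_gt0.
Qed.

Lemma measurable_secr (x : 'rV[R]_m) : measurable_fun setT (fun y => f (row_mx x y)).
Proof. exact: (measurableT_comp mf (measurable_row_mxr x)). Qed.

Lemma measurable_secl (y : 'rV[R]_n) : measurable_fun setT (fun x => f (row_mx x y)).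
Proof. exact: (measurableT_comp mf (measurable_row_mxl y)). Qed.

Let sec1 (x : 'rV[R]_m) : (leb n).-integrable setT (EFin \o (fun y => f (row_mx x y))).
Proof.
apply: (@le_integrable_wt _ _ (C * wt 2 x)); first exact: measurable_secr.
by move=> y; rewrite -mulrA -wt_row_mx.
Qed.

Let sec2 (y : 'rV[R]_n) : (leb m).-integrable setT (EFin \o (fun x => f (row_mx x y))).
Proof.
apply: (@le_integrable_wt _ _ (C * wt 2 y)); first exact: measurable_secl.
by move=> x; rewrite -mulrA [wt 2 y * _]mulrC -wt_row_mx.
Qed.

Let ig : (@lebs R m \x @lebs R n)%E.-integrable setT g.
Proof.
apply/integrable12ltyP; first exact: mg.
apply: (@le_lt_trans _ _ (\int[leb (m + n)]_z (C * wt 2 z)%:E)%E).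
  rewrite leb_split; last 2 first.
  - apply/measurable_EFinP; apply: measurable_funM; first exact: measurable_cst.
    exact: measurable_wt.
  - by move=> z; rewrite lee_fin mulr_ge0// wt_ge0.
  apply: ge0_le_integral => //.
  - by move=> x _; exact: integral_ge0.
  - apply: (@measurable_fun_fubini_tonelli_F _ _ _ _ R (@lebs R n) (abse \o g)).
      by apply: measurableT_comp => //; exact: mg.
    by move=> z /=.
  - apply: (@measurable_fun_fubini_tonelli_F _ _ _ _ R (@lebs R n)
        (fun p => (C * wt 2 (row_mx p.1 p.2))%:E)).
      apply/measurable_EFinP; apply: measurable_funM; first exact: measurable_cst.
      by apply: (measurableT_comp (@measurable_wt R _ 2)); exact: measurable_row_mx.
    by move=> z /=; rewrite lee_fin mulr_ge0// wt_ge0.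
  - move=> x _; apply: ge0_le_integral => //.
    + by apply: measurableT_comp => //; exact: (measurable_int _ (sec1 x)).
    + apply/measurable_EFinP; apply: measurable_funM; first exact: measurable_cst.
      by apply: (measurableT_comp (@measurable_wt R _ 2)); exact: measurable_row_mxr.
    + by move=> y _ /=; rewrite lee_fin.
under eq_integral do rewrite EFinM.
rewrite ge0_integralZl_EFin//.
- by rewrite lte_mul_pinfty// integral_wt_lty// ltr1n.
- by move=> t _; rewrite lee_fin wt_ge0.
- by apply/measurable_EFinP; exact: measurable_wt.
Qed.

Let sec1E x : (\int[leb n]_y g (x, y) = (\int[leb n]_y f (row_mx x y))%R%:E)%E.
Proof. by rewrite /Rintegral fineK//; exact: (integrable_fin_num _ (sec1 x)). Qed.

Let sec2E y : (\int[leb m]_x g (x, y) = (\int[leb m]_x f (row_mx x y))%R%:E)%E.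
Proof. by rewrite /Rintegral fineK//; exact: (integrable_fin_num _ (sec2 y)). Qed.

Lemma measurable_Rintegral_sec :
  measurable_fun setT (fun x => \int[leb n]_y f (row_mx x y)).
Proof.
apply/measurable_EFinP.
have := @measurable_fubini_F _ _ _ _ R (@lebs R m) (@lebs R n) _ ig.
apply: eq_measurable_fun => x _; exact: sec1E.
Qed.

Lemma Rintegral_split :
  \int[leb (m + n)]_z f z = \int[leb m]_x \int[leb n]_y f (row_mx x y).
Proof.
congr fine.
transitivity (\int[pushforward (@lebs R m \x @lebs R n) (fun p => row_mx p.1 p.2)]_z (f z)%:E)%E.
  apply: eq_measure_integral; first exact: measurable_row_mx.
  by move=> mphi A mA _; exact: leb_prodE.
have mef : measurable_fun setT (EFin \o f) by exact/measurable_EFinP.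
rewrite (@integral_pushforward _ _ _ _ R _ (@measurable_row_mx R m n) _ setT (EFin \o f))//.
rewrite preimage_setT.
have := @integral12_prod_meas1 _ _ _ _ R (@lebs R m) (@lebs R n) _ ig.
rewrite /comp => <-; apply: eq_integral => x _; exact: sec1E.
Qed.

Lemma Rintegral_swap :
  \int[leb m]_x \int[leb n]_y f (row_mx x y) =
  \int[leb n]_y \int[leb m]_x f (row_mx x y).
Proof.
congr fine.
transitivity (\int[@lebs R m]_x \int[@lebs R n]_y g (x, y))%E.
  by apply: eq_integral => x _; rewrite -sec1E.
rewrite (@Fubini _ _ _ _ R (@lebs R m) (@lebs R n) _ ig).
by apply: eq_integral => y _; exact: sec2E.
Qed.

End Split.

End RealIntegral.

Section ComplexIntegral.
Local Open Scope classical_set_scope.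
Local Open Scope complex_scope.
Context {R : realType}.
Local Notation Re := (@complex.Re R).
Local Notation Im := (@complex.Im R).
Implicit Types (z w : R[i]) (C : R).

Lemma cmod_ge0 z : 0 <= cmod z.
Proof. by case: z => a b; rewrite /ComplexField.Normc.normc sqrtr_ge0. Qed.

Lemma cmod_Re z : `|Re z| <= cmod z.
Proof.
case: z => a b; rewrite /ComplexField.Normc.normc /= -sqrtr_sqr ler_wsqrtr//.
by rewrite lerDl sqr_ge0.
Qed.

Lemma cmod_Im z : `|Im z| <= cmod z.
Proof.
case: z => a b; rewrite /ComplexField.Normc.normc /= -sqrtr_sqr ler_wsqrtr//.
by rewrite lerDr sqr_ge0.
Qed.

Lemma cmod_le z : cmod z <= `|Re z| + `|Im z|.
Proof.
case: z => a b; rewrite /ComplexField.Normc.normc /=.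
rewrite -[leRHS]ger0_norm ?addr_ge0// -sqrtr_sqr ler_wsqrtr// sqrrD.
by rewrite !real_normK ?num_real// lerD2r lerDl mulrn_wge0// mulr_ge0.
Qed.

Lemma cmodM z w : cmod (z * w) = cmod z * cmod w.
Proof. exact: ComplexField.Normc.normcM. Qed.

Lemma cmodD z w : cmod (z + w) <= cmod z + cmod w.
Proof. exact: le_normcD. Qed.

Lemma cmodJ z : cmod z^* = cmod z.
Proof. by case: z => a b; rewrite /ComplexField.Normc.normc /= sqrrN. Qed.

Lemma cmodr (x : R) : cmod x%:C = `|x|.
Proof. by rewrite /ComplexField.Normc.normc /= expr0n addr0 sqrtr_sqr. Qed.

Lemma Re_mul z w : Re (z * w) = Re z * Re w - Im z * Im w.
Proof. by case: z => ? ?; case: w. Qed.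
Lemma Im_mul z w : Im (z * w) = Re z * Im w + Im z * Re w.
Proof. by case: z => a b; case: w => c d. Qed.
Lemma Re_add z w : Re (z + w) = Re z + Re w.
Proof. by case: z => ? ?; case: w. Qed.
Lemma Im_add z w : Im (z + w) = Im z + Im w.
Proof. by case: z => ? ?; case: w. Qed.
Lemma Re_conjc z : Re z^* = Re z. Proof. by case: z. Qed.
Lemma Im_conjc z : Im z^* = - Im z. Proof. by case: z. Qed.
Lemma complexP z w : Re z = Re w -> Im z = Im w -> z = w.
Proof. by case: z => a b; case: w => c d /= -> ->. Qed.

Definition cmeas d (T : measurableType d) (f : T -> R[i]) : Prop :=
  measurable_fun setT (fun x => Re (f x)) /\
  measurable_fun setT (fun x => Im (f x)).

Section Cmeas.
Context d (T : measurableType d).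
Implicit Types f g : T -> R[i].

Lemma cmeasM f g : cmeas f -> cmeas g -> cmeas (fun x => f x * g x).
Proof.
move=> [f1 f2] [g1 g2]; split.
- under eq_fun do rewrite Re_mul.
  by apply: measurable_funB; exact: measurable_funM.
- under eq_fun do rewrite Im_mul.
  by apply: measurable_funD; exact: measurable_funM.
Qed.

Lemma cmeasD f g : cmeas f -> cmeas g -> cmeas (fun x => f x + g x).
Proof.
move=> [f1 f2] [g1 g2]; split.
- by under eq_fun do rewrite Re_add; exact: measurable_funD.
- by under eq_fun do rewrite Im_add; exact: measurable_funD.
Qed.

Lemma cmeas_cst z : cmeas (fun _ : T => z).
Proof. by split; exact: measurable_cst. Qed.

Lemma cmeasJ f : cmeas f -> cmeas (fun x => (f x)^*).
Proof.
move=> [f1 f2]; split; first by under eq_fun do rewrite Re_conjc.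
by under eq_fun do rewrite Im_conjc; exact: measurableT_comp.
Qed.

Lemma cmeas_comp d' (T' : measurableType d') f (h : T' -> T) :
  cmeas f -> measurable_fun setT h -> cmeas (fun x => f (h x)).
Proof.
move=> [f1 f2] mh; split; first exact: (measurableT_comp f1 mh).
exact: (measurableT_comp f2 mh).
Qed.

End Cmeas.

(** The working class for integration. It is stable under shifts, products, bounded measurable
    multiples and partial integration, and on it linearity and Fubini hold without further
    integrability conditions. It contains the Schwartz functions and also the boxes. *)
Definition nice n (f : 'rV[R]_n -> R[i]) : Prop :=
  cmeas f /\ exists C, forall t, cmod (f t) <= C * wt 2 t.

Lemma nice_bound n (f : 'rV[R]_n -> R[i]) : nice f ->
  exists2 C, 0 <= C & forall t, cmod (f t) <= C * wt 2 t.
Proof.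
move=> [_ [C fC]]; exists C => //.
have := le_trans (cmod_ge0 _) (fC 0); rewrite pmulr_lge0//; exact: wt_gt0.
Qed.

Lemma nice_Re n (f : 'rV[R]_n -> R[i]) : nice f ->
  (leb n).-integrable setT (EFin \o (fun t => Re (f t))).
Proof.
move=> [[mf _] [C fC]]; apply: (@le_integrable_wt _ _ _ C) => // t.
exact: le_trans (cmod_Re _) (fC t).
Qed.

Lemma nice_Im n (f : 'rV[R]_n -> R[i]) : nice f ->
  (leb n).-integrable setT (EFin \o (fun t => Im (f t))).
Proof.
move=> [[_ mf] [C fC]]; apply: (@le_integrable_wt _ _ _ C) => // t.
exact: le_trans (cmod_Im _) (fC t).
Qed.

Lemma nice_mulb n (f g : 'rV[R]_n -> R[i]) (B : R) : nice f -> cmeas g ->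
  (forall t, cmod (g t) <= B) -> nice (fun t => g t * f t).
Proof.
move=> nf mg gB; have [C C0 fC] := nice_bound nf.
split; first by apply: cmeasM => //; case: nf.
exists (B * C) => t; rewrite cmodM -mulrA ler_pM ?cmod_ge0//.
Qed.

Lemma niceZ n (f : 'rV[R]_n -> R[i]) z : nice f -> nice (fun t => z * f t).
Proof.
by move=> nf; apply: (@nice_mulb _ _ (fun=> z) (cmod z)) => //; exact: cmeas_cst.
Qed.

Lemma niceD n (f g : 'rV[R]_n -> R[i]) : nice f -> nice g ->
  nice (fun t => f t + g t).
Proof.
move=> [mf [C fC]] [mg [D gD]]; split; first exact: cmeasD.
by exists (C + D) => t; rewrite (le_trans (cmodD _ _))// mulrDl lerD.
Qed.

Lemma niceJ n (f : 'rV[R]_n -> R[i]) : nice f -> nice (fun t => (f t)^*).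
Proof.
move=> [mf [C fC]]; split; first exact: cmeasJ.
by exists C => t; rewrite cmodJ.
Qed.

Lemma wt_shift_le n (t a : 'rV[R]_n) : wt 2 (t + a) <= wt 2 t / wt 2 a.
Proof.
rewrite ler_pdivlMr ?wt_gt0//.
have := @wt_peetre R n 2 (t + a) (- a); rewrite addrK wtN; exact.
Qed.

Lemma nice_shift n (f : 'rV[R]_n -> R[i]) a : nice f -> nice (fun t => f (t + a)).
Proof.
move=> nf; have [C C0 fC] := nice_bound nf.
split; first by apply: cmeas_comp; [case: nf|exact: measurable_shift].
exists (C / wt 2 a) => t; apply: (le_trans (fC _)).
by rewrite -mulrA [_^-1 * _]mulrC ler_wpM2l// wt_shift_le.
Qed.

Lemma nice_secr m n (f : 'rV[R]_(m + n) -> R[i]) x :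
  nice f -> nice (fun y => f (row_mx x y)).
Proof.
move=> [mf [C fC]]; split; first by apply: cmeas_comp => //; exact: measurable_row_mxr.
by exists (C * wt 2 x) => y; rewrite -mulrA -wt_row_mx.
Qed.

Lemma cintD n (f g : 'rV[R]_n -> R[i]) : nice f -> nice g ->
  cint (fun t => f t + g t) = cint f + cint g.
Proof.
move=> nf ng; apply: complexP; rewrite ?(Re_add, Im_add) /cint/=.
- under eq_Rintegral do rewrite Re_add.
  by rewrite RintegralD//; exact: nice_Re.
- under eq_Rintegral do rewrite Im_add.
  by rewrite RintegralD//; exact: nice_Im.
Qed.

Lemma cintZ n (f : 'rV[R]_n -> R[i]) z : nice f ->
  cint (fun t => z * f t) = z * cint f.
Proof.
move=> nf; apply: complexP; rewrite ?(Re_mul, Im_mul) /cint/=.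
- under eq_Rintegral do rewrite Re_mul.
  rewrite RintegralB ?RintegralZl//; [exact: nice_Im|exact: nice_Re| |].
  + exact: (integrableZl measurableT _ (nice_Re nf)).
  + exact: (integrableZl measurableT _ (nice_Im nf)).
- under eq_Rintegral do rewrite Im_mul.
  rewrite RintegralD ?RintegralZl//; [exact: nice_Re|exact: nice_Im| |].
  + exact: (integrableZl measurableT _ (nice_Im nf)).
  + exact: (integrableZl measurableT _ (nice_Re nf)).
Qed.

Lemma cint_shift n (f : 'rV[R]_n -> R[i]) a : cmeas f ->
  cint (fun t => f (t + a)) = cint f.
Proof.
move=> [mf1 mf2]; apply: complexP; rewrite /cint/=.
- exact: (Rintegral_shift a mf1).
- exact: (Rintegral_shift a mf2).
Qed.

Lemma cint_opp n (f : 'rV[R]_n -> R[i]) : cmeas f ->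
  cint (fun t => f (- t)) = cint f.
Proof.
move=> [mf1 mf2]; apply: complexP; rewrite /cint/=.
- exact: (Rintegral_opp mf1).
- exact: (Rintegral_opp mf2).
Qed.

Lemma cintJ n (f : 'rV[R]_n -> R[i]) : nice f ->
  cint (fun t => (f t)^*) = (cint f)^*.
Proof.
move=> nf; apply: complexP; rewrite ?(Re_conjc, Im_conjc) /cint/=.
- by apply: eq_Rintegral => t _; rewrite Re_conjc.
- under eq_Rintegral do rewrite Im_conjc -mulN1r.
  by rewrite RintegralZl ?mulN1r//; exact: nice_Im.
Qed.

Lemma cmod_cint_le n (f : 'rV[R]_n -> R[i]) C : cmeas f ->
  (forall t, cmod (f t) <= C * wt 2 t) -> cmod (cint f) <= 2 * C * wt_int n.
Proof.
move=> [mf1 mf2] fC; apply: (le_trans (cmod_le _)).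
rewrite -mulrA mulrDl mul1r /cint/= lerD//; apply: le_Rintegral_wt => // t.
- exact: le_trans (cmod_Re _) (fC t).
- exact: le_trans (cmod_Im _) (fC t).
Qed.

Lemma cint_split m n (f : 'rV[R]_(m + n) -> R[i]) : nice f ->
  cint f = cint (fun x => cint (fun y => f (row_mx x y))).
Proof.
move=> [[mf1 mf2] [C fC]]; apply: complexP; rewrite /cint/=.
- by apply: (Rintegral_split mf1) => t; exact: le_trans (cmod_Re _) (fC t).
- by apply: (Rintegral_split mf2) => t; exact: le_trans (cmod_Im _) (fC t).
Qed.

Lemma cint_swap m n (f : 'rV[R]_(m + n) -> R[i]) : nice f ->
  cint (fun x => cint (fun y => f (row_mx x y))) =
  cint (fun y => cint (fun x => f (row_mx x y))).
Proof.
move=> [[mf1 mf2] [C fC]]; apply: complexP; rewrite /cint/=.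
- by apply: (Rintegral_swap mf1) => t; exact: le_trans (cmod_Re _) (fC t).
- by apply: (Rintegral_swap mf2) => t; exact: le_trans (cmod_Im _) (fC t).
Qed.

Lemma nice_cint m n (f : 'rV[R]_(m + n) -> R[i]) : nice f ->
  nice (fun x => cint (fun y => f (row_mx x y))).
Proof.
move=> nf; have [mf [C fC]] := nf; split.
  case: mf => mf1 mf2; split; rewrite /cint/=.
  - by apply: (measurable_Rintegral_sec mf1) => t; exact: le_trans (cmod_Re _) (fC t).
  - by apply: (measurable_Rintegral_sec mf2) => t; exact: le_trans (cmod_Im _) (fC t).
exists (2 * C * wt_int n) => x.
have -> : 2 * C * wt_int n * wt 2 x = 2 * (C * wt 2 x) * wt_int n by ring.
apply: cmod_cint_le; first by have [] := nice_secr x nf.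
by move=> y; rewrite -mulrA -wt_row_mx.
Qed.

End ComplexIntegral.

(** * Decay of the short-time Fourier transform *)

Section Partials.
Local Open Scope classical_set_scope.
Context {R : realType} {n : nat}.
Implicit Types (f g : 'rV[R]_n -> R) (l : seq 'I_n) (L : nat).
Local Notation ek i := (delta_mx 0 i : 'rV[R]_n).

(** Smoothness of finite order lets the product rule be proved by induction on [L], one derivative
    consuming one order. *)
Definition smoothn L f := forall l, (size l <= L)%N ->
  forall x, differentiable (partials l f) x.

Lemma partials_cat l1 l2 f : partials (l1 ++ l2) f = partials l1 (partials l2 f).
Proof. by rewrite /partials foldr_cat. Qed.

Lemma partials_rcons l i f :
  partials (rcons l i) f = partials l (fun x => 'D_(ek i) f x).
Proof. by rewrite -cats1 partials_cat. Qed.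

Lemma smoothn_le L L' f : (L <= L')%N -> smoothn L' f -> smoothn L f.
Proof. by move=> LL sf l sl; apply: sf; exact: leq_trans LL. Qed.

Lemma smoothn_partials L l f : smoothn (size l + L)%N f -> smoothn L (partials l f).
Proof.
move=> sf l' sl'; rewrite -partials_cat; apply: sf.
by rewrite size_cat addnC leq_add2l.
Qed.

Lemma smoothn_D L i f : smoothn L.+1 f -> smoothn L (fun x => 'D_(ek i) f x).
Proof. by move=> sf; apply: (@smoothn_partials L [:: i]). Qed.

Lemma smoothn_diff L f : smoothn L f -> forall x, differentiable f x.
Proof. by move=> sf; exact: (sf [::]). Qed.

Lemma smoothn_cont L f : smoothn L f -> continuous f.
Proof. by move=> sf x; apply: differentiable_continuous; exact: smoothn_diff sf _. Qed.

Lemma smoothn_meas L f : smoothn L f -> measurable_fun setT f.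
Proof. by move=> sf; apply: continuous_row_measurable; exact: smoothn_cont sf. Qed.

Lemma partialsD l f g : smoothn (size l) f -> smoothn (size l) g ->
  partials l (fun x => f x + g x) = fun x => partials l f x + partials l g x.
Proof.
elim: l => [//|i l IH] sf sg /=.
rewrite IH; [|exact: smoothn_le sf|exact: smoothn_le sg].
apply/funext => x; apply: deriveD; apply: diff_derivable.
- by apply: sf.
- by apply: sg.
Qed.

Lemma partialsZ l (c : R) f : smoothn (size l) f ->
  partials l (fun x => c * f x) = fun x => c * partials l f x.
Proof.
elim: l => [//|i l IH] sf /=.
rewrite IH; last exact: smoothn_le sf.
apply/funext => x; apply: (@deriveZ _ _ _ (partials l f) c); apply: diff_derivable.
by apply: sf.
Qed.

Lemma smoothnD L f g : smoothn L f -> smoothn L g -> smoothn L (fun x => f x + g x).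
Proof.
move=> sf sg l sl x; rewrite partialsD; [|exact: smoothn_le sf|exact: smoothn_le sg].
by apply: differentiableD; [exact: sf|exact: sg].
Qed.

Lemma smoothnZ L (c : R) f : smoothn L f -> smoothn L (fun x => c * f x).
Proof.
move=> sf l sl x; rewrite partialsZ; last exact: smoothn_le sf.
by apply: (@differentiableZ _ _ _ (partials l f)); exact: sf.
Qed.

Lemma derive_mul i f g : (forall x, differentiable f x) ->
  (forall x, differentiable g x) ->
  (fun x => 'D_(ek i) (fun x => f x * g x) x) =
  (fun x => 'D_(ek i) f x * g x + f x * 'D_(ek i) g x).
Proof.
move=> df dg; apply/funext => x.
have : 'D_(ek i) (f * g) x = f x *: 'D_(ek i) g x + g x *: 'D_(ek i) f x.
  by apply: deriveM; apply: diff_derivable.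
by move=> ->; rewrite addrC [g x *: _]mulrC.
Qed.

Lemma smoothnM L f g : smoothn L f -> smoothn L g -> smoothn L (fun x => f x * g x).
Proof.
elim: L f g => [|L IH] f g sf sg l sl x.
  case: l sl => // _ /=.
  by apply: differentiableM; [exact: (sf [::])|exact: (sg [::])].
case/lastP: l sl => [_|l i].
  by apply: differentiableM; [exact: (sf [::])|exact: (sg [::])].
rewrite size_rcons ltnS => sl; rewrite partials_rcons derive_mul; last 2 first.
- exact: smoothn_diff sf.
- exact: smoothn_diff sg.
have [sf' sg'] : smoothn L f /\ smoothn L g by split; [exact: smoothn_le sf|exact: smoothn_le sg].
by apply: (smoothnD (L := L)) => //; apply: IH => //; exact: smoothn_D.
Qed.

Definition ctrl L (w : 'rV[R]_n -> R) f := forall l, (size l <= L)%N ->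
  forall x, `|partials l f x| <= w x.

Lemma ctrl_le L L' w f : (L <= L')%N -> ctrl L' w f -> ctrl L w f.
Proof. by move=> LL sf l sl; apply: sf; exact: leq_trans LL. Qed.

Lemma ctrl_D L w i f : ctrl L.+1 w f -> ctrl L w (fun x => 'D_(ek i) f x).
Proof.
by move=> cf l sl x; rewrite -partials_rcons; apply: cf; rewrite size_rcons.
Qed.

(** Each differentiation of a product at most doubles the number of terms, whence [2 ^+ L]. Since
    [ctrl] uses one majorant for all derivatives, every term has the same bound [u x * w x]. *)
Lemma ctrlM L u w f g : smoothn L f -> smoothn L g -> ctrl L u f -> ctrl L w g ->
  ctrl L (fun x => 2 ^+ L * (u x * w x)) (fun x => f x * g x).
Proof.
elim: L f g => [|L IH] f g sf sg cf cg l sl x.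
  case: l sl => // _ /=; rewrite expr0 mul1r normrM ler_pM//.
  - exact: (cf [::]).
  - exact: (cg [::]).
case/lastP: l sl => [_|l i].
  rewrite /= normrM; apply: (@le_trans _ _ (u x * w x)).
    by rewrite ler_pM//; [exact: (cf [::])|exact: (cg [::])].
  rewrite ler_peMl//; last by rewrite exprn_ege1// ler1n.
  have := cf [::] isT x; have := cg [::] isT x => /= c1 c2.
  by rewrite mulr_ge0//; [exact: le_trans c2|exact: le_trans c1].
rewrite size_rcons ltnS => sl; rewrite partials_rcons derive_mul; last 2 first.
- exact: smoothn_diff sf.
- exact: smoothn_diff sg.
have [sf' sg'] : smoothn L f /\ smoothn L g by split; [exact: smoothn_le sf|exact: smoothn_le sg].
have [cf' cg'] : ctrl L u f /\ ctrl L w g by split; [exact: ctrl_le cf|exact: ctrl_le cg].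
rewrite partialsD; last 2 first.
- by apply: (@smoothn_le _ L) => //; apply: smoothnM => //; exact: smoothn_D.
- by apply: (@smoothn_le _ L) => //; apply: smoothnM => //; exact: smoothn_D.
rewrite (le_trans (ler_normD _ _))// exprS -mulrA mulrDl mul1r lerD//.
- by apply: (IH _ _ _ sg') => //; [exact: smoothn_D|exact: ctrl_D].
- by apply: (IH _ _ sf') => //; [exact: smoothn_D|exact: ctrl_D].
Qed.

Lemma derive_transl (v a : 'rV[R]_n) f x :
  'D_v (fun t => f (t + a)) x = 'D_v f (x + a).
Proof.
rewrite /derive.
have -> // : (fun h : R => h^-1 *: (((fun t => f (t + a)) \o shift x) (h *: v) - f (x + a)))
  = (fun h : R => h^-1 *: ((f \o shift (x + a)) (h *: v) - f (x + a))).
by apply/funext => h /=; rewrite addrA.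
Qed.

Lemma partials_transl l a f :
  partials l (fun t => f (t + a)) = fun t => partials l f (t + a).
Proof.
elim: l => [//|i l IH] /=; apply/funext => x; rewrite IH.
exact: derive_transl.
Qed.

Lemma differentiable_transl a f x :
  differentiable f (x + a) -> differentiable (fun t => f (t + a)) x.
Proof.
by move=> df; apply: (@differentiable_comp _ _ _ _ (fun t => t + a) f) => //.
Qed.

Lemma smoothn_transl L a f : smoothn L f -> smoothn L (fun t => f (t + a)).
Proof.
by move=> sf l sl x; rewrite partials_transl; apply: differentiable_transl; exact: sf.
Qed.

Lemma ctrl_transl L w a f : ctrl L w f -> ctrl L (fun t => w (t + a)) (fun t => f (t + a)).
Proof. by move=> cf l sl x; rewrite partials_transl; exact: cf. Qed.

(** Restriction to a line turns a directional derivative into a derivative in one real variable,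
    where the mean value theorem and the chain rule apply. *)
Lemma derive_line (v x : 'rV[R]_n) f (s : R) : differentiable f (x + s *: v) ->
  is_derive s 1 (fun s => f (x + s *: v)) ('D_v f (x + s *: v)).
Proof.
move=> df; have dv : derivable f (x + s *: v) v by exact: diff_derivable.
have E : (fun h : R => h^-1 *: (((fun s => f (x + s *: v)) \o shift s) (h *: 1) - f (x + s *: v)))
       = (fun h : R => h^-1 *: ((f \o shift (x + s *: v)) (h *: v) - f (x + s *: v))).
  apply/funext => h /=; congr (_ *: (f _ - _)).
  by rewrite [h *: 1]mulr1 scalerDl addrCA.
by split; [rewrite /derivable E|rewrite /derive E].
Qed.

(* Translation invariance of the integral, differentiated under the integral. *)
Lemma Rintegral_derive i f (C : R) :
  (forall x, differentiable f x) ->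
  measurable_fun setT (fun x => 'D_(ek i) f x) ->
  (forall x, `|f x| <= C * wt 2 x) ->
  (forall x, `|'D_(ek i) f x| <= C * wt 2 x) ->
  \int[leb n]_x 'D_(ek i) f x = 0.
Proof.
move=> df mdf fC dfC.
have mf : measurable_fun setT f.
  by apply: continuous_row_measurable => x; exact: differentiable_continuous.
have C0 : 0 <= C.
  have := le_trans (normr_ge0 _) (fC 0); rewrite pmulr_lge0//; exact: wt_gt0.
pose h m : R := m.+1%:R^-1.
have h0 m : 0 < h m by rewrite invr_gt0.
pose q m x := (h m)^-1 * (f (x + h m *: ek i) - f x).
have mq m : measurable_fun setT (q m).
  apply: measurable_funM; first exact: measurable_cst.
  apply: measurable_funB => //; apply: (measurableT_comp mf); exact: measurable_shift.
have q_le m x : `|q m x| <= 4 * C * wt 2 x.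
  have [s] := @MVT_segment R (fun s => f (x + s *: ek i))
    (fun s => 'D_(ek i) f (x + s *: ek i)) 0 (h m) (ltW (h0 m))
    (fun s _ => derive_line (df _))
    (derivable_within_continuous (fun s _ => @ex_derive _ _ _ _ _ _ _ (derive_line (df _)))).
  rewrite scale0r addr0 subr0 in_itv/= => /andP[s0 sh] E.
  rewrite /q E mulrC mulfK ?gt_eqF//; apply: (le_trans (dfC _)).
  rewrite mulrAC mulrC; apply: ler_wpM2r => //.
  have := @wt_peetre R n 2 (x + s *: ek i) (- (s *: ek i)).
  rewrite addrK wtN => /(_ (ler0n R 2)) H.
  (* The point given by the mean value theorem is within distance 1 of [x], and [pw 2 1 = 1/4];
     through Peetre's inequality this yields the factor 4 in the dominating function. *)
  have w4 : 4^-1 <= wt 2 (s *: ek i).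
    rewrite /wt (bigD1 i)//= big1 ?mulr1; last first.
      by move=> j ji; rewrite !mxE (negbTE ji) andbF mulr0 /pw normr0 addr0 powR1.
    rewrite !mxE !eqxx mulr1; apply: (@le_trans _ _ (pw 2 1)).
      by rewrite (pw_nat 2) normr1 expr2 lef_pV2 ?posrE//; lra.
    apply: pw_mono => //; rewrite normr1 ger0_norm//; apply: (le_trans sh).
    by rewrite invf_le1 ?ler1n.
  have := wt_ge0 2 (x + s *: ek i); nra.
have q_cvg x : q ^~ x @ \oo --> 'D_(ek i) f x.
  have dv : derivable f x (ek i) by exact: diff_derivable.
  have hc : h m @[m --> \oo] --> (0 : R) by exact: cvg_harmonic.
  have /cvgr_dnbhsP/(_ h) := dv.
  have H : (forall m, h m != 0) /\ (h m @[m --> \oo] --> (0 : R)).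
    by split => // m; rewrite gt_eqF// h0.
  move=> /(_ H); rewrite /derive; apply: cvg_trans.
  by apply: near_eq_cvg; near=> m; rewrite /q /= [_ + x]addrC.
have q0 m : \int[leb n]_x q m x = 0.
  have qi : (leb n).-integrable setT (EFin \o (fun x => f (x + h m *: ek i) - f x)).
    apply: (@le_integrable_wt _ _ _ (h m * (4 * C))).
      apply: measurable_funB => //; apply: (measurableT_comp mf); exact: measurable_shift.
    move=> x; have := q_le m x; rewrite /q normrM gtr0_norm ?invr_gt0//.
    by rewrite ler_pdivrMl// !mulrA.
  rewrite RintegralZl// RintegralB//.
  - by rewrite (Rintegral_shift _ mf) subrr mulr0.
  - apply: (@le_integrable_wt _ _ _ (C / wt 2 (h m *: ek i))).
      by apply: (measurableT_comp mf); exact: measurable_shift.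
    move=> x; apply: (le_trans (fC _)).
    by rewrite -mulrA [_^-1 * _]mulrC ler_wpM2l// wt_shift_le.
  - exact: le_integrable_wt fC.
have gi : (leb n).-integrable setT (EFin \o (fun x : 'rV[R]_n => 4 * C * wt 2 x)).
  apply: (@le_integrable_wt _ _ _ (4 * C)).
    by apply: measurable_funM; [exact: measurable_cst|exact: measurable_wt].
  by move=> x; rewrite ger0_norm// !mulr_ge0// wt_ge0.
have [] := @dominated_convergence _ _ R (leb n) setT measurableT
  (fun m x => (q m x)%:E) (fun x => ('D_(ek i) f x)%:E) (fun x => (4 * C * wt 2 x)%:E).
- by move=> m; apply/measurable_EFinP.
- exact/measurable_EFinP.
- by apply: aeW => x _; apply: cvg_EFin; [exact: nearW|exact: q_cvg].
- exact: gi.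
- by apply: aeW => x m _ /=; rewrite lee_fin.
move=> _ _ H.
have E m : (\int[leb n]_x (q m x)%:E = 0)%E.
  have fi : (\int[leb n]_x (q m x)%:E)%E \is a fin_num.
    by apply: integrable_fin_num => //; exact: le_integrable_wt (q_le m).
  by rewrite -(fineK fi) -[fine _]/(\int[leb n]_x q m x) q0.
rewrite /Rintegral; suff -> : (\int[leb n]_x ('D_(ek i) f x)%:E = 0)%E by [].
move/cvg_lim : H => <- //; under eq_fun do rewrite E.
exact: lim_cst.
Unshelve. all: by end_near. Qed.

End Partials.

(** * Decay of Fourier integrals by repeated integration by parts *)

Section MainEstimate.
Local Open Scope classical_set_scope.
Context {R : realType} {n : nat}.
Implicit Types (f g H : 'rV[R]_n -> R) (xi t x : 'rV[R]_n).
Local Notation ek i := (delta_mx 0 i : 'rV[R]_n).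

Lemma derive_comp (g : R -> R) f x (v : 'rV[R]_n) (dg : R) :
  is_derive (f x) 1 g dg -> differentiable f x ->
  differentiable (fun t => g (f t)) x /\
  'D_v (fun t => g (f t)) x = dg * 'D_v f x.
Proof.
move=> dg1 df.
have dgf : differentiable (fun t => g (f t)) x.
  by apply: differentiable_comp => //; apply/derivable1_diffP; case: dg1.
split => //.
have E : x + (0 : R) *: v = x by rewrite scale0r addr0.
have df' : differentiable f (x + (0 : R) *: v) by rewrite E.
have dgf' : differentiable (fun t => g (f t)) (x + (0 : R) *: v) by rewrite E.
have H1 := derive_line df'; have H2 := derive_line dgf'.
have dg1' : is_derive (f (x + (0 : R) *: v)) 1 g dg by rewrite E.
have H3 := @is_derive1_comp _ g (fun s => f (x + s *: v)) 0 _ _ dg1' H1.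
have [_ e2] := H2; have [_ e3] := H3.
by rewrite E in e2 e3; rewrite -e2 -e3.
Qed.

Lemma dotrv_deltar t i : dotrv t (ek i) = t 0 i.
Proof.
rewrite /dotrv (bigD1 i)//= big1 ?addr0 ?mxE ?eqxx ?mulr1// => j ji.
by rewrite mxE (negbTE ji) andbF mulr0.
Qed.

Lemma dotrvDl t x xi : dotrv (t + x) xi = dotrv t xi + dotrv x xi.
Proof. by rewrite /dotrv -big_split; apply: eq_bigr => i _; rewrite mxE mulrDl. Qed.

Lemma dotrvZl (c : R) t xi : dotrv (c *: t) xi = c * dotrv t xi.
Proof. by rewrite /dotrv mulr_sumr; apply: eq_bigr => i _; rewrite mxE mulrA. Qed.

Lemma dotrvC t xi : dotrv t xi = dotrv xi t.
Proof. by apply: eq_bigr => i _; rewrite mulrC. Qed.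

Lemma dotrvDr t x xi : dotrv xi (t + x) = dotrv xi t + dotrv xi x.
Proof. by rewrite dotrvC dotrvDl ![dotrv _ xi]dotrvC. Qed.

Lemma dotrvZr (c : R) t xi : dotrv xi (c *: t) = c * dotrv xi t.
Proof. by rewrite dotrvC dotrvZl dotrvC. Qed.

Lemma dotrvNl t xi : dotrv (- t) xi = - dotrv t xi.
Proof. by rewrite -scaleN1r dotrvZl mulN1r. Qed.

Lemma dotrvNr t xi : dotrv xi (- t) = - dotrv xi t.
Proof. by rewrite dotrvC dotrvNl dotrvC. Qed.

Lemma dotrv0l xi : dotrv 0 xi = 0.
Proof. by rewrite -(scale0r 0) dotrvZl mul0r. Qed.

Lemma dotrv0r xi : dotrv xi 0 = 0.
Proof. by rewrite dotrvC dotrv0l. Qed.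

Lemma differentiable_dotrv xi x : differentiable (fun t => dotrv t xi) x.
Proof.
have -> : (fun t => dotrv t xi) = \sum_i (fun t : 'rV[R]_n => t 0 i * xi 0 i).
  by apply/funext => t; rewrite fct_sumE.
apply: differentiable_sum => i.
apply: (@differentiableM _ _ (fun t : 'rV[R]_n => t 0 i) (cst (xi 0 i))).
- exact: differentiable_coord.
- exact: differentiable_cst.
Qed.

Lemma derive_dotrv xi x i : 'D_(ek i) (fun t => dotrv t xi) x = xi 0 i.
Proof.
have E : x + (0 : R) *: ek i = x by rewrite scale0r addr0.
have := @derive_line R n (ek i) x (fun t => dotrv t xi) 0 (differentiable_dotrv _ _).
rewrite E => -[_ <-].
have -> : (fun s : R => dotrv (x + s *: ek i) xi) = (fun s => dotrv x xi + s * xi 0 i).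
  by apply/funext => s; rewrite dotrvDl dotrvZl [dotrv (ek i) _]dotrvC dotrv_deltar.
have H : is_derive (0 : R) 1 (fun s : R => dotrv x xi + s * xi 0 i) (xi 0 i).
  by apply: is_derive_eq; rewrite /GRing.scale/=; ring.
by case: H.
Qed.

Definition cosx xi t : R := cos (2 * pi * dotrv t xi).
Definition sinx xi t : R := sin (2 * pi * dotrv t xi).

Let is_cos (a : R) : is_derive a 1 (fun y => cos (2 * pi * y)) (- (2 * pi) * sin (2 * pi * a)).
Proof.
have H := @is_derive1_comp R cos ( *%R (2 * pi)) a _ _ (is_derive_cos _) _.
apply: (is_derive_eq (H (2 * pi) _)); last by rewrite mulrC mulrN mulNr.
by apply: is_derive_eq; rewrite /GRing.scale/= mulr1.
Qed.

Let is_sin (a : R) : is_derive a 1 (fun y => sin (2 * pi * y)) (2 * pi * cos (2 * pi * a)).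
Proof.
have H := @is_derive1_comp R sin ( *%R (2 * pi)) a _ _ (is_derive_sin _) _.
apply: (is_derive_eq (H (2 * pi) _)); last by rewrite mulrC.
by apply: is_derive_eq; rewrite /GRing.scale/= mulr1.
Qed.

Lemma diff_cosx xi x : differentiable (cosx xi) x.
Proof. by have [] := derive_comp 0 (is_cos _) (differentiable_dotrv xi x). Qed.

Lemma diff_sinx xi x : differentiable (sinx xi) x.
Proof. by have [] := derive_comp 0 (is_sin _) (differentiable_dotrv xi x). Qed.

Lemma derive_cosx xi x i : 'D_(ek i) (cosx xi) x = - (2 * pi * xi 0 i) * sinx xi x.
Proof.
have [_ ->] := derive_comp (ek i) (is_cos _) (differentiable_dotrv xi x).
by rewrite derive_dotrv /sinx; ring.
Qed.

Lemma derive_sinx xi x i : 'D_(ek i) (sinx xi) x = 2 * pi * xi 0 i * cosx xi x.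
Proof.
have [_ ->] := derive_comp (ek i) (is_sin _) (differentiable_dotrv xi x).
by rewrite derive_dotrv /cosx; ring.
Qed.

Lemma cosx_le1 xi t : `|cosx xi t| <= 1.
Proof. by rewrite ler_norml cos_geN1 cos_le1. Qed.

Lemma sinx_le1 xi t : `|sinx xi t| <= 1.
Proof. by rewrite ler_norml sin_geN1 sin_le1. Qed.

Lemma meas_cosx xi : measurable_fun setT (cosx xi).
Proof.
by apply: continuous_row_measurable => x; apply: differentiable_continuous; exact: diff_cosx.
Qed.

Lemma meas_sinx xi : measurable_fun setT (sinx xi).
Proof.
by apply: continuous_row_measurable => x; apply: differentiable_continuous; exact: diff_sinx.
Qed.

Definition cosI xi H : R := \int[leb n]_t (cosx xi t * H t).
Definition sinI xi H : R := \int[leb n]_t (sinx xi t * H t).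

Section IBP.
Variables (H : 'rV[R]_n -> R) (C : R) (i : 'I_n) (xi : 'rV[R]_n).
Hypotheses (sH : smoothn 1 H) (mdH : measurable_fun setT (fun x => 'D_(ek i) H x))
  (cH : ctrl 1 (fun t => C * wt 2 t) H).

Let Hle t : `|H t| <= C * wt 2 t. Proof. exact: (cH (l := [::])). Qed.
Let dHle t : `|'D_(ek i) H t| <= C * wt 2 t. Proof. exact: (cH (l := [:: i])). Qed.
Let dH x : differentiable H x. Proof. exact: (smoothn_diff sH). Qed.
Let mH : measurable_fun setT H. Proof. exact: (smoothn_meas sH). Qed.

Let bounded_mul g f : (forall t, `|g t| <= 1) -> (forall t, `|f t| <= C * wt 2 t) ->
  forall t, `|g t * f t| <= C * wt 2 t.
Proof.
move=> g1 fC t; rewrite normrM -[leRHS]mul1r; exact: ler_pM.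
Qed.

(** Integration by parts: the derivative of [g * H] has integral zero. Leaving [g] abstract covers
    sine and cosine at once. *)
Let key g dg (c : R) : (forall x, differentiable g x) -> measurable_fun setT g ->
  measurable_fun setT dg ->
  (forall x, 'D_(ek i) g x = c * dg x) -> (forall t, `|g t| <= 1) ->
  (forall t, `|dg t| <= 1) ->
  \int[leb n]_t (g t * 'D_(ek i) H t) = - c * \int[leb n]_t (dg t * H t).
Proof.
move=> dfg mg mdg Eg g1 dg1.
have D t : 'D_(ek i) (fun t => g t * H t) t = c * (dg t * H t) + g t * 'D_(ek i) H t.
  have := derive_mul i dfg dH; move/(congr1 (@^~ t)) => /= ->.
  by rewrite Eg mulrA.
have m1 : measurable_fun setT (fun t => dg t * H t) by exact: measurable_funM.
have m2 : measurable_fun setT (fun t => g t * 'D_(ek i) H t) by exact: measurable_funM.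
have i1 := le_integrable_wt m1 (bounded_mul dg1 Hle).
have i2 := le_integrable_wt m2 (bounded_mul g1 dHle).
have Z : \int[leb n]_t 'D_(ek i) (fun t => g t * H t) t = 0.
  apply: (@Rintegral_derive _ _ _ _ ((`|c| + 1) * C)).
  - by move=> x; apply: differentiableM.
  - under eq_fun do rewrite D.
    by apply: measurable_funD => //; apply: measurable_funM => //; exact: measurable_cst.
  - move=> t; apply: (le_trans (bounded_mul g1 Hle t)).
    rewrite -mulrA ler_peMl ?lerDr//.
    by have := dHle t; have := normr_ge0 ('D_(ek i) H t); lra.
  - move=> t; rewrite D (le_trans (ler_normD _ _))//.
    rewrite -mulrA mulrDl mul1r lerD//; last exact: (bounded_mul g1 dHle).
    by rewrite normrM ler_wpM2l//; exact: (bounded_mul dg1 Hle).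
have : \int[leb n]_t (c * (dg t * H t) + g t * 'D_(ek i) H t) = 0.
  by rewrite -Z; apply: eq_Rintegral => t _; rewrite D.
rewrite RintegralD//; last first.
  exact: (integrableZl measurableT c i1).
rewrite RintegralZl// => E; lra.
Qed.

Lemma cosI_derive : cosI xi (fun t => 'D_(ek i) H t) = 2 * pi * xi 0 i * sinI xi H.
Proof.
rewrite /cosI (@key _ (sinx xi) (- (2 * pi * xi 0 i))) ?opprK//.
- exact: diff_cosx.
- exact: meas_cosx.
- exact: meas_sinx.
- by move=> x; exact: derive_cosx.
- exact: cosx_le1.
- exact: sinx_le1.
Qed.

Lemma sinI_derive : sinI xi (fun t => 'D_(ek i) H t) = - (2 * pi * xi 0 i) * cosI xi H.
Proof.
rewrite /sinI (@key _ (cosx xi) (2 * pi * xi 0 i))//.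
- exact: diff_sinx.
- exact: meas_sinx.
- exact: meas_cosx.
- by move=> x; exact: derive_sinx.
- exact: sinx_le1.
- exact: cosx_le1.
Qed.

End IBP.

(* On the Fourier side this multiplies by [1 + 4 pi^2 xi_i^2]. *)
Definition one_sub_d2 i H : 'rV[R]_n -> R :=
  fun t => H t + (-1) * 'D_(ek i) (fun x => 'D_(ek i) H x) t.

Lemma one_sub_d2_ctrl L (w : 'rV[R]_n -> R) i H :
  smoothn L.+2 H -> ctrl L.+2 w H ->
  smoothn L (one_sub_d2 i H) /\ ctrl L (fun t => 2 * w t) (one_sub_d2 i H).
Proof.
move=> sH cH.
have s0 : smoothn L H by apply: smoothn_le sH; rewrite -addn2 leq_addr.
have s2 : smoothn L (fun t => 'D_(ek i) (fun x => 'D_(ek i) H x) t).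
  by do 2 apply: smoothn_D.
have c0 : ctrl L w H by apply: ctrl_le cH; rewrite -addn2 leq_addr.
have c2 : ctrl L w (fun t => 'D_(ek i) (fun x => 'D_(ek i) H x) t).
  by do 2 apply: ctrl_D.
split; first by apply: smoothnD => //; exact: smoothnZ.
move=> l sl x; rewrite partialsD; last 2 first.
- exact: smoothn_le s0.
- by apply: smoothnZ; exact: smoothn_le s2.
rewrite partialsZ; last exact: smoothn_le s2.
rewrite mulN1r (le_trans (ler_normB _ _))// mulrDl mul1r lerD//.
- exact: c0.
- exact: c2.
Qed.

Lemma ctrl_derive_meas L i H : smoothn L.+1 H ->
  measurable_fun setT (fun x => 'D_(ek i) H x).
Proof. by move=> sH; apply: (@smoothn_meas _ _ L); exact: smoothn_D. Qed.

Lemma one_sub_d2_cosI C i H xi : smoothn 2 H -> ctrl 2 (fun t => C * wt 2 t) H ->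
  cosI xi (one_sub_d2 i H) = (1 + (2 * pi * xi 0 i) ^+ 2) * cosI xi H /\
  sinI xi (one_sub_d2 i H) = (1 + (2 * pi * xi 0 i) ^+ 2) * sinI xi H.
Proof.
move=> sH cH.
have sd : smoothn 1 (fun x => 'D_(ek i) H x) by exact: smoothn_D.
have s1 : smoothn 1 H by exact: smoothn_le sH.
have cd : ctrl 1 (fun t => C * wt 2 t) (fun x => 'D_(ek i) H x) by exact: ctrl_D.
have c1 : ctrl 1 (fun t => C * wt 2 t) H by exact: ctrl_le cH.
have mH := smoothn_meas sH.
have md := smoothn_meas sd.
have mdd : measurable_fun setT (fun t => 'D_(ek i) (fun x => 'D_(ek i) H x) t).
  exact: (@ctrl_derive_meas 0 i _ sd).
have ib (g f : 'rV[R]_n -> R) : measurable_fun setT g -> measurable_fun setT f ->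
    (forall t, `|g t| <= 1) -> (forall t, `|f t| <= C * wt 2 t) ->
    (leb n).-integrable setT (EFin \o (fun t => g t * f t)).
  move=> mg mf g1 fC; apply: (@le_integrable_wt _ _ _ C).
    exact: measurable_funM.
  by move=> t; rewrite normrM -[leRHS]mul1r; exact: ler_pM.
have split (g : 'rV[R]_n -> R) : measurable_fun setT g -> (forall t, `|g t| <= 1) ->
   \int[leb n]_t (g t * one_sub_d2 i H t) =
   \int[leb n]_t (g t * H t) -
   \int[leb n]_t (g t * 'D_(ek i) (fun x => 'D_(ek i) H x) t).
  move=> mg g1; rewrite -RintegralB//.
  - by apply: eq_Rintegral => t _; rewrite /one_sub_d2; ring.
  - by apply: (ib _ _ mg mH g1) => t; exact: (cH [::]).
  - by apply: (ib _ _ mg mdd g1) => t; exact: (cH [:: i; i]).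
rewrite {1}/cosI {1}/sinI (split _ (meas_cosx xi) (cosx_le1 xi)) (split _ (meas_sinx xi) (sinx_le1 xi)).
rewrite -!/(cosI _ _) -!/(sinI _ _).
rewrite (cosI_derive xi sd mdd cd) (sinI_derive xi s1 md c1).
rewrite (sinI_derive xi sd mdd cd) (cosI_derive xi s1 md c1).
by split; ring.
Qed.

(** Every index in [l] costs two derivatives and doubles the majorant, and gains one factor
    [1 + (2 pi xi_i)^2] on the Fourier side. *)
Lemma one_sub_d2_iter (l : seq 'I_n) C H xi :
  smoothn (size l).*2 H -> ctrl (size l).*2 (fun t => C * wt 2 t) H ->
  `|cosI xi H| * \prod_(i <- l) (1 + (2 * pi * xi 0 i) ^+ 2) <= 2 ^+ size l * C * wt_int n /\
  `|sinI xi H| * \prod_(i <- l) (1 + (2 * pi * xi 0 i) ^+ 2) <= 2 ^+ size l * C * wt_int n.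
Proof.
elim: l C H => [|i l IH] C H sH cH.
  rewrite !big_nil !mulr1 expr0 mul1r.
  have mH := smoothn_meas sH.
  split; apply: le_Rintegral_wt.
  - by apply: measurable_funM => //; exact: meas_cosx.
  - move=> t; rewrite normrM -[leRHS]mul1r; apply: ler_pM => //.
    + exact: cosx_le1.
    + exact: (cH [::]).
  - by apply: measurable_funM => //; exact: meas_sinx.
  - move=> t; rewrite normrM -[leRHS]mul1r; apply: ler_pM => //.
    + exact: sinx_le1.
    + exact: (cH [::]).
have [sO cO] := one_sub_d2_ctrl i sH cH.
have cO' : ctrl (size l).*2 (fun t => 2 * C * wt 2 t) (one_sub_d2 i H).
  by move=> l' sl x; rewrite -mulrA; exact: cO.
have [I1 I2] := IH _ _ sO cO'.
have [E1 E2] := @one_sub_d2_cosI C i H xi (smoothn_le (leq_addr _ 2) sH) (ctrl_le (leq_addr _ 2) cH).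
have E : 2 ^+ (size l).+1 * C * wt_int n = 2 ^+ size l * (2 * C) * wt_int n.
  by rewrite exprS; ring.
rewrite !big_cons /= E.
have p0 : 0 <= 1 + (2 * pi * xi 0 i) ^+ 2 by rewrite addr_ge0// sqr_ge0.
split.
- by rewrite mulrCA mulrA -(ger0_norm p0) -normrM -E1.
- by rewrite mulrCA mulrA -(ger0_norm p0) -normrM -E2.
Qed.

Lemma trig_decay C H xi : smoothn (4 * n) H -> ctrl (4 * n) (fun t => C * wt 2 t) H ->
  `|cosI xi H| <= 16 ^+ n * C * wt_int n * wt 4 xi /\
  `|sinI xi H| <= 16 ^+ n * C * wt_int n * wt 4 xi.
Proof.
move=> sH cH.
(* Each index occurs twice, because two factors [1 + (2 pi xi_i)^2] dominate [(1 + |xi_i|)^4 / 4].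
   Per coordinate, this 4 and the two doublings of the majorant give the constant 16. *)
pose l := enum 'I_n ++ enum 'I_n.
have sl : size l = (2 * n)%N by rewrite size_cat size_enum_ord addnn mul2n.
have sl2 : (size l).*2 = (4 * n)%N by rewrite sl -muln2; lia.
rewrite -sl2 in sH cH.
have [I1 I2] := one_sub_d2_iter xi sH cH.
have P : (wt 4 xi)^-1 <= 4 ^+ n * \prod_(i <- l) (1 + (2 * pi * xi 0 i) ^+ 2).
  rewrite /l big_cat /= !big_enum/= -big_split/= /wt -prodfV.
  have -> : 4 ^+ n = \prod_(i < n) (4 : R) by rewrite prodr_const card_ord.
  rewrite -big_split/=; apply: ler_prod => i _.
  rewrite invr_ge0 pw_ge0/= (pw_nat 4) invrK.
  have p1 : 1 <= pi :> R.
    by have := @pi_ge2 R; lra.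
  set y := xi 0 i; have y2 : y ^+ 2 = `|y| ^+ 2 by rewrite real_normK ?num_real.
  have A : (1 + `|y|) ^+ 2 <= 2 * (1 + (2 * pi * y) ^+ 2).
    rewrite exprMn y2.
    have B : 1 <= (2 * pi : R) ^+ 2 by rewrite exprn_ege1//; lra.
    have := sqr_ge0 (`|y|); have := sqr_ge0 (1 - `|y|); nra.
  have -> : (1 + `|y|) ^+ 4 = (1 + `|y|) ^+ 2 * (1 + `|y|) ^+ 2 by rewrite -exprD.
  have -> : 4 * ((1 + (2 * pi * y) ^+ 2) * (1 + (2 * pi * y) ^+ 2))
    = (2 * (1 + (2 * pi * y) ^+ 2)) * (2 * (1 + (2 * pi * y) ^+ 2)) by ring.
  by apply: ler_pM => //; exact: sqr_ge0.
have w0 : 0 < wt 4 xi by exact: wt_gt0.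
rewrite sl exprM -[2 ^+ 2]/(2 * 2) in I1 I2.
have fin (a : R) : 0 <= a -> a * \prod_(i <- l) (1 + (2 * pi * xi 0 i) ^+ 2)
      <= (2 * 2) ^+ n * C * wt_int n -> a <= 16 ^+ n * C * wt_int n * wt 4 xi.
  move=> a0 aI.
  rewrite -ler_pdivrMr//; apply: (le_trans (ler_wpM2l a0 P)).
  rewrite mulrCA; have -> : 16 = 4 * (2 * 2) :> R by ring.
  rewrite exprMn -!mulrA ler_wpM2l ?exprn_ge0//.
  by move: aI; rewrite -!mulrA.
by split; apply: fin.
Qed.

End MainEstimate.

(** * The short-time Fourier transform of Schwartz functions *)

Section SchwartzEstimate.
Local Open Scope classical_set_scope.
Local Open Scope complex_scope.
Context {R : realType} {n : nat}.
Local Notation Re := (@complex.Re R).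
Local Notation Im := (@complex.Im R).
Implicit Types (f F G : 'rV[R]_n -> R[i]) (t x xi : 'rV[R]_n).

Definition sem (N : nat) f : R := fine (seminorm N f).

Lemma seminorm_ge0 N f : (0 <= seminorm N f)%E.
Proof.
apply: (@le_trans _ _ ((1 + enorm 0) ^+ N * cmod (cpartials [::] f 0))%:E).
  by rewrite lee_fin mulr_ge0 ?cmod_ge0// exprn_ge0// addr_ge0// sqrtr_ge0.
by apply: ereal_sup_ubound; exists [::], 0.
Qed.

Lemma sem_ge0 N f : 0 <= sem N f.
Proof. by rewrite fine_ge0// seminorm_ge0. Qed.

Lemma semE N f : schwartz f -> seminorm N f = (sem N f)%:E.
Proof.
move=> [_ /(_ N) fN]; rewrite /sem fineK//.
by rewrite ge0_fin_numE// seminorm_ge0.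
Qed.

Lemma schwartz_bound N f l t : schwartz f -> (size l <= N)%N ->
  cmod (cpartials l f t) <= sem N f * ((1 + enorm t) ^+ N)^-1.
Proof.
move=> sf lN; have e0 : 0 < (1 + enorm t) ^+ N.
  by apply: exprn_gt0; rewrite ltr_pwDl// sqrtr_ge0.
rewrite ler_pdivlMr// mulrC -lee_fin -semE//.
by apply: ereal_sup_ubound; exists l, t.
Qed.

Lemma smooth_Re L f : smooth f -> smoothn L (fun t => Re (f t)).
Proof. by move=> sf l _ x; have [] := sf l x. Qed.

Lemma smooth_Im L f : smooth f -> smoothn L (fun t => Im (f t)).
Proof. by move=> sf l _ x; have [] := sf l x. Qed.

Lemma schwartz_ctrl k f : schwartz f ->
  ctrl (n * k) (fun t => sem (n * k) f * wt k%:R t) (fun t => Re (f t)) /\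
  ctrl (n * k) (fun t => sem (n * k) f * wt k%:R t) (fun t => Im (f t)).
Proof.
move=> sf; split=> l ls t.
- apply: le_trans (le_trans (cmod_Re (cpartials l f t)) (schwartz_bound t sf ls)) _.
  by rewrite ler_wpM2l ?sem_ge0// enorm_wt.
- apply: le_trans (le_trans (cmod_Im (cpartials l f t)) (schwartz_bound t sf ls)) _.
  by rewrite ler_wpM2l ?sem_ge0// enorm_wt.
Qed.

Lemma schwartz_le k f t : schwartz f -> cmod (f t) <= sem (n * k) f * wt k%:R t.
Proof.
move=> sf; apply: le_trans (_ : sem (n * k) f * ((1 + enorm t) ^+ (n * k))^-1 <= _).
  have := @schwartz_bound (n * k) f [::] t sf isT.
  by rewrite /cpartials/=; case: (f t).
by rewrite ler_wpM2l ?sem_ge0// enorm_wt.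
Qed.

Lemma smooth_cmeas f : smooth f -> cmeas f.
Proof.
move=> sf; split.
- exact: (smoothn_meas (@smooth_Re 0 _ sf)).
- exact: (smoothn_meas (@smooth_Im 0 _ sf)).
Qed.

Lemma schwartz_nice f : schwartz f -> nice f.
Proof.
move=> sf; split; first by apply: smooth_cmeas; case: sf.
by exists (sem (n * 2) f) => t; exact: schwartz_le.
Qed.

Lemma e2piD (a b : R) : e2pi (a + b) = e2pi a * e2pi b.
Proof. by rewrite /e2pi mulrDr cosD sinD; apply: complexP => /=; ring. Qed.

Lemma e2pi0 : e2pi (0 : R) = 1.
Proof. by rewrite /e2pi mulr0 cos0 sin0. Qed.

Lemma e2piJ (a : R) : (e2pi a)^* = e2pi (- a).
Proof. by rewrite /e2pi mulrN cosN sinN. Qed.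

Lemma cmod_e2pi (a : R) : cmod (e2pi a) = 1.
Proof. by rewrite /ComplexField.Normc.normc /e2pi cos2Dsin2 sqrtr1. Qed.

Lemma cmeas_e2pi d (T : measurableType d) (f : T -> R) :
  measurable_fun setT f -> cmeas (fun u : T => e2pi (f u)).
Proof.
move=> mf; have m2 : measurable_fun setT (fun u : T => 2 * pi * f u).
  by apply: measurable_funM => //; exact: measurable_cst.
split => /=.
- apply: (measurableT_comp _ m2); apply: continuous_measurable_fun; exact: continuous_cos.
- apply: (measurableT_comp _ m2); apply: continuous_measurable_fun; exact: continuous_sin.
Qed.

Lemma measurable_dotrv d (T : measurableType d) m (f g : T -> 'rV[R]_m) :
  measurable_fun setT f -> measurable_fun setT g ->
  measurable_fun setT (fun u : T => dotrv (f u) (g u)).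
Proof.
move=> mf mg; apply: measurable_sum => i; apply: measurable_funM.
- exact: (measurableT_comp (measurable_coord i) mf).
- exact: (measurableT_comp (measurable_coord i) mg).
Qed.

Lemma nice_modul xi f : nice f -> nice (modul xi f).
Proof.
move=> nf; apply: (@nice_mulb _ _ _ _ 1) => //.
- apply: cmeas_e2pi.
  by apply: measurable_dotrv; [exact: measurable_id|exact: measurable_cst].
- by move=> t; rewrite cmod_e2pi.
Qed.

Lemma nice_transl x f : nice f -> nice (transl x f).
Proof. by move=> nf; exact: nice_shift. Qed.

Lemma nice_mul f g : nice f -> nice g -> nice (fun t => f t * g t).
Proof.
move=> nf ng; have [C C0 fC] := nice_bound nf.
apply: (@nice_mulb _ _ _ _ C) => //; first by case: nf.
by move=> t; apply: (le_trans (fC t)); rewrite ler_piMr// wt_le1.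
Qed.

Section RealParts.
Variables (g h : 'rV[R]_n -> R) (a b : R) (x xi : 'rV[R]_n).
Hypotheses (sg : smoothn (4 * n) g) (sh : smoothn (4 * n) h).
Hypotheses (cg : ctrl (4 * n) (fun t => a * wt 6 t) g).
Hypotheses (ch : ctrl (4 * n) (fun t => b * wt 6 t) h).

Let p t := g (t - x) * h t.

Let a0 : 0 <= a.
Proof.
have := le_trans (normr_ge0 _) (cg (l := [::]) isT 0).
by rewrite pmulr_lge0//; exact: wt_gt0.
Qed.

Let b0 : 0 <= b.
Proof.
have := le_trans (normr_ge0 _) (ch (l := [::]) isT 0).
by rewrite pmulr_lge0//; exact: wt_gt0.
Qed.

Let sp : smoothn (4 * n) p.
Proof. by apply: smoothnM => //; exact: smoothn_transl. Qed.

(** The exponent 6 is split as 4 + 2. By Peetre's inequality the weights of exponent 4 at [t - x]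
    and [t] combine into [wt 4 x]; the exponent 2 at [t] is kept for integrability. *)
Let cp : ctrl (4 * n) (fun t => 2 ^+ (4 * n) * a * b * wt 4 x * wt 2 t) p.
Proof.
move=> l ls t.
apply: (le_trans (ctrlM (smoothn_transl (- x) sg) sh (ctrl_transl (- x) cg) ch ls t)).
rewrite -!mulrA ler_wpM2l ?exprn_ge0// ler_wpM2l//.
rewrite mulrCA ler_wpM2l//.
have -> : (6 = 4 + 2 :> R) by ring.
rewrite !(wtD 4 2).
have H : wt 4 (t - x) * wt 4 t <= wt 4 x.
  have := @wt_peetre R n 4 (t - x) (- t) (ler0n R 4).
  by rewrite addrAC subrr sub0r !wtN.
have := wt_le1 (t - x) (ler0n R 2).
have := wt_ge0 2 (t - x); have := wt_ge0 2 t.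
have := wt_ge0 4 (t - x); have := wt_ge0 4 t.
move=> h3 h4 h1 h2 h5.
rewrite mulrACA; apply: (ler_pM (mulr_ge0 h4 h3) (mulr_ge0 h2 h1) H).
exact: ler_piMl.
Qed.

Definition me_cst : R := 16 ^+ n * 2 ^+ (4 * n) * wt_int n.

Lemma me_cst_ge0 : 0 <= me_cst.
Proof. by rewrite !mulr_ge0 ?exprn_ge0// wt_int_ge0. Qed.

Lemma real_estimate : cmod (cint (fun t => e2pi (dotrv t xi) * (g (t - x) * h t)%:C))
  <= 2 * me_cst * (a * b) * (wt 4 x * wt 4 xi).
Proof.
have [E1 E2] := trig_decay xi sp cp.
have -> : cint (fun t => e2pi (dotrv t xi) * (g (t - x) * h t)%:C) =
  cosI xi p +i* sinI xi p.
  rewrite /cint; congr (_ +i* _); apply: eq_Rintegral => t _.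
  - by rewrite Re_mul /= mulr0 subr0.
  - by rewrite Im_mul /= mulr0 add0r.
apply: (le_trans (cmod_le _)) => /=.
apply: (le_trans (lerD E1 E2)).
by rewrite le_eqVlt; apply/orP; left; apply/eqP; rewrite /me_cst; ring.
Qed.

Lemma real_estimate_nice : nice (fun t => e2pi (dotrv t xi) * (g (t - x) * h t)%:C).
Proof.
apply: (@nice_modul xi (fun t => (p t)%:C)); split.
  split => /=; last exact: measurable_cst.
  exact: (smoothn_meas sp).
exists (2 ^+ (4 * n) * a * b * wt 4 x) => t; rewrite cmodr.
exact: (cp (l := [::])).
Qed.

End RealParts.

(* The left-hand side is a short-time Fourier transform of F with window G. *)
Lemma modul_transl_decay G F x xi : schwartz G -> schwartz F ->
  cmod (cint (fun t => modul xi (transl x G) t * F t)) <=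
  8 * me_cst * sem (n * 6) G * sem (n * 6) F * (wt 4 x * wt 4 xi).
Proof.
move=> sG sF.
have n46 : (4 * n <= n * 6)%N by rewrite mulnC leq_mul2l orbT.
have [cG1 cG2] := schwartz_ctrl 6 sG; have [cF1 cF2] := schwartz_ctrl 6 sF.
have [smG _] := sG; have [smF _] := sF.
pose J (g h : 'rV[R]_n -> R) t := e2pi (dotrv t xi) * (g (t - x) * h t)%:C.
have [r1 q1] : smoothn (4 * n) (fun t => Re (G t)) /\ smoothn (4 * n) (fun t => Im (G t)).
  by split; [exact: smooth_Re|exact: smooth_Im].
have [r2 q2] : smoothn (4 * n) (fun t => Re (F t)) /\ smoothn (4 * n) (fun t => Im (F t)).
  by split; [exact: smooth_Re|exact: smooth_Im].
move/(ctrl_le n46) in cG1; move/(ctrl_le n46) in cG2.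
move/(ctrl_le n46) in cF1; move/(ctrl_le n46) in cF2.
have B11 := real_estimate x xi r1 r2 cG1 cF1.
have B12 := real_estimate x xi r1 q2 cG1 cF2.
have B21 := real_estimate x xi q1 r2 cG2 cF1.
have B22 := real_estimate x xi q1 q2 cG2 cF2.
have N11 := real_estimate_nice x xi r1 r2 cG1 cF1.
have N12 := real_estimate_nice x xi r1 q2 cG1 cF2.
have N21 := real_estimate_nice x xi q1 r2 cG2 cF1.
have N22 := real_estimate_nice x xi q1 q2 cG2 cF2.
set b := 2 * _ * _ * _ in B11 B12 B21 B22.
(* Splitting window and function into real and imaginary parts gives four integrals, each bounded
   with the constant [2 * me_cst]; hence the 8. *)
have -> : (fun t => modul xi (transl x G) t * F t) = (fun t =>
    (J (fun t => Re (G t)) (fun t => Re (F t)) t +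
     'i * J (fun t => Re (G t)) (fun t => Im (F t)) t) +
    ('i * J (fun t => Im (G t)) (fun t => Re (F t)) t +
     (-1) * J (fun t => Im (G t)) (fun t => Im (F t)) t)).
  apply/funext => t; rewrite /modul /transl /J.
  case: (G (t - x)) => g1 g2; case: (F t) => f1 f2 /=.
  by case: (e2pi _) => c s; apply: complexP => /=; ring.
rewrite cintD; [|by apply: niceD => //; exact: niceZ|by apply: niceD; exact: niceZ].
rewrite cintD//; last exact: niceZ.
rewrite cintD; [|exact: niceZ|exact: niceZ].
rewrite !cintZ//.
have ci : cmod ('i : R[i]) = 1.
  by rewrite /ComplexField.Normc.normc /= expr0n expr1n add0r sqrtr1.
have c1 : cmod (-1 : R[i]) = 1.
  by rewrite /ComplexField.Normc.normc /= oppr0 expr0n sqrrN expr1n addr0 sqrtr1.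
have -> : 8 * me_cst * sem (n * 6) G * sem (n * 6) F * (wt 4 x * wt 4 xi) = (b + b) + (b + b).
  by rewrite /b; ring.
apply: (le_trans (cmodD _ _)); apply: lerD.
- by apply: (le_trans (cmodD _ _)); rewrite cmodM ci mul1r lerD.
- by apply: (le_trans (cmodD _ _)); rewrite !cmodM ci c1 !mul1r lerD.
Qed.

End SchwartzEstimate.

(** * Gaussians *)

Section GaussClass.
Local Open Scope classical_set_scope.
Local Open Scope complex_scope.
Context {R : realType} {n : nat}.
Implicit Types (P q Q : 'rV[R]_n -> R) (t x : 'rV[R]_n).
Local Notation ek i := (delta_mx 0 i : 'rV[R]_n).

Definition sqn t : R := \sum_i t 0 i ^+ 2.

Lemma sqn_ge0 t : 0 <= sqn t.
Proof. by apply: sumr_ge0 => i _; exact: sqr_ge0. Qed.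

(** Polynomial functions as a syntactic class: closed under partial derivatives and of polynomial
    growth, both by induction on the construction. *)
Inductive polyf : ('rV[R]_n -> R) -> Prop :=
| polyf_cst c : polyf (fun=> c)
| polyf_coord i : polyf (fun t => t 0 i)
| polyf_add P Q : polyf P -> polyf Q -> polyf (fun t => P t + Q t)
| polyf_mul P Q : polyf P -> polyf Q -> polyf (fun t => P t * Q t).

Lemma polyf_opp P : polyf P -> polyf (fun t => - P t).
Proof.
move=> pP; rewrite (_ : (fun _ => _) = (fun t => (-1) * P t)).
  by apply: polyf_mul => //; exact: polyf_cst.
by apply/funext => t; rewrite mulN1r.
Qed.

Lemma polyf_exp P k : polyf P -> polyf (fun t => P t ^+ k).
Proof.
move=> pP; elim: k => [|k IH]; first exact: polyf_cst.
by under eq_fun do rewrite exprS; exact: polyf_mul.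
Qed.

Lemma polyf_sum (I : Type) (r : seq I) (P : I -> 'rV[R]_n -> R) :
  (forall i, polyf (P i)) -> polyf (fun t => \sum_(i <- r) P i t).
Proof.
move=> pP; elim: r => [|i r IH].
  by under eq_fun do rewrite big_nil; exact: polyf_cst.
by under eq_fun do rewrite big_cons; exact: polyf_add.
Qed.

Lemma polyf_diff P : polyf P -> forall x, differentiable P x.
Proof.
elim=> {P} [c|i|P Q _ IP _ IQ|P Q _ IP _ IQ] x.
- exact: differentiable_cst.
- exact: differentiable_coord.
- by apply: differentiableD.
- by apply: differentiableM.
Qed.

Lemma polyf_derive i P : polyf P -> polyf (fun x => 'D_(ek i) P x).
Proof.
elim=> {P} [c|j|P Q pP IP pQ IQ|P Q pP IP pQ IQ].
- have -> : (fun x => 'D_(ek i) (fun=> c) x) = (fun=> 0 : R).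
    by apply/funext => x; exact: derive_cst.
  exact: polyf_cst.
- have -> : (fun x => 'D_(ek i) (fun t : 'rV[R]_n => t 0 j) x) = (fun=> ek j 0 i).
    apply/funext => x; rewrite -(@derive_dotrv _ _ (ek j) x i).
    congr ('D_(ek i) _ x).
    by apply/funext => t; rewrite dotrv_deltar.
  exact: polyf_cst.
- have -> : (fun x => 'D_(ek i) (fun t => P t + Q t) x) =
      (fun x => 'D_(ek i) P x + 'D_(ek i) Q x).
    by apply/funext => x; apply: deriveD; apply: diff_derivable; exact: polyf_diff.
  exact: polyf_add.
- rewrite derive_mul; [|exact: polyf_diff|exact: polyf_diff].
  by apply: polyf_add; exact: polyf_mul.
Qed.

Lemma polyf_growth P : polyf P ->
  exists C N, 0 <= C /\ forall t, `|P t| <= C * (1 + sqn t) ^+ N.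
Proof.
have e1 t N : 1 <= (1 + sqn t) ^+ N by rewrite exprn_ege1// lerDl sqn_ge0.
elim=> {P} [c|i|P Q _ [C [N [C0 PC]]] _ [D [M [D0 QD]]]|P Q _ [C [N [C0 PC]]] _ [D [M [D0 QD]]]].
- by exists `|c|, 0; split => // t; rewrite expr0 mulr1.
- exists 1, 1; split => // t; rewrite expr1 mul1r.
  have H : t 0 i ^+ 2 <= sqn t.
    by rewrite /sqn (bigD1 i)//= lerDl; apply: sumr_ge0 => j _; exact: sqr_ge0.
  have E : t 0 i ^+ 2 = `|t 0 i| ^+ 2 by rewrite real_normK ?num_real.
  rewrite E in H; have := sqr_ge0 (`|t 0 i| - 1); nra.
- exists (C + D), (N + M)%N; split; first exact: addr_ge0.
  move=> t; rewrite (le_trans (ler_normD _ _))// mulrDl lerD//.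
  + apply: (le_trans (PC t)); rewrite ler_wpM2l// exprD ler_peMr// exprn_ge0//.
    by rewrite addr_ge0// sqn_ge0.
  + apply: (le_trans (QD t)); rewrite ler_wpM2l// exprD ler_peMl// exprn_ge0//.
    by rewrite addr_ge0// sqn_ge0.
- exists (C * D), (N + M)%N; split; first exact: mulr_ge0.
  by move=> t; rewrite normrM exprD mulrACA ler_pM.
Qed.

Section Fixed.
Local Notation fpair := (('rV[R]_n -> R) * ('rV[R]_n -> R))%type.
Variables (q Q : 'rV[R]_n -> R).
Hypotheses (pq : polyf q) (pQ : polyf Q).

(** Real form of a polynomial times [exp (2 pi i q - Q)]. Cosine and sine need separate amplitudes
    because differentiation mixes them; [gfun_next] is the resulting rule for the pair. *)
Definition gfun (P : fpair) t : R :=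
  (P.1 t * cos (2 * pi * q t) + P.2 t * sin (2 * pi * q t)) * expR (- Q t).

Let dcos x (v : 'rV[R]_n) : differentiable (fun t => cos (2 * pi * q t)) x /\
  'D_v (fun t => cos (2 * pi * q t)) x = - (2 * pi) * 'D_v q x * sin (2 * pi * q x).
Proof.
have H := @is_derive1_comp R cos ( *%R (2 * pi)) (q x) _ _ (is_derive_cos _) _.
have /H{}H : is_derive (q x) 1 ( *%R (2 * pi)) (2 * pi : R).
  by apply: is_derive_eq; rewrite /GRing.scale/= mulr1.
have [D ->] := derive_comp v H (polyf_diff pq x).
by split => //; ring.
Qed.

Let dsin x (v : 'rV[R]_n) : differentiable (fun t => sin (2 * pi * q t)) x /\
  'D_v (fun t => sin (2 * pi * q t)) x = (2 * pi) * 'D_v q x * cos (2 * pi * q x).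
Proof.
have H := @is_derive1_comp R sin ( *%R (2 * pi)) (q x) _ _ (is_derive_sin _) _.
have /H{}H : is_derive (q x) 1 ( *%R (2 * pi)) (2 * pi : R).
  by apply: is_derive_eq; rewrite /GRing.scale/= mulr1.
have [D ->] := derive_comp v H (polyf_diff pq x).
by split => //; ring.
Qed.

Let dexp x (v : 'rV[R]_n) : differentiable (fun t => expR (- Q t)) x /\
  'D_v (fun t => expR (- Q t)) x = - 'D_v Q x * expR (- Q x).
Proof.
have dN : differentiable (fun t => - Q t) x by exact: (polyf_diff (polyf_opp pQ)).
have [D ->] := derive_comp v (is_derive_expR (- Q x)) dN.
split => //; rewrite mulrC; congr (_ * _).
by rewrite -(@deriveN _ _ _ Q)//; apply: diff_derivable; exact: polyf_diff.
Qed.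

Definition gfun_next i (P : fpair) : fpair :=
  (fun x => 'D_(ek i) P.1 x + (2 * pi * (P.2 x * 'D_(ek i) q x) + - (P.1 x * 'D_(ek i) Q x)),
   fun x => 'D_(ek i) P.2 x + (- (2 * pi * (P.1 x * 'D_(ek i) q x)) + - (P.2 x * 'D_(ek i) Q x))).

Lemma gfun_next_polyf i (P : fpair) : polyf P.1 -> polyf P.2 ->
  polyf (gfun_next i P).1 /\ polyf (gfun_next i P).2.
Proof.
move=> p1 p2; split; rewrite /gfun_next/=.
- apply: polyf_add; first exact: polyf_derive.
  apply: polyf_add; last by apply/polyf_opp/polyf_mul => //; exact: polyf_derive.
  apply: polyf_mul; first exact: polyf_cst.
  by apply: polyf_mul => //; exact: polyf_derive.
- apply: polyf_add; first exact: polyf_derive.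
  apply: polyf_add; last by apply/polyf_opp/polyf_mul => //; exact: polyf_derive.
  apply: polyf_opp; apply: polyf_mul; first exact: polyf_cst.
  by apply: polyf_mul => //; exact: polyf_derive.
Qed.

Lemma gfun_diff (P : fpair) : polyf P.1 -> polyf P.2 -> forall x, differentiable (gfun P) x.
Proof.
move=> p1 p2 x.
have d1 := polyf_diff p1 x; have d2 := polyf_diff p2 x.
have dc := (dcos x 0).1; have ds := (dsin x 0).1; have de := (dexp x 0).1.
apply: differentiableM => //.
by apply: differentiableD; exact: differentiableM.
Qed.

Lemma gfun_derive i (P : fpair) : polyf P.1 -> polyf P.2 ->
  (fun x => 'D_(ek i) (gfun P) x) = gfun (gfun_next i P).
Proof.
move=> p1 p2.
have d1 := polyf_diff p1; have d2 := polyf_diff p2.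
have dc x := (dcos x (ek i)).1; have ds x := (dsin x (ek i)).1.
have de x := (dexp x (ek i)).1.
pose f1 t := P.1 t * cos (2 * pi * q t); pose f2 t := P.2 t * sin (2 * pi * q t).
have df1 x : differentiable f1 x by apply: differentiableM.
have df2 x : differentiable f2 x by apply: differentiableM.
have df x : differentiable (fun t => f1 t + f2 t) x by apply: differentiableD.
have := derive_mul i df de => ->.
apply/funext => x.
have -> : 'D_(ek i) (fun t => f1 t + f2 t) x = 'D_(ek i) f1 x + 'D_(ek i) f2 x.
  by apply: deriveD; exact: diff_derivable.
have /(congr1 (@^~ x)) /= -> := derive_mul i d1 dc.
have /(congr1 (@^~ x)) /= -> := derive_mul i d2 ds.
rewrite (dcos x (ek i)).2 (dsin x (ek i)).2 (dexp x (ek i)).2 /gfun /gfun_next /f1 /f2 /=.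
ring.
Qed.

Lemma gfun_smooth (P : fpair) : polyf P.1 -> polyf P.2 ->
  forall l x, differentiable (partials l (gfun P)) x.
Proof.
move=> + + l; elim/last_ind: l P => [|l i IH] P p1 p2 x /=; first exact: gfun_diff.
rewrite partials_rcons gfun_derive//.
by have [r1 r2] := gfun_next_polyf i p1 p2; exact: IH.
Qed.

Variables (c c' : R).
Hypotheses (c0 : 0 < c) (Qc : forall t, c * sqn t - c' <= Q t).

(** With [k = N + 1] and [s = sqn t], the inequality [1 + y <= exp y] at [y = c s / k] gives
    [1 + s <= (1 + k / c) exp (c s / k)]; its [k]-th power is absorbed by [exp (- Q t)]. Taking
    [N + 1] avoids a division by zero. *)
Lemma exp_poly_bound (N : nat) : exists2 K : R, 0 <= K &
  forall t, (1 + sqn t) ^+ N * expR (- Q t) <= K.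
Proof.
pose K := (1 + N.+1%:R / c) ^+ N.+1 * expR c'.
have K0 : 0 <= 1 + N.+1%:R / c by rewrite addr_ge0// divr_ge0// ltW.
exists K => [|t]; first by rewrite mulr_ge0 ?expR_ge0// exprn_ge0.
have s0 := sqn_ge0 t.
pose y := c * sqn t / N.+1%:R.
have y0 : 0 <= y by rewrite divr_ge0// mulr_ge0// ltW.
have h1 : 1 + sqn t <= (1 + N.+1%:R / c) * expR y.
  apply: (@le_trans _ _ ((1 + N.+1%:R / c) * (1 + y))); last first.
    by rewrite ler_wpM2l// expR_ge1Dx.
  have E0 (k : R) : k != 0 -> k / c * (c * sqn t / k) = sqn t.
    by move=> k0; field; rewrite k0; apply: lt0r_neq0.
  have E : N.+1%:R / c * y = sqn t by apply: E0; rewrite pnatr_eq0.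
  rewrite mulrDl mul1r mulrDr mulr1 E.
  have := divr_ge0 (ler0n R N.+1) (ltW c0); lra.
have h2 : (1 + sqn t) ^+ N.+1 <= (1 + N.+1%:R / c) ^+ N.+1 * expR (c * sqn t).
  apply: (@le_trans _ _ (((1 + N.+1%:R / c) * expR y) ^+ N.+1)).
    apply: lerXn2r => //; rewrite nnegrE; first exact: addr_ge0.
    by rewrite mulr_ge0// expR_ge0.
  rewrite exprMn -expRM_natl /y mulrC [N.+1%:R * _]mulrC divfK//.
  by rewrite mulrC.
have h3 : expR (- Q t) <= expR c' * expR (- (c * sqn t)).
  by rewrite -expRD ler_expR; have := Qc t; lra.
apply: (@le_trans _ _ ((1 + sqn t) ^+ N.+1 * expR (- Q t))).
  rewrite ler_wpM2r ?expR_ge0// exprS ler_peMl// ?lerDl//.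
  by rewrite exprn_ge0// addr_ge0.
apply: (le_trans (ler_pM _ (expR_ge0 _) h2 h3)); first by rewrite exprn_ge0// addr_ge0.
rewrite /K le_eqVlt; apply/orP; left; apply/eqP.
rewrite -mulrA; congr (_ * _); rewrite mulrCA -expRD subrr expR0 mulr1//.
Qed.

Lemma gfun_decay (M : nat) (P : fpair) : polyf P.1 -> polyf P.2 ->
  exists2 K : R, 0 <= K & forall t, (1 + sqn t) ^+ M * `|gfun P t| <= K.
Proof.
move=> /polyf_growth[C1 [N1 [C10 P1]]] /polyf_growth[C2 [N2 [C20 P2]]].
have [K1 K10 H1] := exp_poly_bound (M + N1).
have [K2 K20 H2] := exp_poly_bound (M + N2).
exists (C1 * K1 + C2 * K2) => [|t]; first by rewrite addr_ge0// mulr_ge0.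
have e0 : 0 <= (1 + sqn t) ^+ M by rewrite exprn_ge0// addr_ge0// sqn_ge0.
rewrite /gfun normrM (ger0_norm (expR_ge0 _)) mulrA.
have := H1 t; have := H2 t; rewrite !exprD => G2 G1.
have trig : `|P.1 t * cos (2 * pi * q t) + P.2 t * sin (2 * pi * q t)| <= `|P.1 t| + `|P.2 t|.
  apply: (le_trans (ler_normD _ _)); rewrite !normrM lerD//; apply: ler_piMr => //.
  - by rewrite ler_norml cos_geN1 cos_le1.
  - by rewrite ler_norml sin_geN1 sin_le1.
apply: (@le_trans _ _ ((1 + sqn t) ^+ M * (C1 * (1 + sqn t) ^+ N1 + C2 * (1 + sqn t) ^+ N2) * expR (- Q t))).
  rewrite ler_wpM2r ?expR_ge0// ler_wpM2l//; apply: (le_trans trig).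
  by rewrite lerD.
have -> : (1 + sqn t) ^+ M * (C1 * (1 + sqn t) ^+ N1 + C2 * (1 + sqn t) ^+ N2) * expR (- Q t)
  = C1 * ((1 + sqn t) ^+ M * (1 + sqn t) ^+ N1 * expR (- Q t))
  + C2 * ((1 + sqn t) ^+ M * (1 + sqn t) ^+ N2 * expR (- Q t)) by ring.
by rewrite lerD// ler_wpM2l.
Qed.

Lemma gfun_decay_all (M L : nat) (P : fpair) : polyf P.1 -> polyf P.2 ->
  exists2 K : R, 0 <= K & forall l t, (size l <= L)%N ->
    (1 + sqn t) ^+ M * `|partials l (gfun P) t| <= K.
Proof.
elim: L P => [|L IH] P p1 p2.
  have [K K0 H] := gfun_decay M p1 p2; exists K => // -[|//] t _; exact: H.
have [K K0 H] := gfun_decay M p1 p2.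
have /choice[D HD] i : exists D : R, 0 <= D /\ forall l t, (size l <= L)%N ->
    (1 + sqn t) ^+ M * `|partials l (gfun (gfun_next i P)) t| <= D.
  have [r1 r2] := gfun_next_polyf i p1 p2.
  by have [D D0 HD] := IH _ r1 r2; exists D.
have D0 i : 0 <= D i by have [] := HD i.
exists (K + \sum_i D i) => [|l t]; first by rewrite addr_ge0// sumr_ge0.
case/lastP: l => [_|l i].
  by apply: (le_trans (H t)); rewrite lerDl sumr_ge0.
rewrite size_rcons ltnS => sl; rewrite partials_rcons gfun_derive//.
have [_ Hi] := HD i; apply: (le_trans (Hi l t sl)).
by rewrite (bigD1 i)//= addrCA lerDl addr_ge0// sumr_ge0.
Qed.

(** The common form [exp (2 pi i q - Q)] of shifted Gaussians, chirped Gaussians and smooth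
    approximations of boxes. Since [Q] is any polynomial with a quadratic lower bound, one proof
    shows that all of them are Schwartz. *)
Definition gwave t : R[i] := e2pi (q t) * (expR (- Q t))%:C.

Lemma gwave_Re t : complex.Re (gwave t) = gfun (fun=> 1, fun=> 0) t.
Proof. by rewrite Re_mul /gfun /= mulr0 subr0 mul1r mul0r addr0. Qed.

Lemma gwave_Im t : complex.Im (gwave t) = gfun (fun=> 0, fun=> 1) t.
Proof. by rewrite Im_mul /gfun /= mulr0 add0r mul1r mul0r add0r. Qed.

Lemma enorm_sqn t : 1 + enorm t <= 2 * (1 + sqn t).
Proof.
have s0 := sqn_ge0 t.
suff : enorm t <= 1 + sqn t by lra.
rewrite /enorm -/(sqn t) -[leRHS]ger0_norm ?addr_ge0// -sqrtr_sqr ler_wsqrtr//.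
nra.
Qed.

Lemma schwartz_gwave : schwartz gwave.
Proof.
have fR : (fun t => complex.Re (gwave t)) = gfun (fun=> 1, fun=> 0).
  by apply/funext => t; exact: gwave_Re.
have fI : (fun t => complex.Im (gwave t)) = gfun (fun=> 0, fun=> 1).
  by apply/funext => t; exact: gwave_Im.
split.
  move=> l x; rewrite fR fI.
  by split; apply: gfun_smooth; exact: polyf_cst.
move=> N.
have [K1 K10 H1] := @gfun_decay_all N N (fun=> 1, fun=> 0) (polyf_cst _) (polyf_cst _).
have [K2 K20 H2] := @gfun_decay_all N N (fun=> 0, fun=> 1) (polyf_cst _) (polyf_cst _).
apply: (@le_lt_trans _ _ (2 ^+ N * (K1 + K2))%:E); last exact: ltry.
apply: ge_ereal_sup => _ [l [t [sl ->]]]; rewrite lee_fin.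
have e0 : 0 <= 1 + enorm t by rewrite addr_ge0// sqrtr_ge0.
apply: (@le_trans _ _ (2 ^+ N * ((1 + sqn t) ^+ N * cmod (cpartials l gwave t)))).
  rewrite mulrA ler_wpM2r ?cmod_ge0// -exprMn lerXn2r ?nnegrE ?enorm_sqn//.
  by rewrite mulr_ge0// addr_ge0// sqn_ge0.
rewrite ler_wpM2l ?exprn_ge0//.
apply: (@le_trans _ _ ((1 + sqn t) ^+ N * (`|partials l (gfun (fun=> 1, fun=> 0)) t| +
    `|partials l (gfun (fun=> 0, fun=> 1)) t|))).
  rewrite ler_wpM2l ?exprn_ge0 ?addr_ge0 ?sqn_ge0//.
  by apply: (le_trans (cmod_le _)); rewrite /cpartials/= fR fI.
by rewrite mulrDr lerD//; [exact: H1|exact: H2].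
Qed.

End Fixed.

End GaussClass.

(** * The Fourier transform of a Gaussian *)

Section GaussFourier.
Local Open Scope classical_set_scope.
Context {R : realType} {n : nat}.
Implicit Types (t x w xi : 'rV[R]_n).
Local Notation ek i := (delta_mx 0 i : 'rV[R]_n).

Lemma polyf_sqn : polyf (@sqn R n).
Proof. by apply: polyf_sum => i; apply: polyf_exp; exact: polyf_coord. Qed.

Lemma inv_sqn_wt t (C : R) (v : R) : (1 + sqn t) ^+ (n * 2) * v <= C -> 0 <= C ->
  v <= 2 ^+ (n * 2) * C * wt 2 t.
Proof.
move=> vC C0; have s0 : 0 < (1 + sqn t) ^+ (n * 2).
  by rewrite exprn_gt0// ltr_pwDl// sqn_ge0.
have e0 : 0 < (1 + enorm t) ^+ (n * 2).
  by rewrite exprn_gt0// ltr_pwDl// sqrtr_ge0.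
move: vC; rewrite -ler_pdivlMl// => vC; apply: (le_trans vC).
rewrite mulrC [2 ^+ _ * C]mulrC -mulrA ler_wpM2l//.
apply: (@le_trans _ _ (2 ^+ (n * 2) * ((1 + enorm t) ^+ (n * 2))^-1)).
  rewrite ler_pdivlMr// ler_pdivrMl// -exprMn mulrC lerXn2r ?nnegrE//.
  - by rewrite addr_ge0// sqrtr_ge0.
  - by rewrite mulr_ge0// addr_ge0// sqn_ge0.
  - exact: enorm_sqn.
by rewrite ler_wpM2l// enorm_wt.
Qed.

Lemma polyf_exp_wt (P Q : 'rV[R]_n -> R) (c c' : R) : polyf P -> polyf Q -> 0 < c ->
  (forall t, c * sqn t - c' <= Q t) ->
  exists C, forall t, `|P t * expR (- Q t)| <= C * wt 2 t.
Proof.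
move=> pP pQ c0 Qc.
have [K K0 H] := @gfun_decay R n (fun=> 0) Q c c' c0 Qc (n * 2) (P, fun=> 0) pP (polyf_cst 0).
exists (2 ^+ (n * 2) * K) => t; apply: inv_sqn_wt => //.
by have := H t; rewrite /gfun /= mulr0 cos0 mulr1 mul0r addr0.
Qed.

Variable a : R.
Hypothesis a0 : 0 < a.

Definition gaus t : R := expR (- (a * sqn t)).

Lemma gaus_gt0 t : 0 < gaus t. Proof. exact: expR_gt0. Qed.

Let polyQ : polyf (fun t => a * sqn t).
Proof. by apply: polyf_mul; [exact: polyf_cst|exact: polyf_sqn]. Qed.

Let Qc t : a * sqn t - 0 <= a * sqn t. Proof. by rewrite subr0. Qed.

Let gausE : gaus = gfun (fun=> 0) (fun t => a * sqn t) (fun=> 1, fun=> 0).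
Proof.
by apply/funext => t; rewrite /gfun /= mulr0 cos0 mulr1 mul0r addr0 mul1r.
Qed.

Lemma gaus_smooth L : smoothn L gaus.
Proof.
move=> l _ x; rewrite gausE; apply: gfun_smooth => //; exact: polyf_cst.
Qed.

Lemma polyf_gaus_wt (P : 'rV[R]_n -> R) : polyf P ->
  exists C, forall t, `|P t * gaus t| <= C * wt 2 t.
Proof. by move=> pP; exact: (polyf_exp_wt pP polyQ a0 Qc). Qed.

Lemma gaus_ctrl L : exists C, ctrl L (fun t => C * wt 2 t) gaus.
Proof.
have [K K0 H] := @gfun_decay_all R n (fun=> 0) (fun t => a * sqn t) (polyf_cst 0) polyQ a 0 a0 Qc
  (n * 2) L (fun=> 1, fun=> 0) (polyf_cst _) (polyf_cst _).
exists (2 ^+ (n * 2) * K) => l sl t; apply: inv_sqn_wt => //.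
by rewrite gausE; exact: H.
Qed.

Lemma derive_sqn i x : 'D_(ek i) (@sqn R n) x = 2 * x 0 i.
Proof.
have E : x + (0 : R) *: ek i = x by rewrite scale0r addr0.
have := @derive_line R n (ek i) x (@sqn R n) 0 (polyf_diff polyf_sqn _).
rewrite E => -[_ <-].
have -> : (fun s : R => sqn (x + s *: ek i)) = (fun s => sqn x + s * (2 * x 0 i) + s * s).
  apply/funext => s; rewrite /sqn (bigD1 i)//= [in RHS](bigD1 i)//= !mxE !eqxx mulr1.
  rewrite (eq_bigr (fun j => x 0 j ^+ 2)); first by ring.
  by move=> j ji; rewrite !mxE (negbTE ji) mulr0 addr0.
have H : is_derive (0 : R) 1 (fun s : R => sqn x + s * (2 * x 0 i) + s * s) (2 * x 0 i).
  by apply: is_derive_eq; rewrite /GRing.scale/=; ring.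
by case: H.
Qed.

Lemma derive_gaus i x : 'D_(ek i) gaus x = - (2 * a) * (x 0 i * gaus x).
Proof.
have dQ : differentiable (fun t => - (a * sqn t)) x.
  exact: (polyf_diff (polyf_opp polyQ)).
have [_ ->] := derive_comp (ek i) (is_derive_expR (- (a * sqn x))) dQ.
have -> : 'D_(ek i) (fun t => - (a * sqn t)) x = - (a * (2 * x 0 i)).
  have -> : (fun t => - (a * sqn t)) = (- a) \*: (@sqn R n).
    by apply/funext => t; rewrite /= scaleNr.
  rewrite deriveZ ?derive_sqn; last by apply: diff_derivable; exact: (polyf_diff polyf_sqn).
  by rewrite /GRing.scale/= mulNr.
by rewrite /gaus; ring.
Qed.

Lemma meas_gaus : measurable_fun setT gaus.
Proof. exact: (smoothn_meas (@gaus_smooth 0)). Qed.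

Let mk i : measurable_fun setT (fun t : 'rV[R]_n => t 0 i * gaus t).
Proof. by apply: measurable_funM; [exact: measurable_coord|exact: meas_gaus]. Qed.

Let trig_int (g f : 'rV[R]_n -> R) : measurable_fun setT g -> measurable_fun setT f ->
  (forall t, `|g t| <= 1) -> (exists C, forall t, `|f t| <= C * wt 2 t) ->
  (leb n).-integrable setT (EFin \o (fun t => g t * f t)).
Proof.
move=> mg mf g1 [C fC]; apply: (@le_integrable_wt _ _ _ C); first exact: measurable_funM.
by move=> t; rewrite normrM -[leRHS]mul1r; exact: ler_pM.
Qed.

(** The derivative of the Gaussian is [-2 a t_i] times the Gaussian; integration by parts of that
    derivative then expresses the first moments. *)
Let coordI i xi :
  sinI xi (fun t => t 0 i * gaus t) = (pi * xi 0 i / a) * cosI xi gaus /\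
  cosI xi (fun t => t 0 i * gaus t) = - (pi * xi 0 i / a) * sinI xi gaus.
Proof.
have [C cC] := gaus_ctrl 1.
have mD : measurable_fun setT (fun x => 'D_(ek i) gaus x).
  exact: (@ctrl_derive_meas _ _ 0 i _ (@gaus_smooth 1)).
have bi : exists C, forall t, `|t 0 i * gaus t| <= C * wt 2 t.
  by apply: polyf_gaus_wt; exact: polyf_coord.
have E1 := sinI_derive xi (@gaus_smooth 1) mD cC.
have E2 := cosI_derive xi (@gaus_smooth 1) mD cC.
have F1 : sinI xi (fun t => 'D_(ek i) gaus t) = - (2 * a) * sinI xi (fun t => t 0 i * gaus t).
  rewrite /sinI -RintegralZl//.
    by apply: eq_Rintegral => t _; rewrite derive_gaus; ring.
  by apply: trig_int => //; [exact: meas_sinx|exact: sinx_le1].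
have F2 : cosI xi (fun t => 'D_(ek i) gaus t) = - (2 * a) * cosI xi (fun t => t 0 i * gaus t).
  rewrite /cosI -RintegralZl//.
    by apply: eq_Rintegral => t _; rewrite derive_gaus; ring.
  by apply: trig_int => //; [exact: meas_cosx|exact: cosx_le1].
have an0 : - (2 * a) != 0 by rewrite oppr_eq0 mulf_neq0// gt_eqF.
split; apply: (mulfI an0).
- rewrite -F1 E1; field; exact: lt0r_neq0.
- rewrite -F2 E2; field; exact: lt0r_neq0.
Qed.

Let dotI w xi :
  \int[leb n]_t (sinx xi t * (dotrv t w * gaus t)) = pi / a * dotrv xi w * cosI xi gaus /\
  \int[leb n]_t (cosx xi t * (dotrv t w * gaus t)) = - (pi / a * dotrv xi w) * sinI xi gaus.
Proof.
have bi i : exists C, forall t, `|t 0 i * gaus t| <= C * wt 2 t.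
  by apply: polyf_gaus_wt; exact: polyf_coord.
have S (g : 'rV[R]_n -> R) : measurable_fun setT g -> (forall t, `|g t| <= 1) ->
   \int[leb n]_t (g t * (dotrv t w * gaus t)) =
   \sum_i w 0 i * \int[leb n]_t (g t * (t 0 i * gaus t)).
  move=> mg g1.
  have H (r : seq 'I_n) : (leb n).-integrable setT
       (EFin \o (fun t => \sum_(i <- r) w 0 i * (g t * (t 0 i * gaus t)))) /\
     \int[leb n]_t (\sum_(i <- r) w 0 i * (g t * (t 0 i * gaus t))) =
     \sum_(i <- r) w 0 i * \int[leb n]_t (g t * (t 0 i * gaus t)).
    elim: r => [|i r [I1 I2]].
      split; last first.
        by under eq_Rintegral do rewrite big_nil; rewrite big_nil Rintegral_cst// mul0r.
      rewrite (_ : _ \o _ = cst 0%E); first exact: integrable0.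
      by apply/funext => t /=; rewrite big_nil.
    have Ii : (leb n).-integrable setT (EFin \o (fun t => g t * (t 0 i * gaus t))).
      exact: trig_int.
    have Iw : (leb n).-integrable setT (EFin \o (fun t => w 0 i * (g t * (t 0 i * gaus t)))).
      exact: (integrableZl measurableT (w 0 i) Ii).
    split; last first.
      under eq_Rintegral do rewrite big_cons.
      by rewrite RintegralD// RintegralZl// I2 big_cons.
    rewrite (_ : _ \o _ = (EFin \o (fun t => w 0 i * (g t * (t 0 i * gaus t)))) \+
       (EFin \o (fun t => \sum_(i <- r) w 0 i * (g t * (t 0 i * gaus t))))).
      exact: integrableD.
    by apply/funext => t /=; rewrite big_cons EFinD.
  have [_ <-] := H (index_enum _); apply: eq_Rintegral => t _.
  by rewrite /dotrv mulr_suml mulr_sumr; apply: eq_bigr => i _; ring.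
split.
- rewrite (S _ (meas_sinx xi) (sinx_le1 xi)).
  under eq_bigr do rewrite -/(sinI xi _) (coordI _ xi).1.
  rewrite /dotrv !(mulr_sumr, mulr_suml); apply: eq_bigr => i _; ring.
- rewrite (S _ (meas_cosx xi) (cosx_le1 xi)).
  under eq_bigr do rewrite -/(cosI xi _) (coordI _ xi).2.
  rewrite /dotrv !(mulr_sumr, mulr_suml) -sumrN mulr_suml; apply: eq_bigr => i _; ring.
Qed.

Lemma sqn_dotrv w : dotrv w w = sqn w.
Proof. by apply: eq_bigr => i _; rewrite expr2. Qed.

Section Ode.
Variable w : 'rV[R]_n.

Let dint (g dg : R -> R) (e : R) : (forall y, `|g y| <= 1) -> (forall y, `|dg y| <= 1) ->
  measurable_fun setT g -> measurable_fun setT dg ->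
  (forall y : R, is_derive y 1 g (e * dg y)) -> `|e| <= 2 * pi -> forall s : R,
  is_derive s 1 (fun s => \int[leb n]_t (g (s * dotrv t w) * gaus t))
    (e * \int[leb n]_t (dg (s * dotrv t w) * (dotrv t w * gaus t))).
Proof.
move=> g1 dg1 mg mdg isg e2 s.
have pdot : polyf (fun t : 'rV[R]_n => dotrv t w).
  by apply: polyf_sum => i; apply: polyf_mul; [exact: polyf_coord|exact: polyf_cst].
have mdot (s' : R) : measurable_fun setT (fun t : 'rV[R]_n => s' * dotrv t w).
  apply: measurable_funM; first exact: measurable_cst.
  by apply: measurable_dotrv; [exact: measurable_id|exact: measurable_cst].
have [C HC] := polyf_gaus_wt pdot.
have b0 : exists C, forall t, `|gaus t| <= C * wt 2 t.
  have [C' HC'] := polyf_gaus_wt (polyf_cst 1); exists C' => t.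
  by have := HC' t; rewrite mul1r.
have mdg0 : measurable_fun setT (fun t : 'rV[R]_n => dotrv t w * gaus t).
  apply: measurable_funM; last exact: meas_gaus.
  by apply: measurable_dotrv; [exact: measurable_id|exact: measurable_cst].
pose f s' t := g (s' * dotrv t w) * gaus t.
have isf (s' : R) t : is_derive s' 1 (f ^~ t) (e * dg (s' * dotrv t w) * dotrv t w * gaus t).
  have H1 : is_derive s' 1 (fun s' => s' * dotrv t w) (dotrv t w).
    by apply: is_derive_eq; rewrite /GRing.scale/=; ring.
  have H2 := @is_derive1_comp _ g (fun s' => s' * dotrv t w) s' _ _ (isg _) H1.
  have H3 := is_deriveM H2 (is_derive_cst (gaus t) s' 1).
  by apply: (is_derive_eq H3); rewrite /GRing.scale/=; ring.
have intf (x : R) : `]s - 1, s + 1[%classic x -> (leb n).-integrable setT (EFin \o f x).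
  by move=> _; apply: trig_int => //; [exact: (measurableT_comp mg (mdot x))|exact: meas_gaus].
have sI : `]s - 1, s + 1[%classic s by rewrite /= in_itv/=; apply/andP; split; lra.
have der (x : R) (y : 'rV[R]_n) : `]s - 1, s + 1[%classic x -> setT y -> derivable (f ^~ y) x 1.
  by move=> _ _; have [] := isf x y.
pose G t : R := 2 * pi * (C * wt 2 t).
have C0 : 0 <= C.
  have := le_trans (normr_ge0 _) (HC 0); rewrite pmulr_lge0//; exact: wt_gt0.
have pi0 : 0 <= 2 * pi :> R by rewrite mulr_ge0// pi_ge0.
have G0 t : 0 <= G t by rewrite /G !mulr_ge0// ?pi_ge0// wt_ge0.
have Gi : (leb n).-integrable setT (EFin \o G).
  apply: (@le_integrable_wt _ _ _ (2 * pi * C)).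
    apply: measurable_funM; first exact: measurable_cst.
    by apply: measurable_funM; [exact: measurable_cst|exact: measurable_wt].
  by move=> t; rewrite ger0_norm// /G !mulrA.
have Gub (x : R) (y : 'rV[R]_n) : `]s - 1, s + 1[%classic x -> setT y -> `|partial1of2 f x y| <= G y.
  move=> _ _; rewrite partial1of2E; have [_ ->] := isf x y.
  have -> : e * dg (x * dotrv y w) * dotrv y w * gaus y =
    e * (dg (x * dotrv y w) * (dotrv y w * gaus y)) by ring.
  rewrite normrM /G; apply: ler_pM => //; rewrite normrM -[leRHS]mul1r.
  by apply: ler_pM.
have D := @derivable_under_integral R _ _ (leb n) f setT measurableT s (s - 1) (s + 1) sI intf der G G0 Gi Gub.
have E := @differentiation_under_integral R _ _ (leb n) f setT measurableT s (s - 1) (s + 1) sI intf der G G0 Gi Gub.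
split; first exact: D.
rewrite -derive1E E -RintegralZl//; last first.
  by apply: trig_int => //; [exact: (measurableT_comp mdg (mdot s))|exists C].
apply: eq_Rintegral => t _; rewrite partial1of2E; have [_ ->] := isf s t; ring.
Qed.

Let b := pi ^+ 2 * sqn w / a.

Let cosI_scale (s : R) : cosI (s *: w) gaus = \int[leb n]_t (cos (2 * pi * (s * dotrv t w)) * gaus t).
Proof. by apply: eq_Rintegral => t _; rewrite /cosx dotrvZr. Qed.

Let sinI_scale (s : R) : sinI (s *: w) gaus = \int[leb n]_t (sin (2 * pi * (s * dotrv t w)) * gaus t).
Proof. by apply: eq_Rintegral => t _; rewrite /sinx dotrvZr. Qed.

Let is_cos (y : R) : is_derive y 1 (fun y => cos (2 * pi * y)) (- (2 * pi) * sin (2 * pi * y)).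
Proof.
have H := @is_derive1_comp R cos ( *%R (2 * pi)) y _ _ (is_derive_cos _) _.
apply: (is_derive_eq (H (2 * pi) _)); last by rewrite mulrC mulrN mulNr.
by apply: is_derive_eq; rewrite /GRing.scale/= mulr1.
Qed.

Let is_sin (y : R) : is_derive y 1 (fun y => sin (2 * pi * y)) (2 * pi * cos (2 * pi * y)).
Proof.
have H := @is_derive1_comp R sin ( *%R (2 * pi)) y _ _ (is_derive_sin _) _.
apply: (is_derive_eq (H (2 * pi) _)); last by rewrite mulrC.
by apply: is_derive_eq; rewrite /GRing.scale/= mulr1.
Qed.

Let mcos : measurable_fun [set: R] (fun y : R => cos (2 * pi * y)).
Proof.
apply: continuous_measurable_fun => y; apply: differentiable_continuous.
by apply/derivable1_diffP; have [] := is_cos y.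
Qed.

Let msin : measurable_fun [set: R] (fun y : R => sin (2 * pi * y)).
Proof.
apply: continuous_measurable_fun => y; apply: differentiable_continuous.
by apply/derivable1_diffP; have [] := is_sin y.
Qed.

Let cos1 (y : R) : `|cos (2 * pi * y)| <= 1.
Proof. by rewrite ler_norml cos_geN1 cos_le1. Qed.

Let sin1 (y : R) : `|sin (2 * pi * y)| <= 1.
Proof. by rewrite ler_norml sin_geN1 sin_le1. Qed.

Let n2pi : `|2 * pi : R| <= 2 * pi.
Proof. by rewrite ger0_norm// mulr_ge0// pi_ge0. Qed.

Let is_cosI (s : R) : is_derive s 1 (fun s : R => cosI (s *: w) gaus) (- (2 * b * s) * cosI (s *: w) gaus).
Proof.
have H := dint cos1 sin1 mcos msin is_cos _ s.
have -> : (fun s : R => cosI (s *: w) gaus) = (fun s => \int[leb n]_t (cos (2 * pi * (s * dotrv t w)) * gaus t)).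
  by apply/funext => s'; exact: cosI_scale.
apply: (is_derive_eq (H _)); first by rewrite normrN.
have [E _] := dotI w (s *: w).
have -> : \int[leb n]_t (sin (2 * pi * (s * dotrv t w)) * (dotrv t w * gaus t)) =
    \int[leb n]_t (sinx (s *: w) t * (dotrv t w * gaus t)).
  by apply: eq_Rintegral => t _; rewrite /sinx dotrvZr.
by rewrite E dotrvZl sqn_dotrv /b; ring.
Qed.

Let is_sinI (s : R) : is_derive s 1 (fun s : R => sinI (s *: w) gaus) (- (2 * b * s) * sinI (s *: w) gaus).
Proof.
have H := dint sin1 cos1 msin mcos is_sin _ s.
have -> : (fun s : R => sinI (s *: w) gaus) = (fun s => \int[leb n]_t (sin (2 * pi * (s * dotrv t w)) * gaus t)).
  by apply/funext => s'; exact: sinI_scale.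
apply: (is_derive_eq (H _)); first exact: n2pi.
have [_ E] := dotI w (s *: w).
have -> : \int[leb n]_t (cos (2 * pi * (s * dotrv t w)) * (dotrv t w * gaus t)) =
    \int[leb n]_t (cosx (s *: w) t * (dotrv t w * gaus t)).
  by apply: eq_Rintegral => t _; rewrite /cosx dotrvZr.
by rewrite E dotrvZl sqn_dotrv /b; ring.
Qed.

Let ode (f : R -> R) : (forall s : R, is_derive s 1 f (- (2 * b * s) * f s)) ->
  f 1 = f 0 * expR (- b).
Proof.
move=> isf.
have D (s : R) : is_derive s 1 (fun s => f s * expR (b * (s * s))) 0.
  have H1 : is_derive s 1 (fun s : R => b * (s * s)) (2 * b * s).
    by apply: is_derive_eq; rewrite /GRing.scale/=; ring.
  have H2 := @is_derive1_comp _ expR (fun s : R => b * (s * s)) s _ _ (is_derive_expR _) H1.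
  have H3 := is_deriveM (isf s) H2.
  by apply: (is_derive_eq H3); rewrite /GRing.scale/=; ring.
have := is_derive_0_is_cst 1 0 D.
rewrite !mulr0 expR0 !mulr1 => E.
by rewrite -E -mulrA -expRD subrr expR0 mulr1.
Qed.

(** Along the line [s *: w] differentiation under the integral and the first moments give
    [f' = -2 b s f], so [f(s) exp (b s^2)] is constant; compare [s = 0] and [s = 1]. *)
Lemma cosI_gaus : cosI w gaus = (\int[leb n]_t gaus t) * expR (- (pi ^+ 2 * sqn w / a)).
Proof.
have := ode is_cosI; rewrite scale1r scale0r => ->; congr (_ * _).
by apply: eq_Rintegral => t _; rewrite /cosx dotrv0r mulr0 cos0 mul1r.
Qed.

Lemma sinI_gaus : sinI w gaus = 0.
Proof.
have := ode is_sinI; rewrite scale1r scale0r => ->.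
rewrite (_ : sinI 0 gaus = 0) ?mul0r//.
rewrite /sinI; under eq_Rintegral do rewrite /sinx dotrv0r mulr0 sin0 mul0r.
by rewrite Rintegral_cst// mul0r.
Qed.

End Ode.

(** For [a = pi] this is the normalised Gaussian integral; it is carried along as the symbolic
    factor [mass]. *)
Definition gaus_mass : R := \int[leb n]_t gaus t.

Lemma gaus_le_wt : exists C, forall t, gaus t <= C * wt 2 t.
Proof.
have [C H] := polyf_gaus_wt (polyf_cst 1); exists C => t.
by have := H t; rewrite mul1r ger0_norm// ltW// gaus_gt0.
Qed.

End GaussFourier.

(** * Symbols of elementary Gaussian kernels *)

Section KernelSymbol.
Local Open Scope classical_set_scope.
Local Open Scope complex_scope.
Context {R : realType}.
Let pi0 : 0 < (pi : R) := @pi_gt0 R.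

Definition gau n (t : 'rV[R]_n) : R[i] := (gaus pi t)%:C.

Lemma gauN n (t : 'rV[R]_n) : gau (- t) = gau t.
Proof.
rewrite /gau /gaus; congr (_ (- (_ * _)))%:C.
by apply: eq_bigr => i _; rewrite mxE sqrrN.
Qed.

Lemma nice_gau n : nice (@gau n).
Proof.
have [C H] := @gaus_le_wt R n _ pi0; split.
  by split => /=; [exact: meas_gaus|exact: measurable_cst].
by exists C => t; rewrite cmodr ger0_norm ?H// ltW// gaus_gt0.
Qed.

Lemma cint_gau n (w : 'rV[R]_n) :
  cint (fun t => e2pi (dotrv t w) * gau t) = (@gaus_mass R n pi)%:C * gau w.
Proof.
have E : pi ^+ 2 * sqn w / pi = pi * sqn w :> R.
  have p0 : pi != 0 :> R by rewrite gt_eqF.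
  by rewrite expr2 mulrAC mulfK.
apply: complexP.
- transitivity (cosI w (gaus pi)).
    by apply: eq_Rintegral => t _; rewrite Re_mul /= mulr0 subr0.
  by rewrite cosI_gaus// E Re_mul /= mulr0 subr0.
- transitivity (sinI w (gaus pi)).
    by apply: eq_Rintegral => t _; rewrite Im_mul /= mulr0 add0r.
  by rewrite sinI_gaus// Im_mul /= mulr0 mul0r addr0.
Qed.

Lemma cint_gau_shift n (u w : 'rV[R]_n) :
  cint (fun t => e2pi (dotrv t w) * gau (t - u)) =
  (@gaus_mass R n pi)%:C * (e2pi (dotrv u w) * gau w).
Proof.
have nf : nice (fun t => e2pi (dotrv t w) * gau t).
  exact: (nice_modul w (@nice_gau n)).
have <- := cint_shift u (f := fun t => e2pi (dotrv t w) * gau (t - u)).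
  rewrite mulrCA -cint_gau -cintZ//.
  by congr cint; apply/funext => t; rewrite addrK dotrvDl e2piD mulrAC mulrC.
by have [] := nice_modul w (nice_shift (- u) (@nice_gau n)).
Qed.

Variable d : nat.
Implicit Types (a b t x y : 'rV[R]_d) (z : 'rV[R]_(d + d)).

Definition kernel_term a1 a2 b1 b2 : 'rV[R]_(d + d) -> R[i] :=
  tensor (modul b1 (transl a1 (@gau d))) (modul b2 (transl a2 (@gau d))).

(** Up to a constant factor, and when [a2] and [b2] are orthogonal, this is the partial Fourier
    transform F_2 of [kernel_term a1 a2 b1 b2] composed with N, as obtained by inverting k = (F_2^-1
    tau) o N. The shear N couples the variables [x] and [w] in the phase [exp (-2 pi i x.w)]. *)
Definition symbol_term a1 a2 b1 b2 z : R[i] :=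
  e2pi (dotrv (lsubmx z) b1) * gau (lsubmx z - a1) *
  (e2pi (dotrv (rsubmx z) (a2 - lsubmx z)) * gau (rsubmx z + b2)).

Definition Gam : 'rV[R]_(d + d) -> R[i] := gwave (fun=> 0) (fun z => pi * sqn z).
Definition The : 'rV[R]_(d + d) -> R[i] :=
  gwave (fun z => - dotrv (lsubmx z) (rsubmx z)) (fun z => pi * sqn z).

Lemma polyf_lr i j : polyf (fun z : 'rV[R]_(d + d) => lsubmx z 0 i) /\
  polyf (fun z : 'rV[R]_(d + d) => rsubmx z 0 j).
Proof.
split.
- by under eq_fun do rewrite mxE; exact: polyf_coord.
- by under eq_fun do rewrite mxE; exact: polyf_coord.
Qed.

Let polyQ : polyf (fun z : 'rV[R]_(d + d) => pi * sqn z).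
Proof. by apply: polyf_mul; [exact: polyf_cst|exact: polyf_sqn]. Qed.

Let Qc z : pi * sqn z - 0 <= pi * sqn z. Proof. by rewrite subr0. Qed.

Lemma schwartz_Gam : schwartz Gam.
Proof. by apply: (schwartz_gwave _ polyQ pi0 Qc); exact: polyf_cst. Qed.

Lemma schwartz_The : schwartz The.
Proof.
apply: (schwartz_gwave _ polyQ pi0 Qc); apply: polyf_opp; apply: polyf_sum => i.
by have [? ?] := polyf_lr i i; exact: polyf_mul.
Qed.

Lemma sqn_split z : sqn z = sqn (lsubmx z) + sqn (rsubmx z).
Proof.
rewrite -{1}[z]hsubmxK /sqn big_split_ord/=; congr (_ + _); apply: eq_bigr => i _.
  by rewrite row_mxEl.
by rewrite row_mxEr.
Qed.

Lemma gau_split z : (expR (- (pi * sqn z)))%:C = gau (lsubmx z) * gau (rsubmx z).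
Proof. by rewrite /gau /gaus -rmorphM/= -expRD sqn_split mulrDr opprD. Qed.

Lemma dotrv_row_mx n m (x1 x2 : 'rV[R]_n) (y1 y2 : 'rV[R]_m) :
  dotrv (row_mx x1 y1) (row_mx x2 y2) = dotrv x1 x2 + dotrv y1 y2.
Proof.
rewrite /dotrv big_split_ord/=; congr (_ + _); apply: eq_bigr => i _.
  by rewrite !row_mxEl.
by rewrite !row_mxEr.
Qed.

Lemma kernel_termE a1 a2 b1 b2 :
  kernel_term a1 a2 b1 b2 = modul (row_mx b1 b2) (transl (row_mx a1 a2) Gam).
Proof.
apply/funext => z; rewrite -[z]hsubmxK; set x := lsubmx z; set y := rsubmx z.
rewrite /kernel_term /tensor /modul /transl /Gam /gwave e2pi0 mul1r gau_split.
rewrite opp_row_mx add_row_mx !row_mxKl !row_mxKr dotrv_row_mx e2piD.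
by rewrite mulrACA.
Qed.

(** Expanding the chirp around [(a1, -b2)] produces the stated frequencies and one constant phase
    given by [a1.b2], which the hypothesis removes. *)
Lemma symbol_termE a1 a2 b1 b2 : dotrv a1 b2 = 0 ->
  symbol_term a1 a2 b1 b2 = modul (row_mx (b1 + b2) (a2 - a1)) (transl (row_mx a1 (- b2)) The).
Proof.
move=> ab; apply/funext => z; rewrite -[z]hsubmxK; set x := lsubmx z; set y := rsubmx z.
rewrite /symbol_term /modul /transl /The /gwave gau_split.
rewrite opp_row_mx add_row_mx !row_mxKl !row_mxKr dotrv_row_mx opprK.
rewrite mulrACA mulrA -e2piD; rewrite [RHS]mulrA -e2piD mulrA; congr (e2pi _ * _ * _).
rewrite !(dotrvDl, dotrvDr, dotrvNl, dotrvNr) ab.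
rewrite [dotrv y x]dotrvC [dotrv y a1]dotrvC; ring.
Qed.

Lemma F2inv_Nmap (F : 'rV[R]_(d + d) -> R[i]) z :
  F2inv (fun z => F (Nmap z)) z = cint (fun y =>
    F (row_mx (lsubmx z) (lsubmx z - y)) * e2pi (dotrv y (rsubmx z))).
Proof.
rewrite /F2inv; congr cint; apply/funext => y.
by rewrite /Nmap row_mxKl row_mxKr.
Qed.

Lemma measurable_lsub n m : measurable_fun setT (fun z : 'rV[R]_(n + m) => lsubmx z).
Proof.
apply: measurable_rowP => i; under eq_fun do rewrite mxE.
exact: measurable_coord.
Qed.

Lemma measurable_rsub n m : measurable_fun setT (fun z : 'rV[R]_(n + m) => rsubmx z).
Proof.
apply: measurable_rowP => i; under eq_fun do rewrite mxE.
exact: measurable_coord.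
Qed.

Lemma measurable_rowD e (T : measurableType e) n (f g : T -> 'rV[R]_n) :
  measurable_fun setT f -> measurable_fun setT g ->
  measurable_fun setT (fun u => f u + g u).
Proof.
move=> mf mg; apply: measurable_rowP => i; under eq_fun do rewrite mxE.
by apply: measurable_funD; [exact: (measurableT_comp (measurable_coord i) mf)
                           |exact: (measurableT_comp (measurable_coord i) mg)].
Qed.

Lemma measurable_rowN e (T : measurableType e) n (f : T -> 'rV[R]_n) :
  measurable_fun setT f -> measurable_fun setT (fun u => - f u).
Proof. by move=> mf; exact: (measurableT_comp (@measurable_row_opp R n) mf). Qed.

Lemma measurable_row_mx2 e (T : measurableType e) n m (f : T -> 'rV[R]_n) (g : T -> 'rV[R]_m) :
  measurable_fun setT f -> measurable_fun setT g ->
  measurable_fun setT (fun u => row_mx (f u) (g u)).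
Proof.
move=> mf mg; apply: measurable_rowP => i; case: (split_ordP i) => j ->.
- under eq_fun do rewrite row_mxEl.
  exact: (measurableT_comp (measurable_coord j) mf).
- under eq_fun do rewrite row_mxEr.
  exact: (measurableT_comp (measurable_coord j) mg).
Qed.

Lemma cmeas_gau n : cmeas (@gau n). Proof. by have [] := nice_gau n. Qed.

Lemma symbol_term_cmeas a1 a2 b1 b2 : cmeas (symbol_term a1 a2 b1 b2).
Proof.
have ml := @measurable_lsub d d; have mr := @measurable_rsub d d.
have mc n (u : 'rV[R]_n) : measurable_fun setT (fun _ : 'rV[R]_(d + d) => u).
  exact: measurable_cst.
apply: cmeasM; apply: cmeasM.
- by apply: cmeas_e2pi; exact: measurable_dotrv.
- by apply: (cmeas_comp (@cmeas_gau d)); exact: measurable_rowD.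
- apply: cmeas_e2pi; apply: measurable_dotrv => //; apply: measurable_rowD => //.
  exact: measurable_rowN.
- by apply: (cmeas_comp (@cmeas_gau d)); exact: measurable_rowD.
Qed.

Lemma symbol_term_bound a1 a2 b1 b2 :
  exists2 C, 0 <= C & forall z, cmod (symbol_term a1 a2 b1 b2 z) <= C * wt 2 z.
Proof.
have [C1 C10 H1] := nice_bound (nice_shift (- a1) (@nice_gau d)).
have [C2 C20 H2] := nice_bound (nice_shift b2 (@nice_gau d)).
exists (C1 * C2) => [|z]; first exact: mulr_ge0.
rewrite /symbol_term !cmodM !cmod_e2pi !mul1r -{3}[z]hsubmxK wt_row_mx mulrACA.
by apply: ler_pM; rewrite ?cmod_ge0.
Qed.

Section Term.
Variables (F : 'rV[R]_(d + d) -> R[i]) (a1 a2 b1 b2 : 'rV[R]_d).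
Hypotheses (nF : nice F) (ab : dotrv a2 b2 = 0).
Let S := symbol_term a1 a2 b1 b2.
Let K := kernel_term a1 a2 b1 b2.
Let mass : R[i] := (@gaus_mass R d pi)%:C.

Let FN (x y : 'rV[R]_d) := F (row_mx x (x - y)).

(** Peetre's inequality turns decay in [x] and [x - y] into decay in [y] uniformly in [x]. Decay in
    [x] is left to the factor [S]. *)
Let FN_bound : exists2 D, 0 <= D & forall x y, cmod (FN x y) <= D * wt 2 y.
Proof.
have [D D0 HD] := nice_bound nF; exists D => // x y.
apply: (le_trans (HD _)); rewrite ler_wpM2l// wt_row_mx.
have := @wt_peetre R d 2 x (- (x - y)) (ler0n R 2).
by rewrite wtN; have -> : x - (x - y) = y by rewrite opprB addrC subrK.
Qed.

Let H (v : 'rV[R]_((d + d) + d)) : R[i] :=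
  S (lsubmx v) * (FN (lsubmx (lsubmx v)) (rsubmx v) *
                  e2pi (dotrv (rsubmx v) (rsubmx (lsubmx v)))).

Let nH : nice H.
Proof.
have mF : cmeas F by case: nF.
have m1 := @measurable_lsub (d + d) d; have m2 := @measurable_rsub (d + d) d.
have m3 : measurable_fun setT (fun v : 'rV[R]_((d + d) + d) => lsubmx (lsubmx v)).
  exact: (measurableT_comp (@measurable_lsub d d) m1).
have m4 : measurable_fun setT (fun v : 'rV[R]_((d + d) + d) => rsubmx (lsubmx v)).
  exact: (measurableT_comp (@measurable_rsub d d) m1).
split.
  apply: cmeasM; first exact: (cmeas_comp (symbol_term_cmeas _ _ _ _) m1).
  apply: cmeasM; last by apply: cmeas_e2pi; exact: measurable_dotrv.
  apply: (cmeas_comp mF); apply: measurable_row_mx2 => //.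
  by apply: measurable_rowD => //; exact: measurable_rowN.
have [C C0 HC] := symbol_term_bound a1 a2 b1 b2; have [D D0 HD] := FN_bound.
exists (C * D) => v; rewrite /H (cmodM (S _)) (cmodM (FN _ _)) cmod_e2pi mulr1 -{4}[v]hsubmxK wt_row_mx mulrACA.
by apply: ler_pM; rewrite ?cmod_ge0.
Qed.

Let nice_FN x w : nice (fun y => FN x y * e2pi (dotrv y w)).
Proof.
have mF : cmeas F by case: nF.
have mc n (u : 'rV[R]_n) : measurable_fun setT (fun _ : 'rV[R]_d => u).
  exact: measurable_cst.
have mi : measurable_fun setT (fun y : 'rV[R]_d => y) by exact: measurable_id.
split.
  apply: cmeasM; last by apply: cmeas_e2pi; exact: measurable_dotrv.
  apply: (cmeas_comp mF); apply: measurable_row_mx2 => //.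
  by apply: measurable_rowD => //; exact: measurable_rowN.
have [D D0 HD] := FN_bound; exists D => y.
by rewrite cmodM cmod_e2pi mulr1.
Qed.

Let symbolE z : S z * F2inv (fun z => F (Nmap z)) z = cint (fun y => H (row_mx z y)).
Proof.
rewrite F2inv_Nmap -cintZ; last exact: nice_FN.
by congr cint; apply/funext => y; rewrite /H !row_mxKl !row_mxKr.
Qed.

(** In [w] the integrand is a modulated, shifted Gaussian, whose integral is explicit; [ab] removes
    the constant phase given by [a2.b2]. *)
Let innerE x y : cint (fun w => H (row_mx (row_mx x w) y)) =
  mass * (K (row_mx x (x - y)) * FN x y).
Proof.
pose c0 := FN x y * (e2pi (dotrv x b1) * gau (x - a1)).
have E : (fun w => H (row_mx (row_mx x w) y)) =
    (fun w => c0 * (e2pi (dotrv w (a2 - x + y)) * gau (w - - b2))).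
  apply/funext => w; rewrite /H /S /symbol_term !row_mxKl !row_mxKr opprK.
  rewrite [dotrv w (_ + y)]dotrvDr e2piD [dotrv y w]dotrvC /c0; ring.
rewrite E cintZ; last first.
  by apply: (nice_modul (a2 - x + y)); apply: nice_shift; exact: nice_gau.
rewrite cint_gau_shift /c0 /K /kernel_term /tensor /modul /transl !row_mxKl !row_mxKr.
have -> : gau (a2 - x + y) = gau (x - y - a2).
  by rewrite -gauN; congr gau; apply/rowP => i; rewrite !mxE; ring.
have -> : dotrv (- b2) (a2 - x + y) = dotrv (x - y) b2.
  by rewrite !(dotrvDl, dotrvDr, dotrvNl, dotrvNr) dotrvC ab ![dotrv b2 _]dotrvC; ring.
rewrite -/mass; ring.
Qed.

Let nK : nice K.
Proof.
rewrite /K kernel_termE; apply: nice_modul; apply: nice_transl; apply: schwartz_nice.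
exact: schwartz_Gam.
Qed.

(** Fubini brings the [w]-integral inside, where it is the Gaussian integral [innerE]. A reflection
    followed by a translation, that is [y -> x - y], then undoes [Nmap]. *)
Lemma kn_term : cint (fun z => S z * F2inv (fun z => F (Nmap z)) z) =
  mass * cint (fun z => K z * F z).
Proof.
have nKF : nice (fun z => K z * F z) by exact: nice_mul.
have -> : (fun z => S z * F2inv (fun z => F (Nmap z)) z) =
    (fun z => cint (fun y => H (row_mx z y))).
  by apply/funext => z; exact: symbolE.
rewrite cint_split; last exact: nice_cint.
rewrite -cintZ// [RHS]cint_split; last exact: niceZ.
congr cint; apply/funext => x.
pose Hx (v : 'rV[R]_(d + d)) := H (row_mx (row_mx x (lsubmx v)) (rsubmx v)).
have nHx : nice Hx.
  have [mH [C HC]] := nH; split.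
    apply: (cmeas_comp mH); apply: measurable_row_mx2; last exact: measurable_rsub.
    by apply: measurable_row_mx2; [exact: measurable_cst|exact: measurable_lsub].
  exists (C * wt 2 x) => v; apply: (le_trans (HC _)).
  by rewrite -{3}[v]hsubmxK !wt_row_mx !mulrA.
have E1 : (fun w => cint (fun y => H (row_mx (row_mx x w) y))) =
          (fun w => cint (fun y => Hx (row_mx w y))).
  by apply/funext => w; congr cint; apply/funext => y; rewrite /Hx row_mxKl row_mxKr.
rewrite E1 (cint_swap nHx).
pose G v := mass * (K (row_mx x v) * F (row_mx x v)).
have mG : cmeas G by have [] := niceZ mass (nice_secr x nKF).
pose Gx u := G (u + x).
have E2 : (fun y => cint (fun w => Hx (row_mx w y))) = (fun y => Gx (- y)).
  apply/funext => y; rewrite /Gx /G addrC -/(FN x y) -innerE; congr cint.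
  by apply/funext => w; rewrite /Hx row_mxKl row_mxKr.
rewrite E2 (cint_opp (f := Gx)); first exact: (cint_shift x mG).
by apply: cmeas_comp mG _; exact: measurable_shift.
Qed.

End Term.

End KernelSymbol.

(** * Series of time-frequency shifts *)

Section ComplexSeries.
Local Open Scope classical_set_scope.
Local Open Scope complex_scope.
Context {R : realType}.
Implicit Types (u v : nat -> R[i]).

(** Total by way of [limn]; the value is meaningful under a bound [asum], which gives absolute
    convergence. *)
Definition csum u : R[i] :=
  limn (series (fun n => complex.Re (u n))) +i* limn (series (fun n => complex.Im (u n))).

Definition asum u (S : R) := forall N, \sum_(0 <= n < N) cmod (u n) <= S.

Lemma asum_cvg_dom (w : nat -> R) u S : asum u S -> (forall n, `|w n| <= cmod (u n)) ->
  cvgn (series w).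
Proof.
move=> uS wu; apply: normed_cvg.
have h0 n : 0 <= `|w n| by [].
apply: (@series_le_cvg _ _ (fun n => cmod (u n))) => //.
- by move=> n; exact: cmod_ge0.
- apply: nondecreasing_is_cvgn.
    by apply: nondecreasing_series => n _ _; exact: cmod_ge0.
  by exists S => _ [n _ <-]; exact: uS.
Qed.

Lemma asum_cvg u S : asum u S ->
  cvgn (series (fun n => complex.Re (u n))) /\ cvgn (series (fun n => complex.Im (u n))).
Proof.
move=> uS; split; apply: (asum_cvg_dom uS) => n; [exact: cmod_Re|exact: cmod_Im].
Qed.

Lemma cmod_csum_le u S : asum u S -> cmod (csum u) <= 2 * S.
Proof.
move=> uS; have [c1 c2] := asum_cvg uS.
have bnd (w : nat -> R) : (forall n, `|w n| <= cmod (u n)) -> cvgn (series w) ->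
    `|limn (series w)| <= S.
  move=> wu cw.
  rewrite ler_norml; apply/andP; split.
  - apply: limr_ge => //; apply: nearW => N.
    rewrite lerNl; apply: le_trans (uS N); rewrite /series/= -sumrN.
    by apply: ler_sum => n _; apply: le_trans (wu n); rewrite -normrN ler_norm.
  - apply: limr_le => //; apply: nearW => N.
    apply: le_trans (uS N); rewrite /series/=.
    by apply: ler_sum => n _; apply: le_trans (wu n); rewrite ler_norm.
apply: (le_trans (cmod_le _)); rewrite mulrDl mul1r lerD//=.
- by apply: bnd => // n; exact: cmod_Re.
- by apply: bnd => // n; exact: cmod_Im.
Qed.

Lemma csum_lin (z : R[i]) u v S T : asum u S -> asum v T ->
  csum (fun n => z * u n + v n) = z * csum u + csum v.
Proof.
move=> uS vT; have [u1 u2] := asum_cvg uS; have [v1 v2] := asum_cvg vT.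
have lin3 (a b : R) (p q r : nat -> R) : cvgn (series p) -> cvgn (series q) ->
    cvgn (series r) ->
    limn (series (fun n => a * p n + b * q n + r n)) =
    a * limn (series p) + b * limn (series q) + limn (series r).
  move=> cp cq cr; apply/cvg_lim => //.
  have -> : series (fun n => a * p n + b * q n + r n) =
      (fun n => a * series p n + b * series q n + series r n).
    by apply/funext => n; rewrite /series/= !big_split/= -!mulr_sumr.
  apply: cvgD => //; apply: cvgD; apply: cvgM => //; exact: cvg_cst.
apply: complexP.
- rewrite Re_add Re_mul /csum/= -mulNr -lin3//.
  congr (limn (series _)); apply/funext => n.
  by rewrite Re_add Re_mul mulNr.
- rewrite Im_add Im_mul /csum/= -lin3//.
  congr (limn (series _)); apply/funext => n.
  by rewrite Im_add Im_mul.
Qed.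

(** Nonnegative real parts make every partial sum a lower bound. This is what allows all but the
    wanted terms of the series to be dropped. *)
Lemma csum_Re_ge u S N : asum u S -> (forall n, 0 <= complex.Re (u n)) ->
  \sum_(0 <= n < N) complex.Re (u n) <= complex.Re (csum u).
Proof.
move=> uS u0; have [c1 _] := asum_cvg uS.
rewrite /csum/=; apply: (@nondecreasing_cvgn_le _ (series (fun n => complex.Re (u n)))) => //.
by apply: nondecreasing_series => n _ _; exact: u0.
Qed.

(* x / (1 + |x|) is a bounded antiderivative of (1 + |x|) ^- 2. *)
Lemma sum_pw2 (y : R) N : \sum_(0 <= n < N) pw 2 (n%:R - y) <= 4.
Proof.
pose T (x : R) := x / (1 + `|x|).
have T1 x : `|T x| <= 1.
  rewrite normrM normfV [`|1 + _|]gtr0_norm ?ltr_pwDl//.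
  by rewrite ler_pdivrMr ?ltr_pwDl// mul1r lerDr.
have step x : pw 2 x <= 2 * (T (x + 1) - T x).
  rewrite (pw_nat 2) /T.
  have [x0|x0] := leP 0 x.
    rewrite !ger0_norm ?addr_ge0//.
    have -> : (x + 1) / (1 + (x + 1)) - x / (1 + x) = ((1 + x) * (2 + x))^-1.
      by field; repeat (apply/andP; split); apply: lt0r_neq0; lra.
    rewrite expr2 -[2 * _]invrK lef_pV2 ?posrE ?mulr_gt0//.
    - rewrite invfM invrK; nra.
    - lra.
    - lra.
    - by rewrite invr_gt0 mulr_gt0// invr_gt0 mulr_gt0//; lra.
  have [x1|x1] := leP x (-1).
    rewrite !ler0_norm; [|lra|lra].
    have -> : (x + 1) / (1 - (x + 1)) - x / (1 - x) = (- x * (1 - x))^-1.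
      by field; apply/and3P; split; [apply: lt0r_neq0; lra|apply: ltr0_neq0; lra|apply: lt0r_neq0; lra].
    rewrite expr2 -[2 * _]invrK lef_pV2 ?posrE ?mulr_gt0//.
    - rewrite invfM invrK; nra.
    - lra.
    - lra.
    - by rewrite invr_gt0 mulr_gt0// invr_gt0 mulr_gt0//; lra.
  rewrite (ger0_norm (_ : 0 <= x + 1)); last lra.
  rewrite (ltr0_norm x0).
  have h1 : 2^-1 <= (x + 1) / (1 + (x + 1)) - x / (1 - x).
    rewrite -subr_ge0.
    have -> : (x + 1) / (1 + (x + 1)) - x / (1 - x) - 2^-1 =
      (3 * - x * (1 + x)) / (2 * ((2 + x) * (1 - x))) by field; repeat (apply/andP; split); apply: lt0r_neq0; lra.
    apply: divr_ge0; nra.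
  have h2 : (1 - x) ^- 2 <= 1.
    have e1 : 1 <= (1 - x) ^+ 2 by apply: exprn_ege1; lra.
    by rewrite invf_le1//; exact: lt_le_trans e1.
  lra.
(* The steps telescope; since [T] takes values between -1 and 1 the total is at most 4. *)
have tele : \sum_(0 <= n < N) pw 2 (n%:R - y) <= 2 * (T (N%:R - y) - T (0 - y)).
  elim: N => [|N IH]; first by rewrite big_geq// subrr mulr0.
  rewrite big_nat_recr//=; apply: (le_trans (lerD IH (step _))).
  have -> : N%:R - y + 1 = N.+1%:R - y by rewrite -[N.+1%:R]natr1; ring.
  lra.
apply: (le_trans tele).
have := T1 (N%:R - y); have := T1 (0 - y).
by rewrite !ler_norml => /andP[? ?] /andP[? ?]; lra.
Qed.

End ComplexSeries.

(** * Tempered distributions given by series of time-frequency shifts *)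

Section Wave.
Local Open Scope classical_set_scope.
Local Open Scope complex_scope.
Context {R : realType} {m : nat}.
Implicit Types (F G : 'rV[R]_m -> R[i]) (x y t : 'rV[R]_m).

Lemma schwartz_lin (a : R[i]) f g : schwartz f -> schwartz g ->
  @schwartz R m (fun x => a * f x + g x).
Proof.
move=> [sf bf] [sg bg].
pose ar := complex.Re a; pose ai := complex.Im a.
have ER : (fun x => complex.Re (a * f x + g x)) =
    (fun x => (ar * complex.Re (f x) + (- ai) * complex.Im (f x)) + complex.Re (g x)).
  by apply/funext => x; rewrite Re_add Re_mul mulNr.
have EI : (fun x => complex.Im (a * f x + g x)) =
    (fun x => (ar * complex.Im (f x) + ai * complex.Re (f x)) + complex.Im (g x)).
  by apply/funext => x; rewrite Im_add Im_mul.
have [f1 f2] : (forall L, smoothn L (fun x => complex.Re (f x))) /\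
   (forall L, smoothn L (fun x => complex.Im (f x))).
  by split => L; [exact: smooth_Re|exact: smooth_Im].
have [g1 g2] : (forall L, smoothn L (fun x => complex.Re (g x))) /\
   (forall L, smoothn L (fun x => complex.Im (g x))).
  by split => L; [exact: smooth_Re|exact: smooth_Im].
have P l x : cpartials l (fun x => a * f x + g x) x = a * cpartials l f x + cpartials l g x.
  rewrite /cpartials ER EI; apply: complexP; rewrite ?(Re_add, Im_add, Re_mul, Im_mul)/=.
  - rewrite !(partialsD, partialsZ)//; try exact: smoothnZ.
      by rewrite mulNr.
    by apply: smoothnD; exact: smoothnZ.
  - rewrite !(partialsD, partialsZ)//; try exact: smoothnZ.
    by apply: smoothnD; exact: smoothnZ.
split.
  move=> l x; rewrite ER EI; split.
  - apply: (smoothnD (L := size l)) => //.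
    by apply: smoothnD; exact: smoothnZ.
  - apply: (smoothnD (L := size l)) => //.
    by apply: smoothnD; exact: smoothnZ.
move=> N; apply: (@le_lt_trans _ _ (cmod a * sem N f + sem N g)%:E); last exact: ltry.
apply: ge_ereal_sup => _ [l [t [sl ->]]]; rewrite lee_fin P.
have e0 : 0 < (1 + enorm t) ^+ N by rewrite exprn_gt0// ltr_pwDl// sqrtr_ge0.
have Bf := schwartz_bound t (conj sf bf) sl; have Bg := schwartz_bound t (conj sg bg) sl.
rewrite ler_pdivlMr// mulrC in Bf; rewrite ler_pdivlMr// mulrC in Bg.
apply: (@le_trans _ _ ((1 + enorm t) ^+ N * (cmod a * cmod (cpartials l f t) + cmod (cpartials l g t)))).
  rewrite ler_wpM2l ?(ltW e0)//; apply: (le_trans (cmodD _ _)).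
  by rewrite cmodM.
rewrite mulrDr lerD// mulrCA ler_wpM2l ?cmod_ge0//.
Qed.

Lemma schwartz_conj f : schwartz f -> @schwartz R m (fun x => (f x)^*).
Proof.
move=> [sf bf].
have ER : (fun x => complex.Re ((f x)^*)) = (fun x => complex.Re (f x)).
  by apply/funext => x; rewrite Re_conjc.
have EI : (fun x => complex.Im ((f x)^*)) = (fun x => -1 * complex.Im (f x)).
  by apply/funext => x; rewrite Im_conjc mulN1r.
have sI : forall L, smoothn L (fun x => complex.Im (f x)) by move=> L; exact: smooth_Im.
have P l x : cpartials l (fun x => (f x)^*) x = (cpartials l f x)^*.
  rewrite /cpartials ER EI; apply: complexP; rewrite ?(Re_conjc, Im_conjc)//=.
  by rewrite partialsZ// mulN1r.
split.
  move=> l x; rewrite ER EI; split; first by have [] := sf l x.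
  by apply: (smoothnZ (L := size l)).
move=> N; apply: le_lt_trans (bf N); apply: le_ereal_sup => _ [l [t [sl ->]]].
by exists l, t; rewrite P cmodJ.
Qed.

Lemma conjcM (z w : R[i]) : conjc (z * w) = conjc z * conjc w.
Proof. by case: z => a b; case: w => a' b'; apply: complexP => /=; ring. Qed.

Definition wave (G : 'rV[R]_m -> R[i]) (x y : 'rV[R]_m) n : 'rV[R]_m -> R[i] :=
  modul (n%:R *: y) (transl (n%:R *: x) G).

Definition wavef (c : nat -> R[i]) G x y F : R[i] :=
  csum (fun n => c n * cint (fun t => wave G x y n t * F t)).

Variables (G : 'rV[R]_m -> R[i]) (c : nat -> R[i]) (A : R) (x y : 'rV[R]_m).
Hypotheses (sG : schwartz G) (cA : forall n, cmod (c n) <= A).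
Hypothesis (xy1 : (exists i, `|x 0 i| = 1) \/ (exists i, `|y 0 i| = 1)).

Let A0 : 0 <= A. Proof. exact: le_trans (cmod_ge0 _) (cA 0). Qed.

(** A single coordinate moving at unit speed suffices: its weight alone makes the series summable,
    so bounded coefficients [c] define a distribution. *)
Let wt_decay n : wt 4 (n%:R *: x) * wt 4 (n%:R *: y) <= pw 2 (n%:R : R).
Proof.
have H (u : 'rV[R]_m) i : `|u 0 i| = 1 -> wt 4 (n%:R *: u) <= pw 2 (n%:R : R).
  move=> ui; rewrite /wt (bigD1 i)//=.
  apply: (@le_trans _ _ (pw 4 (n%:R : R))); last by apply: pw_anti; rewrite ler_nat.
  have -> : pw 4 ((n%:R *: u) 0 i) = pw 4 (n%:R : R).
    by rewrite /pw mxE normrM ui mulr1.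
  rewrite ler_piMr ?pw_ge0//; apply: prodr_ile1 => k _.
  by rewrite pw_ge0 pw_le1.
case: xy1 => -[i ui].
- by apply: le_trans (H _ _ ui); apply: ler_piMr; [exact: wt_ge0|exact: wt_le1].
- by apply: le_trans (H _ _ ui); apply: ler_piMl; [exact: wt_ge0|exact: wt_le1].
Qed.

Let me_c := 8 * @me_cst R m * sem (m * 6) G.

Let me_c0 : 0 <= me_c.
Proof.
apply: mulr_ge0; last exact: sem_ge0.
apply: mulr_ge0; last exact: me_cst_ge0.
exact: ler0n.
Qed.

Lemma wave_asum F : schwartz F ->
  asum (fun n => c n * cint (fun t => wave G x y n t * F t)) (4 * (A * me_c * sem (m * 6) F)).
Proof.
move=> sF N; apply: (@le_trans _ _ (\sum_(0 <= n < N) (A * me_c * sem (m * 6) F) * pw 2 (n%:R - 0))).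
  apply: ler_sum => n _; rewrite cmodM subr0.
  apply: (le_trans (ler_pM (cmod_ge0 _) (cmod_ge0 _) (cA n)
    (modul_transl_decay (n%:R *: x) (n%:R *: y) sG sF))).
  apply: (@le_trans _ _ (A * me_c * sem (m * 6) F *
      (wt 4 (n%:R *: x) * wt 4 (n%:R *: y)))); first by rewrite /me_c !mulrA.
  apply: ler_wpM2l; last exact: wt_decay.
  by apply: mulr_ge0; [exact: mulr_ge0|exact: sem_ge0].
rewrite -mulr_sumr mulrC; apply: ler_wpM2r; last exact: sum_pw2.
by apply: mulr_ge0; [exact: mulr_ge0|exact: sem_ge0].
Qed.

Lemma nice_wave n : nice (wave G x y n).
Proof. by apply: nice_modul; apply: nice_transl; exact: schwartz_nice. Qed.

Lemma wavef_tempered : tempered (wavef c G x y).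
Proof.
split.
  move=> a f g sf sg; rewrite /wavef -(csum_lin a (wave_asum sf) (wave_asum sg)).
  congr csum; apply/funext => n.
  have nf : nice (fun t => wave G x y n t * f t).
    by apply: nice_mul; [exact: nice_wave|exact: schwartz_nice].
  have ng : nice (fun t => wave G x y n t * g t).
    by apply: nice_mul; [exact: nice_wave|exact: schwartz_nice].
  rewrite mulrCA -mulrDr -(cintZ a nf) -cintD//; last exact: niceZ.
  by congr (_ * cint _); apply/funext => t; ring.
exists (2 * (4 * (A * me_c))), (m * 6)%N => f sf.
rewrite semE// -EFinM lee_fin.
by have := cmod_csum_le (wave_asum sf); rewrite !mulrA.
Qed.

Section Gabor.
Variable phi : 'rV[R]_m -> R[i].
Hypothesis sphi : schwartz phi.

(** Covariance: shifting the function in phase space shifts its Gabor transform, up to a phase. The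
    integral is thereby a short-time Fourier transform of the conjugate window at the difference of
    the two points. *)
Lemma gabor_term n (z : 'rV[R]_(m + m)) :
  cmod (cint (fun t => wave G x y n t *
    conjc (modul (rsubmx z) (transl (lsubmx z) phi) t))) <=
  me_c * sem (m * 6) (fun t => conjc (phi t)) * wt 4 (n%:R *: row_mx x y - z).
Proof.
set u := lsubmx z; set xi := rsubmx z.
have nphi : nice (modul xi (transl u phi)).
  by apply: nice_modul; apply: nice_transl; exact: schwartz_nice.
have np : nice (fun t => wave G x y n t * conjc (modul xi (transl u phi) t)).
  by apply: nice_mul; [exact: nice_wave|exact: niceJ].
have scphi := schwartz_conj sphi.
have nq : nice (fun t => modul (n%:R *: y - xi) (transl (n%:R *: x - u) G) t * conjc (phi t)).
  apply: nice_mul; last exact: schwartz_nice.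
  by apply: nice_modul; apply: nice_transl; exact: schwartz_nice.
have -> : cint (fun t => wave G x y n t * conjc (modul xi (transl u phi) t)) =
  e2pi (dotrv u (n%:R *: y - xi)) *
  cint (fun t => modul (n%:R *: y - xi) (transl (n%:R *: x - u) G) t * conjc (phi t)).
  rewrite -cintZ// -(cint_shift u); last by case: np.
  congr cint; apply/funext => t.
  rewrite /wave /modul /transl. rewrite conjcM e2piJ addrK.
  have -> : t + u - n%:R *: x = t - (n%:R *: x - u) by rewrite opprB addrA addrAC.
  rewrite !(dotrvDl, dotrvDr, dotrvNr, e2piD) !opprD !e2piD; ring.
rewrite cmodM cmod_e2pi mul1r.
apply: (le_trans (modul_transl_decay _ _ sG scphi)).
have -> : n%:R *: row_mx x y - z = row_mx (n%:R *: x - u) (n%:R *: y - xi).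
  by rewrite -{1}[z]hsubmxK scale_row_mx opp_row_mx add_row_mx.
by rewrite wt_row_mx; apply: ler_wpM2r => //; rewrite mulr_ge0// wt_ge0.
Qed.

Lemma gabor_wavef_le (w : nat -> R) (K : R) z : (forall n, cmod (c n) <= w n) ->
  (forall N, \sum_(0 <= n < N) w n * wt 4 (n%:R *: row_mx x y - z) <= K) ->
  cmod (gabor phi (wavef c G x y) z) <=
    2 * (me_c * sem (m * 6) (fun t => conjc (phi t)) * K).
Proof.
move=> cw wK; rewrite /gabor /pairing /wavef.
have mc0 : 0 <= me_c * sem (m * 6) (fun t => conjc (phi t)) by rewrite mulr_ge0// sem_ge0.
apply: cmod_csum_le => N.
apply: (@le_trans _ _ (\sum_(0 <= n < N) (me_c * sem (m * 6) (fun t => conjc (phi t))) *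
    (w n * wt 4 (n%:R *: row_mx x y - z)))).
  apply: ler_sum => n _; rewrite cmodM mulrCA.
  by apply: ler_pM; rewrite ?cmod_ge0//; exact: gabor_term.
by rewrite -mulr_sumr ler_wpM2l.
Qed.

End Gabor.

End Wave.

(** * Mixed norms *)

Section MixedNorm.
Local Open Scope classical_set_scope.
Local Open Scope ereal_scope.
Context {R : realType}.
Local Notation mu := (@lebesgue_measure R).

(* The integral of a nonnegative function is a supremum over the simple
   functions below it. *)
Lemma ge0_le_integral_nomeas d (T : measurableType d) (nu : {measure set T -> \bar R})
  (f g : T -> \bar R) : (forall x, 0 <= f x) -> (forall x, f x <= g x) ->
  \int[nu]_x f x <= \int[nu]_x g x.
Proof.
move=> f0 fg; have g0 x : 0 <= g x by exact: le_trans (fg x).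
rewrite !ge0_integralTE//; apply: le_ereal_sup => _ [h hf <-].
by exists h => // x; exact: le_trans (fg x).
Qed.

(** The condition for [(1 + |x|)^-rho] to lie in L^q of the line. *)
Definition decay_ok (rho : R) (q : \bar R) :=
  (0 <= rho)%R /\ (q = +oo \/ exists2 r : R, q = r%:E & (0 < r /\ 1 < rho * r)%R).

Lemma mu_setT_gt0 : 0 < mu [set: R].
Proof.
apply: (@lt_le_trans _ _ (mu (`[0%R, 1%R] : set R))).
  by rewrite lebesgue_measure_itv/= lte_fin ltr01 oppr0 adde0 lte01.
by apply: le_measure => //; rewrite inE.
Qed.

(** By translation invariance [N] depends on [rho] and [q] only, so [c] and [s] may later be
    functions of the outer variables. The bound covers arbitrary nonnegative [f], because the inner
    functions of a mixed norm come without a measurability proof. *)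
Lemma Lnorm_pw_le rho q : decay_ok rho q -> exists2 N : R, (0 <= N)%R &
  forall (c s : R) (f : R -> \bar R), (0 <= c)%R -> (forall x, 0 <= f x) ->
    (forall x, f x <= (c * pw rho (x - s))%:E) ->
    Lnorm mu q f <= (c * N)%:E.
Proof.
move=> [rho0 [->|[r -> [r0 rr]]]].
  exists 1%R => // c s f c0 f0 fc; rewrite unlock mu_setT_gt0.
  apply/ess_supP/aeW => x /=; rewrite gee0_abs// mulr1.
  apply: (le_trans (fc x)); rewrite lee_fin -[leRHS]mulr1 ler_wpM2l// pw_le1//.
pose I := \int[mu]_x (pw (rho * r) x)%:E.
have Ioo : I < +oo by exact: integral_pw_lty.
have I0 : 0 <= I by apply: integral_ge0 => x _; rewrite lee_fin pw_ge0.
have If : I \is a fin_num by rewrite ge0_fin_numE.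
exists (fine I `^ r^-1)%R; first exact: powR_ge0.
move=> c s f c0 f0 fc; rewrite unlock.
have cr : (c * fine I `^ r^-1)%:E = ((c `^ r)%:E * I) `^ r^-1.
  rewrite -[in RHS](fineK If) -EFinM poweR_EFin powRM ?powR_ge0 ?fine_ge0//.
  by rewrite -powRrM mulfV ?gt_eqF// powRr1.
rewrite cr; apply: gt0_ler_poweR; rewrite ?invr_ge0 ?(ltW r0)//.
- by rewrite in_itv/= leey andbT integral_ge0// => x _; exact: poweR_ge0.
- by rewrite in_itv/= leey andbT; apply: mule_ge0 => //; rewrite lee_fin powR_ge0.
apply: (@le_trans _ _ (\int[mu]_x ((c `^ r * pw (rho * r) (x - s))%R)%:E)).
  apply: ge0_le_integral_nomeas => x; first exact: poweR_ge0.
  rewrite gee0_abs//.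
  have -> : (c `^ r * pw (rho * r) (x - s))%R%:E = ((c * pw rho (x - s))%R%:E) `^ r.
    rewrite poweR_EFin powRM ?pw_ge0//; congr (_ * _)%:E.
    by rewrite /pw -powRrM mulNr.
  apply: gt0_ler_poweR; rewrite ?(ltW r0)// in_itv/= ?leey ?f0 ?andbT//.
  by rewrite lee_fin mulr_ge0// pw_ge0.
have mpw : measurable_fun setT (EFin \o pw (rho * r)).
  by apply/measurable_EFinP; exact: measurable_pw.
under eq_integral do rewrite EFinM.
rewrite ge0_integralZl_EFin//; last 3 first.
- by move=> x _; rewrite lee_fin pw_ge0.
- apply: (measurableT_comp mpw); apply: measurable_funB; [exact: measurable_id|exact: measurable_cst].
- exact: powR_ge0.
rewrite lee_wpmul2l ?lee_fin ?powR_ge0//.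
by rewrite (mu_shift (- s)%R mpw) => // x; rewrite /= lee_fin pw_ge0.
Qed.

(* Integrating from the innermost variable outwards, each factor is a translate
   by a quantity depending on the variables still to come. *)
Lemma mixed_norm_triangular n (q : 'I_n -> \bar R) (rho : 'I_n -> R)
    (M : 'I_n -> 'I_n -> R) : (forall k, decay_ok (rho k) (q k)) ->
  exists2 N : R, (0 <= N)%R & forall (C : R) (F : 'rV[R]_n -> \bar R), (0 <= C)%R ->
    (forall z, 0 <= F z) ->
    (forall z, F z <= (C * \prod_k pw (rho k)
       (z 0 k - \sum_(l < n | (k < l)%N) M k l * z 0 l))%R%:E) ->
    mixed_norm q F <= (C * N)%:E.
Proof.
elim: n q rho M => [|n IH] q rho M ok.
  exists 1%R => // C F C0 F0 FC /=.
  by have := FC 0%R; rewrite big_ord0.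
have [N1 N10 H1] := Lnorm_pw_le (ok ord0).
have [N2 N20 H2] := IH (fun i => q (lift ord0 i)) (fun i => rho (lift ord0 i))
  (fun k l => M (lift ord0 k) (lift ord0 l)) (fun k => ok (lift ord0 k)).
exists (N1 * N2)%R; first exact: mulr_ge0.
move=> C F C0 F0 FC; rewrite mulrA.
rewrite [mixed_norm _ _]/(mixed_norm (fun i => q (lift ord0 i))
  (fun y => Lnorm mu (q ord0) (fun x => F (row_cons (x, y))))).
apply: H2; first exact: mulr_ge0.
  by move=> y; exact: Lnorm_ge0.
move=> y.
pose P : R := (\prod_k pw (rho (lift ord0 k))
  (y 0 k - \sum_(l < n | (k < l)%N) M (lift ord0 k) (lift ord0 l) * y 0 l))%R.
have P0 : (0 <= P)%R by apply: prodr_ge0 => k _; exact: pw_ge0.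
rewrite -/P mulrAC.
apply: (H1 (C * P)%R (\sum_(l < n) M ord0 (lift ord0 l) * y 0 l)%R) => [||x].
- exact: mulr_ge0.
- by move=> x; exact: F0.
apply: (le_trans (FC _)); rewrite lee_fin big_ord_recl row_cons0.
rewrite -mulrA ler_wpM2l// mulrC le_eqVlt; apply/orP; left; apply/eqP.
congr (_ * _)%R.
- rewrite /P; apply: eq_bigr => k _; rewrite row_consS; congr (pw _ (_ - _)).
  rewrite big_mkcond big_ord_recl/= add0r [in RHS]big_mkcond; apply: eq_bigr => l _.
  by rewrite row_consS.
- congr (pw _ (_ - _)); rewrite big_mkcond big_ord_recl/= add0r.
  by apply: eq_bigr => l _; rewrite row_consS.
Qed.

End MixedNorm.

(** * Finiteness of the modulation norm of such a series *)

Section WaveModulation.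
Local Open Scope classical_set_scope.
Local Open Scope complex_scope.
Context {R : realType} {m : nat}.
Variables (G phi : 'rV[R]_m -> R[i]) (x y : 'rV[R]_m).
Hypotheses (sG : schwartz G) (sphi : schwartz phi).
Variables (i j : 'I_(m + m)) (r B : R) (c : nat -> R[i]).
Let v : 'rV[R]_(m + m) := row_mx x y.
Hypotheses (ij : i != j) (vi : `|v 0 i| = 1) (vj : v 0 j = 0 \/ `|v 0 j| = 1).
Hypothesis (v0 : forall k, k != i -> k != j -> v 0 k = 0).
Hypotheses (r0 : 0 <= r) (r1 : r <= 1) (B0 : 0 <= B).
Hypothesis (cB : forall n, cmod (c n) <= B * pw r (n%:R : R)).

Let pw_abs1 (a e u : R) : `|e| = 1 -> pw a (e * u) = pw a u.
Proof. by move=> e1; rewrite /pw normrM e1 mul1r. Qed.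

Let sq1 (e : R) : `|e| = 1 -> e * e = 1.
Proof. by move=> e1; rewrite -expr2 -real_normK ?num_real// e1 expr1n. Qed.

Let bnd (z : 'rV[R]_(m + m)) : R :=
  pw r (z 0 i) * \prod_(k | k != i) pw 2 (z 0 k - v 0 k * v 0 i * z 0 i).

(* Peetre's inequality twice: [n v_i] near [z_i] and [n v_j] near [z_j] force
   [z_j] to be near [v_j v_i z_i], the shear that [bnd] records. *)
Let two_coord (z : 'rV[R]_(m + m)) : exists w : R, forall n : nat,
  pw r (n%:R : R) * (pw 4 (n%:R * v 0 i - z 0 i) * pw 4 (n%:R * v 0 j - z 0 j)) <=
  pw r (z 0 i) * pw 2 (z 0 j - v 0 j * v 0 i * z 0 i) * pw 2 (n%:R - w).
Proof.
have A1 (n : nat) : pw r (n%:R : R) * pw r (n%:R * v 0 i - z 0 i) <= pw r (z 0 i).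
  have := @pw_peetre R r (n%:R * v 0 i) (- (n%:R * v 0 i - z 0 i)) r0.
  have -> : n%:R * v 0 i + - (n%:R * v 0 i - z 0 i) = z 0 i by ring.
  by rewrite pwN {1}[_ * v 0 i]mulrC pw_abs1.
have A4 (a : R) : pw 4 a <= pw r a * pw 2 a.
  by rewrite -pwD; apply: pw_anti; move: r1 => ?; lra.
have [vj0|vj1] := vj.
  exists (v 0 i * z 0 i) => n; rewrite vj0 mulr0 sub0r pwN !mul0r subr0.
  have E : pw 2 (n%:R * v 0 i - z 0 i) = pw 2 (n%:R - v 0 i * z 0 i).
    by rewrite -(pw_abs1 _ _ vi) mulrBr mulrCA sq1// mulr1.
  have h1 := A1 n; have h2 := A4 (n%:R * v 0 i - z 0 i).
  have h3 : pw 4 (z 0 j) <= pw 2 (z 0 j) by apply: pw_anti; rewrite ler_nat.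
  rewrite -E; set A := n%:R * v 0 i - z 0 i in h1 h2 E *.
  apply: (@le_trans _ _ (pw r n%:R * ((pw r A * pw 2 A) * pw 2 (z 0 j)))).
    by rewrite ler_wpM2l ?pw_ge0//; apply: ler_pM; rewrite ?pw_ge0.
  rewrite [leLHS](_ : _ = (pw r n%:R * pw r A) * (pw 2 (z 0 j) * pw 2 A)); last by ring.
  by rewrite -[leRHS]mulrA; apply: ler_wpM2r h1; rewrite mulr_ge0 ?pw_ge0.
exists (v 0 j * z 0 j) => n.
set A := n%:R * v 0 i - z 0 i; set Bz := n%:R * v 0 j - z 0 j.
have E : pw 2 Bz = pw 2 (n%:R - v 0 j * z 0 j).
  by rewrite -(pw_abs1 _ _ vj1) /Bz mulrBr mulrCA sq1// mulr1.
have h1 := A1 n; rewrite -/A in h1; have h2 := A4 A.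
have h3 : pw 4 Bz <= pw 2 Bz * pw 2 Bz by rewrite -pwD; apply: pw_anti; move: r1 => ?; lra.
have h4 : pw 2 A * pw 2 Bz <= pw 2 (z 0 j - v 0 j * v 0 i * z 0 i).
  have := @pw_peetre R 2 (v 0 j * v 0 i * A) (- Bz) (ler0n R 2).
  rewrite pwN pw_abs1; last by rewrite normrM vi vj1 mulr1.
  suff -> : v 0 j * v 0 i * A - Bz = z 0 j - v 0 j * v 0 i * z 0 i by [].
  rewrite /A /Bz; have := sq1 vi; move=> e; ring: e.
have p := pw_ge0 r (n%:R : R).
apply: (@le_trans _ _ (pw r (n%:R : R) * ((pw r A * pw 2 A) * (pw 2 Bz * pw 2 Bz)))).
  by rewrite ler_wpM2l//; apply: ler_pM; rewrite ?pw_ge0.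
rewrite -E [leLHS](_ : _ = (pw r n%:R * pw r A) * (pw 2 A * pw 2 Bz) * pw 2 Bz); last by ring.
by rewrite ler_wpM2r ?pw_ge0//; apply: ler_pM; rewrite ?mulr_ge0 ?pw_ge0.
Qed.

Let coordE (z : 'rV[R]_(m + m)) n k :
  (n%:R *: v - z) 0 k = n%:R * v 0 k - z 0 k.
Proof. by rewrite mxE [(- z) 0 k]mxE [(n%:R *: v) 0 k]mxE. Qed.

(** The factor [pw 2 (n - w)] left over by [two_coord] sums to at most 4 wherever [w] lies.
    Coordinates in which [v] vanishes contribute factors that do not depend on [n]. *)
Lemma wave_sum_le (z : 'rV[R]_(m + m)) N :
  \sum_(0 <= n < N) (B * pw r (n%:R : R)) * wt 4 (n%:R *: v - z) <= B * 4 * bnd z.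
Proof.
have [w Hw] := two_coord z.
pose P := \prod_(k | (k != i) && (k != j)) pw 2 (z 0 k - v 0 k * v 0 i * z 0 i).
have P0 : 0 <= P by apply: prodr_ge0 => k _; exact: pw_ge0.
pose c0 := pw r (z 0 i) * pw 2 (z 0 j - v 0 j * v 0 i * z 0 i).
have c00 : 0 <= c0 by rewrite mulr_ge0// pw_ge0.
have E : bnd z = c0 * P.
  rewrite /bnd (bigD1 j)/=; last by rewrite eq_sym.
  by rewrite mulrA.
apply: (@le_trans _ _ (\sum_(0 <= n < N) (B * (c0 * P)) * pw 2 (n%:R - w))).
  apply: ler_sum => n _; rewrite -mulrA -[leRHS]mulrA ler_wpM2l//.
  rewrite /wt (bigD1 i)//= (bigD1 j)/=; last by rewrite eq_sym.
  rewrite !coordE.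
  have Q : \prod_(k | (k != i) && (k != j)) pw 4 ((n%:R *: v - z) 0 k) <= P.
    apply: ler_prod => k /andP[ki kj]; rewrite pw_ge0/= coordE v0//.
    rewrite mulr0 !mul0r sub0r subr0 pwN; apply: pw_anti; rewrite ler_nat//.
  have H := Hw n.
  have Q0 : 0 <= \prod_(k | (k != i) && (k != j)) pw 4 ((n%:R *: v - z) 0 k).
    by apply: prodr_ge0 => k _; exact: pw_ge0.
  rewrite [leRHS]mulrAC [pw 4 _ * (_ * _)]mulrA [leLHS]mulrA.
  apply: ler_pM => //.
  by rewrite !mulr_ge0// pw_ge0.
rewrite -mulr_sumr E [leRHS]mulrAC; apply: ler_wpM2l; last exact: sum_pw2.
by apply: mulr_ge0 => //; exact: mulr_ge0.
Qed.

Variables (s : R) (q : 'I_(m + m) -> \bar R) (sg : 'S_(m + m)).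
Hypotheses (s0 : s <= 0) (qi : decay_ok (r - s) (q (sg i))).
Hypothesis (q2 : forall k, decay_ok 2 (q k)).
Hypothesis (sij : v 0 j != 0 -> (sg j < sg i)%N).

(** The bound [bnd] has the triangular form required by [mixed_norm_triangular], with exponent
    [r - s] at slot [sg i] and 2 elsewhere. [sij] ensures that the sheared coordinate is integrated
    before the one it depends on. *)
Lemma wave_modulation_norm :
  (modulation_norm phi sg q (weight s) (wavef c G x y) < +oo)%E.
Proof.
pose rho k := if k == sg i then r - s else 2.
(* The only nonzero entry is the shear slope, in row [sg j] and column [sg i]: slots of the mixed
   norm, not coordinates of the Gabor transform. *)
pose M (k l : 'I_(m + m)) := if (l == sg i) && (k == sg j) then v 0 j * v 0 i else 0.
have [N N0 HN] := @mixed_norm_triangular R (m + m) q rho M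
  (fun k => ltac:(rewrite /rho; case: eqP => [->|_] //)).
pose C := 2 * (8 * @me_cst R m * sem (m * 6) G * sem (m * 6) (fun t => conjc (phi t)) * (B * 4)).
have C0 : 0 <= C.
  apply: mulr_ge0 => //; apply: mulr_ge0; last exact: mulr_ge0.
  by apply: mulr_ge0; [apply: mulr_ge0; [apply: mulr_ge0; [|exact: me_cst_ge0]|]|]; rewrite ?sem_ge0.
rewrite /modulation_norm; apply: (@le_lt_trans _ _ (C * N)%:E); last exact: ltry.
apply: HN => // z; first by rewrite lee_fin mulr_ge0 ?cmod_ge0// powR_ge0.
rewrite lee_fin; set z' := col_perm sg z.
have H := gabor_wavef_le (x := x) (y := y) sG sphi (z := z') cB (fun N => wave_sum_le z' N).
(* As [s <= 0], the weight decays, and a single coordinate is at most the norm; this raises the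
   exponent at slot [sg i] from [r] to [r - s]. *)
have W : weight s z <= pw (- s) (z 0 (sg i)).
  have e (t : R) : 0 <= t -> (1 + t) `^ s = ((1 + t) `^ (- s))^-1 by rewrite powRN invrK.
  rewrite /weight /pw opprK !e ?sqrtr_ge0// lef_pV2 ?posrE ?powR_gt0 ?ltr_pwDl ?sqrtr_ge0//.
  apply: ge0_ler_powR; rewrite ?oppr_ge0 ?nnegrE ?addr_ge0 ?sqrtr_ge0// lerD2l.
  exact: coord_le_enorm.
apply: (le_trans (ler_pM (cmod_ge0 _) (powR_ge0 _ _) H W)).
rewrite /C; set K := 8 * me_cst * _ * _.
rewrite [leLHS](_ : _ = 2 * (K * (B * 4)) * (bnd z' * pw (- s) (z 0 (sg i)))); last by ring.
apply: ler_wpM2l => //.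
rewrite /bnd.
have -> : \prod_k pw (rho k) (z 0 k - \sum_(l < m + m | (k < l)%N) M k l * z 0 l) =
  \prod_k pw (rho (sg k)) (z 0 (sg k) - \sum_(l < m + m | (sg k < l)%N) M (sg k) l * z 0 l).
  by rewrite (reindex_inj (@perm_inj _ sg)).
rewrite [leRHS](bigD1 i)//= /rho eqxx.
have -> : \sum_(l < m + m | (sg i < l)%N) M (sg i) l * z 0 l = 0.
  apply: big1 => l _; rewrite /M (inj_eq perm_inj) (negbTE ij) andbF mul0r//.
have zE k : z' 0 k = z 0 (sg k) by rewrite mxE.
rewrite subr0 pwD [leLHS]mulrAC !zE; apply: ler_wpM2l; first by rewrite mulr_ge0 ?pw_ge0.
rewrite le_eqVlt; apply/orP; left; apply/eqP; apply: eq_bigr => k ki.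
rewrite (inj_eq perm_inj) (negbTE ki) !zE; congr (pw _ (_ - _)).
have [kj|kj] := eqVneq k j; last first.
  rewrite v0// !mul0r; apply/esym; apply: big1 => l _.
  by rewrite /M (inj_eq perm_inj) (negbTE kj) andbF mul0r.
rewrite kj; have [vj0|vjn0] := eqVneq (v 0 j) 0.
  rewrite vj0 !mul0r; apply/esym; apply: big1 => l _.
  by rewrite /M vj0 mul0r if_same mul0r.
rewrite (bigD1 (sg i))/=; last exact: sij.
rewrite big1 ?addr0; last first.
  by move=> l /andP[_ li]; rewrite /M (negbTE li) mul0r.
by rewrite /M !eqxx.
Qed.

End WaveModulation.

(** * Approximation in L2 *)

Section L2Theory.
Local Open Scope classical_set_scope.
Local Open Scope complex_scope.
Context {R : realType} {d : nat}.
Implicit Types (f g h : 'rV[R]_d -> R[i]).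

(** A squared norm with real values keeps the approximation arguments free of square roots and of
    extended reals. *)
Definition sqnorm f : R := \int[leb d]_x (cmod (f x)) ^+ 2.

Lemma measurable_cmod f : cmeas f -> measurable_fun setT (fun x => cmod (f x)).
Proof.
move=> [m1 m2].
rewrite (_ : (fun x => _) = fun x => Num.sqrt (complex.Re (f x) ^+ 2 + complex.Im (f x) ^+ 2)).
  apply: (measurableT_comp (continuous_measurable_fun (@sqrt_continuous R))).
  by apply: measurable_funD; exact: measurable_funX.
by apply/funext => x; case: (f x).
Qed.

Lemma measurable_cmod2 f : cmeas f -> measurable_fun setT (fun x => (cmod (f x)) ^+ 2).
Proof. by move=> mf; apply: measurable_funX; exact: measurable_cmod. Qed.

Lemma L2normE f : L2norm f = ((\int[leb d]_x ((cmod (f x)) ^+ 2)%:E) `^ 2^-1)%E.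
Proof.
rewrite /L2norm unlock; congr (_ `^ _)%E; apply: eq_integral => x _ /=.
by rewrite ger0_norm ?cmod_ge0// powR_mulrn ?cmod_ge0.
Qed.

Lemma L2P f : L2 f <-> cmeas f /\
  (leb d).-integrable setT (EFin \o (fun x => (cmod (f x)) ^+ 2)).
Proof.
have ge0I : (0 <= \int[leb d]_x ((cmod (f x)) ^+ 2)%:E)%E.
  by apply: integral_ge0 => x _; rewrite lee_fin exprn_ge0// cmod_ge0.
split=> [[m1 m2 fin]|[[m1 m2] /integrableP[mi fin]]].
- split=> //; apply/integrableP; split.
    by apply/measurable_EFinP; apply: measurable_cmod2.
  under eq_integral do rewrite /= ger0_norm ?exprn_ge0 ?cmod_ge0//.
  by move: fin; rewrite L2normE; apply: lty_poweRy; rewrite invr_eq0 pnatr_eq0.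
- split => //; move: fin.
  under eq_integral do rewrite /= ger0_norm ?exprn_ge0 ?cmod_ge0//.
  by rewrite L2normE => fin; exact: poweR_lty.
Qed.

Lemma nice_L2 f : nice f -> L2 f.
Proof.
move=> nf; have [C C0 fC] := nice_bound nf; have [mf _] := nf.
apply/L2P; split=> //; apply: (@le_integrable_wt _ _ _ (C ^+ 2)).
  exact: measurable_cmod2.
move=> t; rewrite ger0_norm ?exprn_ge0 ?cmod_ge0//.
apply: (@le_trans _ _ ((C * wt 2 t) ^+ 2)).
  by apply: lerXn2r; rewrite ?nnegrE ?mulr_ge0 ?cmod_ge0 ?wt_ge0.
by rewrite exprMn ler_wpM2l ?exprn_ge0// expr2 ler_piMr ?wt_ge0 ?wt_le1.
Qed.

Lemma sqnorm_ge0 f : 0 <= sqnorm f.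
Proof. by apply: Rintegral_ge0 => x _; rewrite exprn_ge0// cmod_ge0. Qed.

Lemma L2_bounded_sqnorm T : L2_bounded_op T -> exists2 B : R, 0 <= B &
  forall f, L2 f -> sqnorm (T f) <= B * sqnorm f.
Proof.
move=> [TL _ [B HB]]; exists (B ^+ 2); first exact: sqr_ge0.
move=> f Lf; have LTf := TL _ Lf.
have E h : L2 h -> (\int[leb d]_x ((cmod (h x)) ^+ 2)%:E = (sqnorm h)%:E)%E.
  by move=> /L2P[mh ih]; rewrite /sqnorm fineK// integrable_fin_num.
have := HB _ Lf; rewrite !L2normE !E// !poweR_EFin -EFinM lee_fin => H.
have S h : sqnorm h = (sqnorm h `^ 2^-1) ^+ 2.
  by rewrite -powR_mulrn ?powR_ge0// -powRrM mulVf ?pnatr_eq0// powRr1 ?sqnorm_ge0.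
rewrite (S (T f)) (S f) -exprMn; apply: lerXn2r; rewrite ?nnegrE ?powR_ge0//.
exact: le_trans (powR_ge0 _ _) H.
Qed.

Lemma L2dotE f g : L2dot f g = cint (fun x => f x * conjc (g x)).
Proof. by []. Qed.

Section Pair.
Variables f g : 'rV[R]_d -> R[i].
Hypotheses (Lf : L2 f) (Lg : L2 g).

Let mfg : cmeas (fun x => f x * conjc (g x)).
Proof. by apply: cmeasM; [have /L2P[] := Lf|apply: cmeasJ; have /L2P[] := Lg]. Qed.

Let bound (l : R) x : 0 < l ->
  2 * cmod (f x * conjc (g x)) <= l * cmod (f x) ^+ 2 + l^-1 * cmod (g x) ^+ 2.
Proof.
move=> l0; rewrite cmodM cmodJ; have lu : l * l^-1 = 1 by rewrite mulfV ?gt_eqF.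
rewrite -subr_ge0; set a := cmod _; set b := cmod _.
rewrite (_ : _ - _ = l * (a - l^-1 * b) ^+ 2); first by rewrite mulr_ge0 ?sqr_ge0// ltW.
by rewrite sqrrB exprMn; ring: lu.
Qed.

Let int_bound (l : R) : (leb d).-integrable setT
  (EFin \o (fun x => l * cmod (f x) ^+ 2 + l^-1 * cmod (g x) ^+ 2)).
Proof.
have /L2P[_ If] := Lf; have /L2P[_ Ig] := Lg.
exact: (integrableD measurableT (integrableZl measurableT l If)
  (integrableZl measurableT l^-1 Ig)).
Qed.

Lemma L2dot_int : (leb d).-integrable setT (EFin \o (fun x => complex.Re (f x * conjc (g x)))) /\
  (leb d).-integrable setT (EFin \o (fun x => complex.Im (f x * conjc (g x)))).
Proof.
have B x := @bound 1 x ltr01; have [m1 m2] := mfg.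
split; apply: (le_integrable measurableT _ _ (int_bound 1)) => //; try exact/measurable_EFinP.
- move=> x _; rewrite /= lee_fin (le_trans (cmod_Re _))//.
  by have := B x; have := cmod_ge0 (f x * conjc (g x)); move=> ? ?; rewrite [leRHS]ger0_norm; lra.
- move=> x _; rewrite /= lee_fin (le_trans (cmod_Im _))//.
  by have := B x; have := cmod_ge0 (f x * conjc (g x)); move=> ? ?; rewrite [leRHS]ger0_norm; lra.
Qed.

(** The weighted inequality [2 a b <= l a^2 + b^2 / l] stands in for Cauchy-Schwarz, with [l] left
    to the caller. Its factor 2 pays for treating real and imaginary parts separately. *)
Lemma L2dot_le (l : R) : 0 < l -> cmod (L2dot f g) <= l * sqnorm f + sqnorm g / l.
Proof.
move=> l0; have [i1 i2] := L2dot_int; have [m1 m2] := mfg.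
have E : \int[leb d]_x (l * cmod (f x) ^+ 2 + l^-1 * cmod (g x) ^+ 2) =
    l * sqnorm f + sqnorm g / l.
  have /L2P[_ If] := Lf; have /L2P[_ Ig] := Lg.
  rewrite RintegralD//; last 2 first.
  - exact: (integrableZl measurableT l If).
  - exact: (integrableZl measurableT l^-1 Ig).
  by rewrite !RintegralZl// /sqnorm [_ / l]mulrC.
have P (p : R[i] -> R) : (forall z, `|p z| <= cmod z) ->
    (leb d).-integrable setT (EFin \o (fun x => p (f x * conjc (g x)))) ->
    `|\int[leb d]_x p (f x * conjc (g x))| <= (l * sqnorm f + sqnorm g / l) / 2.
  move=> pz ip; apply: (le_trans (le_normr_Rintegral measurableT ip)).
  rewrite ler_pdivlMr// -E mulrC -RintegralZl//; last exact: integrable_norm ip.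
  apply: le_Rintegral => //; first exact: (integrableZl measurableT 2 (integrable_norm ip)).
  move=> x _; apply: le_trans (bound x l0); rewrite ler_wpM2l//.
apply: (le_trans (cmod_le _)).
rewrite [leRHS]splitr; apply: lerD; rewrite /L2dot /cint/=.
- exact: (P (@complex.Re R) (@cmod_Re R)).
- exact: (P (@complex.Im R) (@cmod_Im R)).
Qed.

End Pair.

Lemma L2dotDl f g h : L2 f -> L2 g -> L2 h ->
  L2dot (fun x => f x + g x) h = L2dot f h + L2dot g h.
Proof.
move=> Lf Lg Lh; have [a1 a2] := L2dot_int Lf Lh; have [b1 b2] := L2dot_int Lg Lh.
rewrite !L2dotE; apply: complexP; rewrite ?Re_add ?Im_add /cint/= -RintegralD//.
- by apply: eq_Rintegral => x _; rewrite mulrDl Re_add.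
- by apply: eq_Rintegral => x _; rewrite mulrDl Im_add.
Qed.

Lemma L2dotDr f g h : L2 f -> L2 g -> L2 h ->
  L2dot h (fun x => f x + g x) = L2dot h f + L2dot h g.
Proof.
move=> Lf Lg Lh; have [a1 a2] := L2dot_int Lh Lf; have [b1 b2] := L2dot_int Lh Lg.
have E x : h x * conjc (f x + g x) = h x * conjc (f x) + h x * conjc (g x).
  by rewrite rmorphD mulrDr.
rewrite !L2dotE; apply: complexP; rewrite ?Re_add ?Im_add /cint/= -RintegralD//.
- by apply: eq_Rintegral => x _; rewrite E Re_add.
- by apply: eq_Rintegral => x _; rewrite E Im_add.
Qed.

Lemma ae_L2dot f g h : L2 f -> L2 g -> L2 h ->
  {ae leb d, forall x, f x = g x} -> L2dot f h = L2dot g h.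
Proof.
move=> Lf Lg Lh fg; have [a1 a2] := L2dot_int Lf Lh; have [b1 b2] := L2dot_int Lg Lh.
rewrite !L2dotE; apply: complexP; rewrite /cint/= /Rintegral; congr fine.
- apply: ae_eq_integral => //; [exact: measurable_int a1|exact: measurable_int b1|].
  by apply: filterS fg => x /= -> _.
- apply: ae_eq_integral => //; [exact: measurable_int a2|exact: measurable_int b2|].
  by apply: filterS fg => x /= -> _.
Qed.

Lemma L2D f g : L2 f -> L2 g -> L2 (fun x => f x + g x).
Proof.
move=> /L2P[mf If] /L2P[mg Ig]; apply/L2P; split; first exact: cmeasD.
apply: (le_integrable measurableT _ _ (g := EFin \o (fun x => 2 * cmod (f x) ^+ 2 + 2 * cmod (g x) ^+ 2))).
- by apply/measurable_EFinP; apply: measurable_cmod2; exact: cmeasD.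
- move=> x _; rewrite /= lee_fin.
  have := cmodD (f x) (g x); have := cmod_ge0 (f x + g x).
  set u := cmod _; set v := cmod (f x); set w := cmod (g x) => u0 uvw.
  rewrite ger0_norm ?sqr_ge0// ger0_norm; last by apply: addr_ge0; apply: mulr_ge0; rewrite ?sqr_ge0.
  by have := sqr_ge0 (v - w); nra.
- exact: (integrableD measurableT (integrableZl measurableT 2 If)
    (integrableZl measurableT 2 Ig)).
Qed.

(* Replacing [f] and [g] by approximations changes [<T f, g>] by an amount that
   is controlled, for every [l > 0], without extracting square roots. *)
Lemma L2dot_approx T (B l : R) f f' g g' : L2_bounded_op T -> 0 <= B ->
  (forall h, L2 h -> sqnorm (T h) <= B * sqnorm h) ->
  nice f -> nice f' -> nice g -> nice g' -> 0 < l ->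
  cmod (L2dot (T f') g') <= cmod (L2dot (T f) g) +
    (l * (B * sqnorm (fun x => f' x - f x)) + sqnorm g / l) +
    (l * sqnorm (fun x => g' x - g x) + B * sqnorm f' / l).
Proof.
move=> bT B0 HB nf nf' ng ng' l0; have [TL Tlin _] := bT.
have nm h1 h2 : nice h1 -> nice h2 -> nice (fun x : 'rV[R]_d => h1 x - h2 x).
  move=> n1 n2; rewrite (_ : (fun x => _) = (fun x => h1 x + (-1) * h2 x)).
    by apply: niceD => //; exact: niceZ.
  by apply/funext => x; rewrite mulN1r.
set df := fun x => f' x - f x; set dg := fun x => g' x - g x.
have Ldf : L2 df by apply: nice_L2; exact: nm.
have Ldg : L2 dg by apply: nice_L2; exact: nm.
have := (nice_L2 nf, nice_L2 nf', nice_L2 ng, nice_L2 ng') => -[[[Lf Lf'] Lg] Lg'].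
have E1 : L2dot (T f') g = L2dot (T df) g + L2dot (T f) g.
  rewrite -L2dotDl; [|exact: TL|exact: TL|by []].
  apply: ae_L2dot => //; [exact: TL|by apply: L2D; exact: TL|].
  have := Tlin 1 _ _ Ldf Lf.
  rewrite (_ : (fun y => 1 * df y + f y) = f'); last first.
    by apply/funext => y; rewrite mul1r /df subrK.
  by apply: filterS => x ->; rewrite mul1r.
have E2 : L2dot (T f') g' = L2dot (T f') dg + L2dot (T f') g.
  rewrite -L2dotDr//; last exact: TL.
  by congr L2dot; apply/funext => y; rewrite /dg subrK.
rewrite E2 E1.
have := L2dot_le (TL _ Ldf) Lg l0; have l0' : 0 < l^-1 by rewrite invr_gt0.
have := L2dot_le (TL _ Lf') Ldg l0'; rewrite invrK.
have := cmodD (L2dot (T f') dg) (L2dot (T df) g + L2dot (T f) g).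
have := cmodD (L2dot (T df) g) (L2dot (T f) g).
have h1 := HB _ Ldf; have h2 := HB _ Lf'.
have h3 : l * sqnorm (T df) <= l * (B * sqnorm df) by rewrite ler_wpM2l// ltW.
have h4 : l^-1 * sqnorm (T f') <= B * sqnorm f' / l by rewrite mulrC ler_wpM2r// ltW.
lra.
Qed.

End L2Theory.

(** * Box test functions *)

Section Bump1D.
Local Open Scope classical_set_scope.
Context {R : realType}.
Implicit Types (x y : R) (M n : nat).

Definition indb x : R := \1_(`]-2^-1, 2^-1[ : set R) x.

(* The factor [M.+1] makes [expR (- steep M x)] tend to 0 at the end points
   [x = +-1/2] too, so that convergence to [indb] holds everywhere. *)
Definition steep M x : R := M.+1%:R * ((2 * x) ^+ 2) ^+ M.+1.

Lemma indbE x : indb x = if `|2 * x| < 1 then 1 else 0.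
Proof.
rewrite /indb indicE; case: ifPn => [|/negP h].
  rewrite ltr_norml => /andP[h1 h2]; rewrite mem_set//= in_itv/=.
  by apply/andP; split; lra.
rewrite memNset//= in_itv/= => /andP[h1 h2].
by apply: h; rewrite ltr_norml; apply/andP; split; lra.
Qed.

Lemma indb_ge0 x : 0 <= indb x. Proof. by rewrite /indb indicE. Qed.
Lemma measurable_indb : measurable_fun setT indb.
Proof. exact: measurable_indic. Qed.

Lemma measurable_steep M : measurable_fun setT (fun x => expR (- steep M x)).
Proof.
apply: measurableT_comp => //; apply: measurableT_comp => //.
apply: measurable_funM; first exact: measurable_cst.
do 2 apply: measurable_funX; apply: measurable_funM; first exact: measurable_cst.
exact: measurable_id.
Qed.

Lemma steep_ge M x : 4 * x ^+ 2 - 1 <= steep M x.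
Proof.
rewrite /steep (_ : (2 * x) ^+ 2 = 4 * x ^+ 2); last by ring.
set y := 4 * x ^+ 2; have y0 : 0 <= y by rewrite mulr_ge0// sqr_ge0.
have [y1|/ltW y1] := leP y 1.
  by apply: (@le_trans _ _ 0); [lra|rewrite mulr_ge0// exprn_ge0].
have h1 : y <= y ^+ M.+1 by rewrite exprS ler_peMr// exprn_ege1.
have h2 : y ^+ M.+1 <= M.+1%:R * y ^+ M.+1.
  by rewrite ler_peMl ?exprn_ge0// ler1n.
lra.
Qed.

Lemma steep_le1 M x : `|4 * x| <= 1 -> steep M x <= 1.
Proof.
rewrite ler_norml => /andP[h1 h2].
have y4 : (2 * x) ^+ 2 <= 2^-1 by nra.
apply: (@le_trans _ _ (M.+1%:R * 2^-1 ^+ M.+1)).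
  by rewrite ler_wpM2l//; apply: lerXn2r; rewrite ?nnegrE ?sqr_ge0// invr_ge0.
by rewrite exprVn ler_pdivrMr ?exprn_gt0// mul1r -natrX ler_nat ltnW// ltn_expl.
Qed.

(** For [y = |2 x|], [1 - y^n = (1 - y) (1 + ... + y^(n-1)) >= (1 - y) n y^n]. One of the two powers
    [y^n] thus absorbs the factor [n], and the other one still tends to 0. *)
Lemma steep_lt1 x n : `|2 * x| < 1 ->
  (1 - `|2 * x|) * (n%:R * ((2 * x) ^+ 2) ^+ n) <= `|2 * x| ^+ n.
Proof.
rewrite -[(2 * x) ^+ 2]real_normK ?num_real//; set y := `|2 * x| => y1.
have y0 : 0 <= y by rewrite normr_ge0.
have H : (1 - y) * (n%:R * y ^+ n) <= 1 - y ^+ n.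
  elim: n => [|n IH]; first by rewrite mul0r mulr0 expr0 subrr.
  have := ler_wpM2l y0 IH.
  have z0 : 0 <= y ^+ n.+1 by rewrite exprn_ge0.
  have z1 : y ^+ n.+1 <= 1 by rewrite exprn_ile1// ltW.
  have : 0 <= (1 - y) * (1 - y ^+ n.+1) by rewrite mulr_ge0 ?subr_ge0// ltW.
  rewrite -natr1 exprS; nra.
have z0 : 0 <= y ^+ n by rewrite exprn_ge0.
rewrite -exprM mulnC exprM expr2 !mulrA -[leRHS]mul1r ler_wpM2r//.
by move: H; rewrite mulrA => H; lra.
Qed.

Lemma steep_cvg x : expR (- steep M x) @[M --> \oo] --> indb x.
Proof.
rewrite indbE; case: ifPn => [x1|]; last first.
  rewrite -leNgt => x1.
  (* For [|2 x| >= 1], end points included, [steep M x >= M + 1], so the exponential is at most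
     [1 / (M + 1)]. *)
  apply: (@squeeze_cvgr _ _ _ _ (fun=> 0) harmonic); [|exact: cvg_cst|exact: cvg_harmonic].
  apply: nearW => M; rewrite expR_ge0/= expRN lef_pV2 ?posrE ?expR_gt0//.
  apply: (@le_trans _ _ (steep M x)).
    by rewrite /steep ler_peMr// exprn_ege1// -real_normK ?num_real// exprn_ege1.
  by apply: le_trans (expR_ge1Dx _); rewrite lerDr.
rewrite -expR0; apply: continuous_cvg; first exact: continuous_expR.
rewrite -oppr0; apply: cvgN.
have y0 : 0 < 1 - `|2 * x| by rewrite subr_gt0.
apply: (@squeeze_cvgr _ _ _ _ (fun=> 0) (fun M => (1 - `|2 * x|)^-1 * `|2 * x| ^+ M.+1)).
- apply: nearW => M; apply/andP; split.
    by rewrite /steep mulr_ge0// exprn_ge0// sqr_ge0.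
  by rewrite ler_pdivlMl//; exact: steep_lt1.
- exact: cvg_cst.
- rewrite -[X in _ --> X](mulr0 (1 - `|2 * x|)^-1); apply: cvgM; first exact: cvg_cst.
  have := @cvg_expr R `|2 * x|; rewrite normr_id => /(_ x1).
  by rewrite -(cvg_shiftS (fun M => `|2 * x| ^+ M)).
Qed.

End Bump1D.

Section Bump.
Local Open Scope classical_set_scope.
Local Open Scope complex_scope.
Context {R : realType} {d : nat}.
Local Notation mu := (@lebesgue_measure R).
Implicit Types (t a xi : 'rV[R]_d) (M n : nat).

Definition boxr t : R := \prod_k indb (t 0 k).
Definition bumpr M t : R := \prod_k expR (- steep M (t 0 k)).
(** A Gaussian majorant of the box and of all its approximations. It serves dominated convergence
    and bounds the norms of the bumps uniformly in [M]. *)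
Definition dom t : R := \prod_k expR (1 - 4 * t 0 k ^+ 2).
Definition box t : R[i] := (boxr t)%:C.
Definition cbump M t : R[i] := (bumpr M t)%:C.

Lemma domE t : dom t = expR d%:R * gaus 4 t.
Proof.
rewrite /dom -expR_sum sumrB sumr_const card_ord expRD /gaus /sqn.
by rewrite -mulr_sumr.
Qed.

Lemma dom_le_wt : exists2 C, 0 <= C & forall t, dom t <= C * wt 2 t.
Proof.
have [C H] := @gaus_le_wt R d 4 (ltr0n R 4).
exists (expR d%:R * `|C|) => [|t]; first by rewrite mulr_ge0// expR_ge0.
rewrite domE -mulrA ler_wpM2l ?expR_ge0// (le_trans (H t))// ler_wpM2r ?wt_ge0//.
exact: ler_norm.
Qed.

Lemma boxr_ge0 t : 0 <= boxr t.
Proof. by apply: prodr_ge0 => k _; exact: indb_ge0. Qed.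
Lemma bumpr_gt0 M t : 0 < bumpr M t.
Proof. by apply: prodr_gt0 => k _; exact: expR_gt0. Qed.

Lemma bumpr_le M t : bumpr M t <= dom t.
Proof.
apply: ler_prod => k _; rewrite expR_ge0/= ler_expR.
by have := steep_ge M (t 0 k); lra.
Qed.

Lemma boxr_le t : boxr t <= dom t.
Proof.
apply: ler_prod => k _; rewrite indb_ge0/= indbE; case: ifP => [|_]; last exact: expR_ge0.
rewrite ltr_norml => /andP[h1 h2]; rewrite -[X in X <= _]expR0 ler_expR; nra.
Qed.

Lemma measurable_boxr : measurable_fun setT boxr.
Proof. exact: (@measurable_prodr R d (fun _ => indb) (fun _ => measurable_indb)). Qed.
Lemma measurable_bumpr M : measurable_fun setT (bumpr M).
Proof. exact: (@measurable_prodr R d (fun _ x => expR (- steep M x)) (fun _ => measurable_steep M)). Qed.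

Let nice_dom (f : 'rV[R]_d -> R) : measurable_fun setT f -> (forall t, 0 <= f t) ->
  (forall t, f t <= dom t) -> nice (fun t => (f t)%:C).
Proof.
move=> mf f0 fd; have [C C0 H] := dom_le_wt; split.
  by split => //=; exact: measurable_cst.
by exists C => t; rewrite cmodr ger0_norm// (le_trans (fd t)).
Qed.

Lemma nice_box : nice box.
Proof. by apply: nice_dom; [exact: measurable_boxr|exact: boxr_ge0|exact: boxr_le]. Qed.
Lemma nice_bump M : nice (cbump M).
Proof.
by apply: nice_dom; [exact: measurable_bumpr|move=> t; exact/ltW/bumpr_gt0|exact: bumpr_le].
Qed.

Lemma bumpr_cvg t : bumpr M t @[M --> \oo] --> boxr t.
Proof.
rewrite /boxr /bumpr; apply: cvg_big => [|k _]; [exact: mul_continuous|].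
exact: steep_cvg.
Qed.

Lemma dom2_int : (leb d).-integrable setT (EFin \o (fun t => dom t ^+ 2)).
Proof.
have [C C0 H] := dom_le_wt.
have mD : measurable_fun setT dom.
  rewrite (_ : dom = fun t => expR d%:R * gaus 4 t); last by apply/funext => t; exact: domE.
  by apply: measurable_funM; [exact: measurable_cst|exact: meas_gaus].
apply: (@le_integrable_wt _ _ _ (C ^+ 2)); first exact: measurable_funX.
have D0 t : 0 <= dom t by apply: le_trans (boxr_le t); exact: boxr_ge0.
move=> t; rewrite ger0_norm ?exprn_ge0//.
apply: (@le_trans _ _ ((C * wt 2 t) ^+ 2)).
  by apply: lerXn2r; rewrite ?nnegrE ?mulr_ge0 ?wt_ge0.
by rewrite exprMn ler_wpM2l ?exprn_ge0// expr2 ler_piMr ?wt_ge0 ?wt_le1.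
Qed.

Definition domK : R := \int[leb d]_t dom t ^+ 2.

Let sub_cmod M t : cmod (cbump M t - box t) ^+ 2 = (bumpr M t - boxr t) ^+ 2.
Proof. by rewrite /cbump /box -rmorphB cmodr real_normK ?num_real. Qed.

Lemma bump_approx (eps : R) : 0 < eps ->
  exists M, sqnorm (fun t => cbump M t - box t) <= eps.
Proof.
move=> e0.
have D0 t : 0 <= dom t by apply: le_trans (boxr_le t); exact: boxr_ge0.
have mE M : measurable_fun setT (fun t => ((bumpr M t - boxr t) ^+ 2)%:E).
  apply/measurable_EFinP; apply: measurable_funX; apply: measurable_funB.
    exact: measurable_bumpr.
  exact: measurable_boxr.
have H : (\int[leb d]_t ((bumpr M t - boxr t) ^+ 2)%:E @[M --> \oo] --> \int[leb d]_t (cst 0 t))%E.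
  apply: (dominated_cvg measurableT mE _ _ dom2_int) => //.
  - move=> t _; apply/cvg_EFin; first by apply: nearW.
    rewrite (_ : 0 = (boxr t - boxr t) ^+ 2); last by rewrite subrr expr0n.
    apply: (continuous_cvg _ (@exprn_continuous R 2 _)).
    by apply: cvgB; [exact: bumpr_cvg|exact: cvg_cst].
  - move=> M t _; rewrite /= lee_fin ger0_norm ?sqr_ge0//.
    rewrite -real_normK ?num_real//; apply: lerXn2r; rewrite ?nnegrE//.
    have := bumpr_le M t; have := boxr_le t; have := boxr_ge0 t; have := bumpr_gt0 M t.
    by rewrite ler_norml => *; apply/andP; split; lra.
rewrite integral0 in H.
have /fine_cvgP[_ /cvgr0_norm_lt/(_ _ e0)[M _ HM]] := H.
exists M; have := HM M (leqnn M); rewrite /= => /ltW; apply: le_trans.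
by rewrite /sqnorm; under eq_Rintegral do rewrite sub_cmod; exact: ler_norm.
Qed.

Lemma sqnorm_bump_le M : sqnorm (cbump M) <= domK.
Proof.
have /L2P[_ iM] := nice_L2 (nice_bump M).
apply: le_Rintegral => //; first exact: dom2_int.
move=> t _; rewrite cmodr ger0_norm ?(ltW (bumpr_gt0 _ _))//.
have := bumpr_gt0 M t => /ltW h; apply: lerXn2r; rewrite ?nnegrE ?bumpr_le//.
exact: le_trans h (bumpr_le M t).
Qed.

Lemma sqnorm_modul_transl a xi f : cmeas f ->
  sqnorm (modul xi (transl a f)) = @sqnorm R d f.
Proof.
move=> mf; rewrite /sqnorm.
under eq_Rintegral do rewrite /modul /transl cmodM cmod_e2pi mul1r.
exact: (Rintegral_shift (- a) (measurable_cmod2 mf)).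
Qed.

Lemma schwartz_bump xi a M : schwartz (modul xi (transl a (cbump M))).
Proof.
pose Q t : R := \sum_k steep M ((t - a) 0 k).
pose q t := dotrv t xi.
have -> : modul xi (transl a (cbump M)) = gwave q Q.
  apply/funext => t; rewrite /modul /transl /gwave /cbump /bumpr /q /Q.
  by rewrite -expR_sum sumrN.
have pc k : polyf (fun t => 2 * (t - a) 0 k).
  apply: polyf_mul; first exact: polyf_cst.
  under eq_fun do rewrite mxE mxE.
  by apply: polyf_add; [exact: polyf_coord|exact: polyf_cst].
(* The constants come from [4 (t - a)^2 - 2 t^2 + 4 a^2 = 2 (t - 2 a)^2 >= 0] in each coordinate,
   the term [d] from the -1 in [steep_ge]. *)
apply: (@schwartz_gwave _ _ q Q _ _ 2 (d%:R + 4 * sqn a)) => //.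
- apply: polyf_sum => k; apply: polyf_mul; [exact: polyf_coord|exact: polyf_cst].
- apply: polyf_sum => k; apply: polyf_mul; first exact: polyf_cst.
  by do 2 apply: polyf_exp; exact: pc.
move=> t; apply: (@le_trans _ _ (\sum_k (4 * ((t - a) 0 k) ^+ 2 - 1))); last first.
  by apply: ler_sum => k _; exact: steep_ge.
rewrite -subr_ge0 /sqn !mulr_sumr.
rewrite (_ : _ - _ = \sum_k (4 * ((t - a) 0 k) ^+ 2 - 1 - 2 * t 0 k ^+ 2 + 1 + 4 * a 0 k ^+ 2)).
  by apply: sumr_ge0 => k _; rewrite mxE mxE; have := sqr_ge0 (t 0 k - 2 * a 0 k); nra.
rewrite !big_split/= !sumrN !sumr_const !card_ord; ring.
Qed.

End Bump.

(** * Orthonormality of shifted boxes *)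

Section Overlap.
Local Open Scope classical_set_scope.
Local Open Scope complex_scope.
Context {R : realType}.
Local Notation mu := (@lebesgue_measure R).

Lemma indb_int : (\int[mu]_x (indb x)%:E = 1)%E.
Proof.
rewrite /indb integral_indic// setIT [LHS]lebesgue_measure_itv/= lte_fin.
rewrite ifT; last by lra.
by rewrite -EFinD; congr (_%:E); lra.
Qed.

Let half_int (f F : R -> R) : (forall x, is_derive x (1 : R) F (f x)) -> (forall x, 0 <= f x) ->
  continuous f -> (\int[mu]_x (f x * indb x)%:E = (F 2^-1 - F (- 2^-1))%:E)%E.
Proof.
move=> dF f0 cf.
have cF : continuous F by move=> x; apply: differentiable_continuous; apply/derivable1_diffP; case: (dF x).
transitivity (\int[mu]_(x in `[(-2^-1)%R, 2^-1%R]) (f x)%:E)%E.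
  rewrite -integral_itv_bndo_bndc; last first.
    by apply/measurable_EFinP; apply: measurable_funTS; exact: continuous_measurable_fun.
  rewrite -integral_itv_obnd_cbnd; last first.
    by apply/measurable_EFinP; apply: measurable_funTS; exact: continuous_measurable_fun.
  rewrite [RHS]integral_mkcond; apply: eq_integral => x _.
  by rewrite patchE /indb indicE; case: ifP => _; rewrite ?mulr1// mulr0.
rewrite (@continuous_FTC2 R f F); first by rewrite -EFinB.
- by lra.
- exact: continuous_subspaceT.
- split => [x _||].
  + by case: (dF x).
  + by apply: cvg_at_right_filter; exact: cF.
  + by apply: cvg_at_left_filter; exact: cF.
- by move=> x _; rewrite derive1E; case: (dF x).
Qed.

(* The constant 1 is added to make the integrand nonnegative. *)
Lemma indb_cos (k : R) : k != 0 -> sin (k / 2) = 0 ->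
  (\int[mu]_x ((1 + cos (k * x)) * indb x)%:E = 1)%E.
Proof.
move=> k0 sk.
have dsin (x : R) : is_derive x (1 : R) (fun x : R => sin (k * x)) (k * cos (k * x)).
  have H := @is_derive1_comp R sin ( *%R k) x _ _ (is_derive_sin _) _.
  apply: (is_derive_eq (H k _)); last by rewrite mulrC.
  by apply: is_derive_eq; rewrite /GRing.scale/= mulr1.
have ccos : continuous (fun x : R => cos (k * x)).
  move=> x; apply: (@continuous_comp _ _ _ ( *%R k)); last exact: continuous_cos.
  exact: mulrl_continuous.
have dF (x : R) : is_derive x (1 : R) (fun x : R => x + k^-1 * sin (k * x)) (1 + cos (k * x)).
  apply: is_deriveD => //.
  have E : cos (k * x) = k^-1 *: (k * cos (k * x)).
    by rewrite /GRing.scale/= mulrA mulVf// mul1r.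
  by rewrite E; have := dsin x => ?; exact: is_deriveZ.
have f0 (x : R) : 0 <= 1 + cos (k * x) by have := cos_geN1 (k * x); lra.
have cf : continuous (fun x : R => 1 + cos (k * x)).
  by move=> x; apply: continuousD; [exact: cvg_cst|exact: ccos].
rewrite (half_int dF f0 cf).
by rewrite mulrN sinN sk; congr (_%:E); lra.
Qed.

End Overlap.

Section OverlapRow.
Local Open Scope classical_set_scope.
Local Open Scope complex_scope.
Context {R : realType} {d : nat}.
Local Notation mu := (@lebesgue_measure R).
Implicit Types (t x y w : 'rV[R]_d) (u v : 'rV[R]_d -> R).

Lemma boxr_int : \int[leb d]_t boxr t = 1 :> R.
Proof.
rewrite /Rintegral (@leb_prod_ge0 R d (fun _ => indb)) => [|_|_ x].
- by rewrite big1 // => k _; exact: indb_int.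
- exact: measurable_indb.
- exact: indb_ge0.
Qed.

Lemma boxr_cos (k : 'I_d) (a : R) : a != 0 -> sin (a / 2) = 0 ->
  \int[leb d]_t (cos (a * t 0 k) * boxr t) = 0.
Proof.
move=> a0 sa.
have nb := @nice_box R d.
have mc : measurable_fun setT (fun t => cos (a * t 0 k)).
  apply: (measurableT_comp (continuous_measurable_fun (@continuous_cos R))).
  by apply: measurable_funM; [exact: measurable_cst|exact: measurable_coord].
have i1 : (leb d).-integrable setT (EFin \o boxr) := nice_Re nb.
have i2 : (leb d).-integrable setT (EFin \o (fun t => cos (a * t 0 k) * boxr t)).
  apply: (le_integrable measurableT _ _ i1).
    by apply/measurable_EFinP; apply: measurable_funM => //; exact: measurable_boxr.
  move=> t _; rewrite /= lee_fin normrM ler_piMl//.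
  by rewrite ler_norml cos_geN1 cos_le1.
(* Adding the integral of the box makes the integrand a product of nonnegative functions of one
   variable, as [leb_prod_ge0] requires. *)
apply: (addrI 1); rewrite addr0 -[X in X + _]boxr_int -RintegralD//.
pose f (l : 'I_d) (x : R) := (if l == k then 1 + cos (a * x) else 1) * indb x.
transitivity (\int[leb d]_t \prod_l f l (t 0 l)).
  apply: eq_Rintegral => t _; rewrite /f big_split/= -/(boxr t).
  rewrite -[X in X + _]mul1r -mulrDl; congr (_ * _).
  by rewrite (bigD1 k)//= eqxx big1 ?mulr1// => l /negbTE ->.
rewrite /Rintegral (leb_prod_ge0 (f := f)) => [|l|l x].
- rewrite (eq_bigr (fun=> 1%E)) ?big1// => l _; rewrite /f; case: eqP => _.
    exact: indb_cos.
  by under eq_integral do rewrite mul1r; exact: indb_int.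
- rewrite /f; apply: measurable_funM; last exact: measurable_indb.
  case: eqP => _; last exact: measurable_cst.
  apply: measurable_funD; first exact: measurable_cst.
  apply: (measurableT_comp (continuous_measurable_fun (@continuous_cos R))).
  by apply: measurable_funM; [exact: measurable_cst|exact: measurable_id].
- rewrite /f mulr_ge0 ?indb_ge0//; by case: eqP.
Qed.

Lemma boxrN t : boxr (- t) = boxr t.
Proof. by apply: eq_bigr => k _; rewrite !indbE mxE mulrN normrN. Qed.

Lemma boxr_sqr t : boxr t * boxr t = boxr t.
Proof.
rewrite /boxr -big_split; apply: eq_bigr => k _ /=; rewrite indbE.
by case: ifP; rewrite ?mulr1 ?mulr0.
Qed.

Lemma Rintegral_odd (f : 'rV[R]_d -> R) : measurable_fun setT f ->
  (forall t, f (- t) = - f t) -> (leb d).-integrable setT (EFin \o f) ->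
  \int[leb d]_t f t = 0.
Proof.
move=> mf fN fi; have := Rintegral_opp mf; under eq_Rintegral do rewrite fN -mulN1r.
by rewrite RintegralZl// mulN1r => E; lra.
Qed.

Lemma e2pi_nat n : e2pi (n%:R : R) = 1.
Proof.
elim: n => [|n IH]; first exact: e2pi0.
by rewrite -natr1 e2piD IH mul1r /e2pi mulr1 mulr_natl cos2pi sin2pi.
Qed.

Lemma wave_conj_mul u v x y m n t :
  wave (fun t => (u t)%:C) x y m t * conjc (wave (fun t => (v t)%:C) x y n t) =
  e2pi (dotrv t ((m%:R - n%:R) *: y)) *
    (u (t - m%:R *: x) * v (t - n%:R *: x))%:C.
Proof.
have cr (z : R) : conjc (z%:C) = z%:C by apply: complexP; rewrite /= ?oppr0.
rewrite /wave /modul /transl conjcM e2piJ cr scalerBl dotrvDr dotrvNr e2piD rmorphM/=.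
by rewrite mulrACA.
Qed.

Lemma cint_e2pi_real w u :
  cint (fun t => e2pi (dotrv t w) * (u t)%:C) =
  (\int[leb d]_t (cos (2 * pi * dotrv t w) * u t)) +i*
  (\int[leb d]_t (sin (2 * pi * dotrv t w) * u t)).
Proof.
apply: complexP; apply: eq_Rintegral => t _.
- by rewrite Re_mul/= mulr0 subr0.
- by rewrite Im_mul/= mulr0 add0r.
Qed.

Lemma dotrv_scale_delta t (a : R) k : dotrv t (a *: delta_mx 0 k) = a * t 0 k.
Proof. by rewrite dotrvZr dotrv_deltar. Qed.

(** Moved boxes have disjoint supports. Modulated boxes are characters of integer frequency on the
    unit cube: the cosine is integrated over full periods and the sine part is odd. *)
Lemma orthonormal_wave_box x y (k : 'I_d) :
  (y = 0 /\ 1 <= `|x 0 k|) \/ (x = 0 /\ exists2 e : R, `|e| = 1 & y = e *: delta_mx 0 k) ->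
  orthonormal_seq (fun n => wave box x y (2 * n)).
Proof.
move=> H; split=> [m|m n].
  by apply: nice_L2; apply: nice_modul; apply: nice_transl; exact: nice_box.
rewrite L2dotE; under [in LHS]eq_fun do rewrite wave_conj_mul.
have [->|mn] := eqVneq m n.
  rewrite subrr scale0r; under eq_fun do rewrite dotrv0r e2pi0 mul1r boxr_sqr.
  apply: complexP => /=; last by rewrite /Rintegral integral0.
  exact: (etrans (Rintegral_shift (- ((2 * n)%:R *: x)) measurable_boxr) boxr_int).
case: H => [[-> xk]|[-> [e e1 ->]]].
  under eq_fun do rewrite scaler0 dotrv0r e2pi0 mul1r.
  suff E t : boxr (t - (2 * m)%:R *: x) * boxr (t - (2 * n)%:R *: x) = 0.
    by under eq_fun do rewrite E; apply: complexP; rewrite /= /Rintegral integral0.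
  rewrite /boxr -big_split/= (bigD1 k)//= !indbE; case: ifPn => [h1|_]; last by rewrite !mul0r.
  case: ifPn => [h2|_]; last by rewrite mulr0 mul0r.
  exfalso; have e0 (p : nat) : (t - p%:R *: x) 0 k = t 0 k - p%:R * x 0 k by rewrite !mxE.
  move: h1 h2; rewrite !e0 => h1 h2.
  have : `|(2 * m)%:R * x 0 k - (2 * n)%:R * x 0 k| < 1.
    move: h1 h2; rewrite !ltr_norml => /andP[? ?] /andP[? ?]; apply/andP; split; lra.
  apply/negP; rewrite -leNgt -mulrBl normrM; apply: mulr_ege1 => //.
  rewrite !natrM -mulrBr normrM ger0_norm// -[leLHS](mulr1 1); apply: ler_pM => //.
    by rewrite ler1n.
  case: (ltngtP m n) mn => // mn _.
    by rewrite distrC -natrB ?(ltnW mn)// normr_nat ler1n subn_gt0.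
  by rewrite -natrB ?(ltnW mn)// normr_nat ler1n subn_gt0.
under eq_fun do rewrite !scaler0 subr0 boxr_sqr scalerA.
set j := _ * e; rewrite cint_e2pi_real.
have j0 : j != 0.
  rewrite /j mulf_neq0//; last by rewrite -normr_gt0 e1.
  by rewrite subr_eq0 eqr_nat eqn_pmul2l.
under eq_Rintegral do rewrite dotrv_scale_delta mulrA.
have i2 := nice_Im (nice_modul (j *: delta_mx 0 k) (@nice_box R d)).
rewrite boxr_cos; first last.
(* Because the steps are doubled, the required zero of the sine is read off from the imaginary part
   of [e2pi] at an integer. *)
- have : e2pi ((m%:R - n%:R) * e : R) = 1.
    have E : e2pi (m%:R - n%:R : R) = 1.
      by rewrite e2piD -e2piJ !e2pi_nat mul1r /conjc/= oppr0.
    have [->|->] : e = 1 \/ e = -1.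
      by case: (ger0P e) e1 => _ e1; [left|right]; rewrite -e1 ?opprK.
    + by rewrite mulr1.
    + by rewrite mulrN1 -e2piJ E /conjc/= oppr0.
  rewrite /e2pi => -[_]; congr (sin _ = 0); rewrite /j !natrM -mulrBr; lra.
- apply: mulf_neq0 j0; apply: mulf_neq0; first by rewrite pnatr_eq0.
  by apply: lt0r_neq0; exact: pi_gt0.
rewrite (@Rintegral_odd (fun t => sin (2 * pi * dotrv t (j *: delta_mx 0 k)) * boxr t))//.
- apply: measurable_funM; last exact: measurable_boxr.
  apply: (measurableT_comp (continuous_measurable_fun (@continuous_sin R))).
  apply: measurable_funM; first exact: measurable_cst.
  by apply: measurable_dotrv; [exact: measurable_id|exact: measurable_cst].
- by move=> t; rewrite boxrN dotrvNl mulrN sinN mulNr.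
- apply: eq_integrable i2 => // t _; congr (_%:E).
  by rewrite /modul /box Im_mul/= mulr0 add0r.
Qed.

End OverlapRow.

(** * Matrix elements *)

Section MatrixElements.
Local Open Scope classical_set_scope.
Local Open Scope complex_scope.
Context {R : realType} {d : nat}.
Local Notation mu := (@lebesgue_measure R).
Implicit Types (t x y w : 'rV[R]_d) (u v : 'rV[R]_d -> R).
Let pi0 : 0 < (pi : R) := @pi_gt0 R.

(** Only the central cube of side 1/2, of volume [2^-d], is kept. On it all bumps are bounded below
    by one constant, so the resulting bounds are uniform in [M]. *)
Lemma Rintegral_cube_ge (f : 'rV[R]_d -> R) (kap : R) : 0 <= kap ->
  (leb d).-integrable setT (EFin \o f) -> (forall t, 0 <= f t) ->
  (forall t, (forall k, `|4 * t 0 k| <= 1) -> kap <= f t) ->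
  kap * 2^-1 ^+ d <= \int[leb d]_t f t.
Proof.
move=> k0 fi f0 fk.
pose qd (x : R) : R := \1_(`]-4^-1, 4^-1[ : set R) x.
have mq : measurable_fun setT qd by exact: measurable_indic.
have iq : (\int[mu]_x (qd x)%:E = (2^-1)%:E)%E.
  rewrite /qd integral_indic// setIT [LHS]lebesgue_measure_itv/= lte_fin.
  rewrite ifT; last by lra.
  by rewrite -EFinD; congr (_%:E); lra.
pose g t := \prod_k qd (t 0 k).
have mg : measurable_fun setT g := @measurable_prodr R d (fun _ => qd) (fun _ => mq).
have g0 t : 0 <= g t by apply: prodr_ge0 => k _; rewrite /qd indicE.
have ig : (\int[leb d]_t (g t)%:E = (2^-1 ^+ d)%:E)%E.
  rewrite (@leb_prod_ge0 R d (fun _ => qd)) => [|_|_ x]; [|exact: mq|by rewrite /qd indicE].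
  by rewrite (eq_bigr (fun=> (2^-1)%:E)) // prodEFin prodr_const card_ord.
have gE t : kap * g t <= f t.
  have [h|] := pselect (forall k, `|4 * t 0 k| <= 1).
    apply: (le_trans _ (fk t h)); rewrite ler_piMr//; apply: prodr_ile1 => k _.
    by rewrite /qd indicE; case: (_ \in _); rewrite ?lexx ler01.
  move=> /existsNP[k hk]; rewrite /g (bigD1 k)//= {1}/qd indicE memNset ?mul0r ?mulr0//=.
  rewrite in_itv/= => /andP[h1 h2]; apply: hk.
  by rewrite ler_norml; apply/andP; split; lra.
have gi : (leb d).-integrable setT (EFin \o g).
  apply/integrableP; split; first exact/measurable_EFinP.
  by under eq_integral do rewrite /= ger0_norm//; rewrite ig ltry.
have -> : kap * 2^-1 ^+ d = \int[leb d]_t (kap * g t).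
  by rewrite RintegralZl// /Rintegral ig.
apply: le_Rintegral => //; exact: (integrableZl measurableT kap gi).
Qed.

Let int_of (f : 'rV[R]_d -> R) : nice (fun t => (f t)%:C) ->
  (leb d).-integrable setT (EFin \o f) := @nice_Re R d _.

Lemma gaus_cube (a : R) t : 0 < a -> (forall k, `|4 * t 0 k| <= 1) ->
  expR (- (a * d%:R)) <= gaus a t.
Proof.
move=> a0 h; rewrite ler_expR lerN2 ler_pM2l// /sqn.
apply: (@le_trans _ _ (\sum_(k < d) 1)); last by rewrite sumr_const card_ord.
by apply: ler_sum => k _; have := h k; rewrite ler_norml => /andP[? ?]; nra.
Qed.

Lemma gaus_mass_gt0 : 0 < @gaus_mass R d pi.
Proof.
have := @Rintegral_cube_ge (gaus pi) (expR (- (pi * d%:R))) (expR_ge0 _) (int_of (@nice_gau R d)).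
move=> /(_ (fun t => ltW (gaus_gt0 _ t)) (fun t => @gaus_cube _ t pi0)).
by apply: lt_le_trans; rewrite mulr_gt0 ?expR_gt0// exprn_gt0// invr_gt0.
Qed.

Lemma bumpr_cube M t : (forall k, `|4 * t 0 k| <= 1) -> expR (- d%:R) <= bumpr M t.
Proof.
move=> h; rewrite /bumpr -expR_sum ler_expR sumrN lerN2.
apply: (@le_trans _ _ (\sum_(k < d) 1)); last by rewrite sumr_const card_ord.
by apply: ler_sum => k _; exact: steep_le1.
Qed.

Definition gau_bump M : R := \int[leb d]_t (gaus pi t * bumpr M t).

Let nice_mulC u v : nice (fun t => (u t)%:C) -> nice (fun t => (v t)%:C) ->
  nice (fun t => (u t * v t)%:C).
Proof. by move=> nu nv; under eq_fun do rewrite rmorphM; exact: nice_mul. Qed.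

Lemma gau_bump_ge : exists2 c0 : R, 0 < c0 & forall M, c0 <= gau_bump M.
Proof.
exists ((expR (- (pi * d%:R)) * expR (- d%:R)) * 2^-1 ^+ d).
  by rewrite !mulr_gt0 ?expR_gt0// exprn_gt0// invr_gt0.
move=> M; apply: Rintegral_cube_ge.
- by rewrite mulr_ge0 ?expR_ge0.
- by apply: int_of; apply: nice_mulC; [exact: nice_gau|exact: nice_bump].
- by move=> t; rewrite mulr_ge0// ltW// ?gaus_gt0 ?bumpr_gt0.
- move=> t h.
  exact: ler_pM (expR_ge0 _) (expR_ge0 _) (gaus_cube pi0 h) (bumpr_cube M h).
Qed.

Definition overlap u v x y m n : R[i] :=
  cint (fun t => wave (fun t => (u t)%:C) x y m t * conjc (wave (fun t => (v t)%:C) x y n t)).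

Lemma overlapE u v x y m n : overlap u v x y m n =
  cint (fun t => e2pi (dotrv t ((m%:R - n%:R) *: y)) *
    (u (t - m%:R *: x) * v (t - n%:R *: x))%:C).
Proof. by rewrite /overlap; congr cint; apply/funext => t; exact: wave_conj_mul. Qed.

Section Overlap.
Variables u v : 'rV[R]_d -> R.
Hypotheses (nu : nice (fun t => (u t)%:C)) (nv : nice (fun t => (v t)%:C)).
Hypotheses (u0 : forall t, 0 <= u t) (v0 : forall t, 0 <= v t).

Lemma overlap_diag x y n : overlap u v x y n n = (\int[leb d]_t (u t * v t))%:C.
Proof.
rewrite overlapE; under eq_fun do rewrite subrr scale0r dotrv0r e2pi0 mul1r.
have [muv _] := nice_mulC nu nv.
apply: complexP => /=; last by rewrite /Rintegral integral0.
exact: (Rintegral_shift (- (n%:R *: x)) (proj1 muv)).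
Qed.

Lemma overlap_real x m n : exists2 g : R, 0 <= g & overlap u v x 0 m n = g%:C.
Proof.
exists (\int[leb d]_t (u (t - m%:R *: x) * v (t - n%:R *: x))).
  by apply: Rintegral_ge0 => t _; rewrite mulr_ge0.
rewrite overlapE; under eq_fun do rewrite scaler0 dotrv0r e2pi0 mul1r.
by apply: complexP => //=; rewrite /Rintegral integral0.
Qed.

(** With opposite frequency steps in the two variables, the product of their overlaps becomes a
    squared modulus and hence nonnegative. *)
Lemma overlap_conj y m n : overlap u v 0 (- y) m n = conjc (overlap u v 0 y m n).
Proof.
have cr (z : R) : conjc (z%:C) = z%:C by apply: complexP; rewrite /= ?oppr0.
rewrite !overlapE -cintJ; last first.
  by under eq_fun do rewrite !scaler0 !subr0; apply: nice_modul; exact: nice_mulC.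
congr cint; apply/funext => t; rewrite !scaler0 !subr0 conjcM cr e2piJ.
by rewrite scalerN dotrvNr.
Qed.

End Overlap.

(** In position, overlaps are integrals of positive functions; in frequency, they are values of the
    Fourier transform of a Gaussian, which is again a positive Gaussian. *)
Lemma gram_real x y m n : x = 0 \/ y = 0 ->
  exists2 g : R, 0 <= g & overlap (gaus pi) (gaus pi) x y m n = g%:C.
Proof.
case=> ->; last first.
  by apply: overlap_real => t; exact/ltW/gaus_gt0.
set w := (m%:R - n%:R) *: y.
exists (cosI w (gaus (2 * pi))).
  rewrite cosI_gaus ?mulr_gt0//; apply: mulr_ge0; last exact: expR_ge0.
  by apply: Rintegral_ge0 => t _; exact/ltW/gaus_gt0.
rewrite overlapE; under eq_fun do rewrite !scaler0 !subr0.
have E t : gaus pi t * gaus pi t = gaus (2 * pi) t.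
  by rewrite /gaus -expRD; congr expR; ring.
under eq_fun do rewrite E; rewrite cint_e2pi_real -/w.
have -> : \int[leb d]_t (sin (2 * pi * dotrv t w) * gaus (2 * pi) t) = 0.
  by apply: sinI_gaus; rewrite mulr_gt0.
by [].
Qed.

Definition gram_diag : R := \int[leb d]_t (gaus pi t * gaus pi t).

Lemma gram_diag_gt0 : 0 < gram_diag.
Proof.
have := @Rintegral_cube_ge (fun t => gaus pi t * gaus pi t) (expR (- (pi * d%:R)) ^+ 2) (sqr_ge0 _)
   (int_of (nice_mulC (@nice_gau R d) (@nice_gau R d))).
move=> H; apply: lt_le_trans (H _ _).
- by rewrite mulr_gt0 ?exprn_gt0 ?expR_gt0.
- by move=> t; rewrite mulr_ge0// ltW// gaus_gt0.
- by move=> t h; rewrite expr2; apply: ler_pM; rewrite ?expR_ge0 ?gaus_cube.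
Qed.

End MatrixElements.

(** * Lower bounds *)

Section Harmonic.
Local Open Scope classical_set_scope.
Context {R : realType}.

Lemma harmonic_unbounded (C : R) : ~ (forall N, \sum_(0 <= n < N) pw 1 (n%:R : R) <= C).
Proof.
move=> H; apply: (@dvg_harmonic R); apply: nondecreasing_is_cvgn.
  by apply: nondecreasing_series => n _ _; rewrite invr_ge0.
exists C => _ [N _ <-]; apply: le_trans (H N); rewrite /series/= le_eqVlt; apply/orP; left.
apply/eqP; apply: eq_bigr => n _.
by rewrite (pw_nat 1) expr1 ger0_norm// addrC natr1.
Qed.

End Harmonic.

Section SchattenLower.
Local Open Scope classical_set_scope.
Local Open Scope complex_scope.
Context {R : realType} {d : nat}.

Lemma schatten_norm_pinfty (T : ('rV[R]_d -> R[i]) -> ('rV[R]_d -> R[i])) (p r c : R) f g :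
  0 < p -> r * p <= 1 -> 0 < c -> orthonormal_seq f -> orthonormal_seq g ->
  (forall n : nat, c * pw r ((2 * n)%:R : R) <= cmod (L2dot (T (f n)) (g n))) ->
  schatten_norm p T = +oo%E.
Proof.
move=> p0 rp c0 of_ og H; apply/eqP; rewrite eq_le leey/= leNgt; apply/negP => fin.
set S := (\sum_(0 <= k <oo) ((cmod (L2dot (T (f k)) (g k))) `^ p)%:E)%E.
have Sfin : (S < +oo)%E.
  apply: (@lty_poweRy _ _ p^-1); first by rewrite invr_eq0 gt_eqF.
  apply: le_lt_trans fin; apply: ereal_sup_ubound.
  by exists f, g; split.
have t0 k : (0%R <= ((cmod (L2dot (T (f k)) (g k))) `^ p)%:E)%E by rewrite lee_fin powR_ge0.
have S0 : (0%R <= S)%E by apply: nneseries_ge0 => k _ _; exact: t0.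
have SE : S = (fine S)%:E by rewrite fineK// ge0_fin_numE.
have cp0 : 0 < c `^ p by exact: powR_gt0.
(* The 2 accounts for [1 + 2 n <= 2 (1 + n)]. *)
apply: (@harmonic_unbounded R (fine S / (c `^ p / 2))) => N.
rewrite ler_pdivlMr ?divr_gt0// mulr_suml -lee_fin -SE; apply: (le_trans _ (nneseries_lim_ge N (fun k _ _ => t0 k))).
rewrite sumEFin lee_fin; apply: ler_sum => n _.
apply: (@le_trans _ _ ((c * pw r ((2 * n)%:R : R)) `^ p)); last first.
  apply: ge0_ler_powR; rewrite ?nnegrE ?cmod_ge0 ?(ltW p0)//.
  by rewrite mulr_ge0 ?pw_ge0// ltW.
rewrite powRM ?pw_ge0 ?(ltW c0)//.
have -> : pw r ((2 * n)%:R : R) `^ p = pw (r * p) ((2 * n)%:R : R).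
  by rewrite /pw -powRrM mulNr.
rewrite mulrCA ler_wpM2l ?(ltW cp0)//; apply: le_trans (pw_anti _ rp).
rewrite !(pw_nat 1) !expr1 !ger0_norm// -invfM lef_pV2 ?posrE ?mulr_gt0 ?ltr_pwDl//.
by rewrite natrM; lra.
Qed.

End SchattenLower.

(** * Lower bounds for a bounded operator represented by the series *)

Section LowerBound.
Local Open Scope classical_set_scope.
Local Open Scope complex_scope.
Context {R : realType} {d : nat}.
Implicit Types (f g h : 'rV[R]_d -> R[i]).
Let pi0 : 0 < (pi : R) := @pi_gt0 R.

Lemma schwartz_gau : schwartz (@gau R d).
Proof.
have -> : @gau R d = gwave (fun=> 0) (fun t => pi * sqn t).
  by apply/funext => t; rewrite /gwave e2pi0 mul1r.
apply: (@schwartz_gwave _ _ _ _ _ _ pi 0) => // [||t]; last by rewrite subr0.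
- exact: polyf_cst.
- by apply: polyf_mul; [exact: polyf_cst|exact: polyf_sqn].
Qed.

Lemma schwartz_wave_gau (x y : 'rV[R]_d) n : schwartz (wave (@gau R d) x y n).
Proof.
set a := n%:R *: x; set xi := n%:R *: y.
have -> : wave (@gau R d) x y n = gwave (fun t => dotrv t xi) (fun t => pi * sqn (t - a)).
  by [].
(* The constants come from [(t - a)^2 - t^2 / 2 + a^2 = (t - 2 a)^2 / 2 >= 0] in each coordinate. *)
apply: (@schwartz_gwave _ _ _ _ _ _ (pi / 2) (pi * sqn a)).
- by apply: polyf_sum => k; apply: polyf_mul; [exact: polyf_coord|exact: polyf_cst].
- apply: polyf_mul; [exact: polyf_cst|apply: polyf_sum => k; apply: polyf_exp].
  under eq_fun do rewrite mxE mxE.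
  by apply: polyf_add; [exact: polyf_coord|exact: polyf_cst].
- by rewrite divr_gt0.
move=> t; rewrite -mulrA -mulrBr ler_pM2l// -subr_ge0 /sqn mulr_sumr -!sumrB.
apply: sumr_ge0 => k _; rewrite mxE mxE.
by have := sqr_ge0 (t 0 k - 2 * a 0 k); nra.
Qed.

Lemma conj_wave (v : 'rV[R]_d -> R) x y n t :
  conjc (wave (fun t => (v t)%:C) x y n t) = wave (fun t => (v t)%:C) x (- y) n t.
Proof.
have cr (z : R) : conjc (z%:C) = z%:C by apply: complexP; rewrite /= ?oppr0.
by rewrite /wave /modul conjcM e2piJ /transl cr scalerN dotrvNr.
Qed.

Variables (T : ('rV[R]_d -> R[i]) -> ('rV[R]_d -> R[i])) (r mass : R).
Variables (x y x' y' : 'rV[R]_d).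
Hypotheses (bT : L2_bounded_op T) (r0 : 0 <= r) (mass0 : 0 < mass).
Hypothesis xy1 : (exists i, `|x 0 i| = 1) \/ (exists i, `|y 0 i| = 1).

Let term f g m : R[i] := (mass * pw r (m%:R : R))%:C *
  (cint (fun t => wave (@gau R d) x y m t * conjc (g t)) *
   cint (fun t => wave (@gau R d) x' y' m t * f t)).

Hypothesis HT : forall f g, schwartz f -> schwartz g ->
  L2dot (T f) g = csum (term f g).

(** Summability comes from the first variable, which moves by [xy1]. The second integral is only
    bounded and is merged into the coefficient, as [x'] and [y'] may both be zero. *)
Let asum_term f g : schwartz f -> schwartz g -> exists S, asum (term f g) S.
Proof.
move=> sf sg.
pose c m := (mass * pw r (m%:R : R))%:C * cint (fun t => wave (@gau R d) x' y' m t * f t).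
have E : term f g = (fun m => c m * cint (fun t => wave (@gau R d) x y m t * conjc (g t))).
  by apply/funext => m; rewrite /term /c; ring.
have cA m : cmod (c m) <= mass * (8 * @me_cst R d * sem (d * 6) (@gau R d) * sem (d * 6) f).
  rewrite cmodM; apply: ler_pM; rewrite ?cmod_ge0//.
    rewrite cmodr ger0_norm; last by apply: mulr_ge0; [exact: ltW|exact: pw_ge0].
    by apply: ler_piMr; [exact: ltW|exact: pw_le1].
  apply: (le_trans (modul_transl_decay _ _ schwartz_gau sf)).
  apply: ler_piMr; last by apply: mulr_ile1; rewrite ?wt_ge0 ?wt_le1.
  apply: mulr_ge0; last exact: sem_ge0.
  by apply: mulr_ge0; [apply: mulr_ge0; [|exact: me_cst_ge0]|exact: sem_ge0].
by rewrite E; eexists; exact: (wave_asum schwartz_gau cA xy1 (schwartz_conj sg)).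
Qed.

Let Re_le_cmod (z : R[i]) : complex.Re z <= cmod z.
Proof. exact: le_trans (ler_norm _) (cmod_Re z). Qed.

Let term_Re m (a : R[i]) :
  complex.Re ((mass * pw r (m%:R : R))%:C * a) = mass * pw r (m%:R : R) * complex.Re a.
Proof. by rewrite Re_mul/= mul0r subr0. Qed.

(** The kernel acts bilinearly, so the function matched to its second factor is the conjugate wave,
    with frequency [- y']. For bumps all terms of the series have nonnegative real part, and the
    term of index [2 n] gives a bound uniform in [M], which survives the passage to boxes. *)
Lemma box_lower :
  (y = 0 /\ y' = 0) \/ [/\ x = 0, x' = 0 & y' = - y] ->
  exists2 c : R, 0 < c & forall n : nat, c * pw r ((2 * n)%:R : R) <=
    cmod (L2dot (T (wave box x' (- y') (2 * n))) (wave box x y (2 * n))).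
Proof.
move=> DC; have [c0 c00 Hc] := @gau_bump_ge R d.
exists (mass * c0 ^+ 2) => [|n]; first by rewrite mulr_gt0// exprn_gt0.
have [B B0 HB] := L2_bounded_sqnorm bT.
pose fM M := wave (cbump M) x' (- y') (2 * n); pose gM M := wave (cbump M) x y (2 * n).
set f := wave box x' _ _; set g := wave box x y _.
have low M : mass * c0 ^+ 2 * pw r ((2 * n)%:R : R) <= cmod (L2dot (T (fM M)) (gM M)).
  have sf : schwartz (fM M) by exact: schwartz_bump.
  have sg : schwartz (gM M) by exact: schwartz_bump.
  apply: le_trans (Re_le_cmod _); rewrite HT//; have [S aS] := asum_term sf sg.
  pose ov := overlap (@gaus R d pi) (bumpr M).
  have tE m : term (fM M) (gM M) m =
      (mass * pw r (m%:R : R))%:C * (ov x y m (2 * n)%N * ov x' y' m (2 * n)%N).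
    rewrite /term /ov /overlap; congr (_ * (_ * cint _)).
    by apply/funext => t; rewrite conj_wave.
  have ng := @nice_gau R d; have nb := @nice_bump R d M.
  have g0 (t : 'rV[R]_d) : 0 <= gaus pi t by exact/ltW/gaus_gt0.
  have b0 (t : 'rV[R]_d) : 0 <= bumpr M t by exact/ltW/bumpr_gt0.
  have ov0 m : 0 <= complex.Re (ov x y m (2 * n)%N * ov x' y' m (2 * n)%N).
    case: DC => [[-> ->]|[-> -> ->]].
      have [a a0 Ea] := overlap_real g0 b0 x m (2 * n).
      have [a' a'0 Ea'] := overlap_real g0 b0 x' m (2 * n).
      by rewrite /ov Ea Ea' -rmorphM/= mulr_ge0.
    rewrite /ov (overlap_conj ng nb) Re_mul Re_conjc Im_conjc mulrN opprK.
    by rewrite addr_ge0// -expr2 sqr_ge0.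
  have t0 m : 0 <= complex.Re (term (fM M) (gM M) m).
    by rewrite tE term_Re mulr_ge0// mulr_ge0 ?pw_ge0// ltW.
  (* The partial sum must reach the diagonal term, whose index is [2 * n]. *)
  apply: le_trans (csum_Re_ge (2 * n).+1 aS t0).
  rewrite big_nat_recr// -[leLHS]add0r; apply: lerD; first by apply: sumr_ge0 => m _; exact: t0.
  rewrite tE term_Re /ov !(overlap_diag ng nb) -rmorphM/= mulrAC ler_wpM2l//.
    by rewrite mulr_ge0 ?pw_ge0// ltW.
  have := Hc M; rewrite /gau_bump => h; rewrite expr2; apply: ler_pM => //; exact: ltW.
apply/ler_addgt0Pr => eta eta0.
have nf : nice f by apply: nice_modul; apply: nice_transl; exact: nice_box.
have ng : nice g by apply: nice_modul; apply: nice_transl; exact: nice_box.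
have nfM M : nice (fM M) by apply: nice_modul; apply: nice_transl; exact: nice_bump.
have ngM M : nice (gM M) by apply: nice_modul; apply: nice_transl; exact: nice_bump.
set Q := sqnorm g + B * @domK R d.
have K0 : 0 <= @domK R d by apply: Rintegral_ge0 => t _; exact: sqr_ge0.
have Q0 : 0 <= Q by rewrite addr_ge0 ?sqnorm_ge0// mulr_ge0.
(* The error allowed by [L2dot_approx] is split in halves: [l] makes [Q / l] at most [eta / 2], and
   then [eps] makes [l (B + 1) eps] equal to [eta / 2]. *)
pose l := 2 * (Q + 1) / eta.
have l0 : 0 < l by rewrite /l divr_gt0// mulr_gt0//; lra.
have lE : l = 2 * (Q + 1) / eta by [].
clearbody l.
pose eps := eta / (2 * l * (B + 1)).
have den : 0 < 2 * l * (B + 1) by rewrite !mulr_gt0//; lra.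
have eps0 : 0 < eps by rewrite /eps divr_gt0.
have [M HM] := bump_approx (d := d) eps0.
have sub (u v : 'rV[R]_d) : sqnorm (fun t => wave (cbump M) u v (2 * n) t - wave box u v (2 * n) t) <= eps.
  have nd : nice (fun t : 'rV[R]_d => cbump M t - box t).
    have := niceD (nice_bump M) (niceZ (-1) (@nice_box R d)).
    by under eq_fun do rewrite mulN1r.
  apply: le_trans HM.
  have := @sqnorm_modul_transl R d ((2 * n)%:R *: u) ((2 * n)%:R *: v)
    (fun t => cbump M t - box t) (proj1 nd) => <-.
  rewrite le_eqVlt; apply/orP; left; apply/eqP; congr sqnorm; apply/funext => t.
  by rewrite /wave /modul /transl mulrBr.
apply: (le_trans (low M)); apply: (le_trans (L2dot_approx bT B0 HB nf (nfM M) ng (ngM M) l0)).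
have h1 : sqnorm (fun t => fM M t - f t) <= eps := sub x' (- y').
have h2 : sqnorm (fun t => gM M t - g t) <= eps := sub x y.
have h3 : sqnorm (fM M) <= @domK R d.
  by rewrite /fM /wave (@sqnorm_modul_transl R d _ _ _ (proj1 (nice_bump M))) sqnorm_bump_le.
have e1 : l * (B * sqnorm (fun t => fM M t - f t)) <= l * (B * eps).
  by apply: ler_wpM2l (ltW l0) _ _ _; apply: ler_wpM2l B0 _ _ h1.
have e2 : l * sqnorm (fun t => gM M t - g t) <= l * eps := ler_wpM2l (ltW l0) h2.
have e3 : sqnorm g / l + B * sqnorm (fM M) / l <= Q / l.
  by rewrite -mulrDl ler_wpM2r ?invr_ge0 ?(ltW l0)// lerD2l ler_wpM2l.
have e4 : l * (B * eps) + l * eps = eta / 2.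
  have E : eps * (2 * l * (B + 1)) = eta by rewrite /eps divfK// gt_eqF.
  by rewrite -E; field.
have e5 : Q / l <= eta / 2.
  rewrite ler_pdivrMr// lE; have -> : eta / 2 * (2 * (Q + 1) / eta) = Q + 1.
    by field; rewrite gt_eqF.
  by rewrite lerDl ler01.
apply: (le_trans (lerD (lerD (lexx _) (lerD e1 (lexx _))) (lerD e2 (lexx _)))).
rewrite -addrA lerD2l addrACA e4 [leRHS]splitr lerD2l.
exact: le_trans e3 e5.
Qed.

Let wg n := wave (@gau R d) x y n.

(** The partial sums of the critical series of Gaussians. The base case is the zero function,
    written as a combination of Gaussians so that [schwartz_lin] applies. *)
Fixpoint packet N : 'rV[R]_d -> R[i] :=
  if N is n.+1 then fun t => (pw r (n%:R : R))%:C * wg n t + packet n t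
  else fun t => -1 * @gau R d t + @gau R d t.

Lemma schwartz_packet N : schwartz (packet N).
Proof.
elim: N => [|N IH]; first by apply: schwartz_lin; exact: schwartz_gau.
by apply: schwartz_lin => //; exact: schwartz_wave_gau.
Qed.

Let packet0 t : packet 0 t = 0.
Proof. by rewrite /= mulN1r addNr. Qed.

Let cint0 : cint (fun _ : 'rV[R]_d => 0) = 0 :> R[i].
Proof. by apply: complexP; rewrite /= /Rintegral integral0. Qed.

Let nice_wg n : nice (wg n).
Proof. by apply: schwartz_nice; exact: schwartz_wave_gau. Qed.

Lemma cint_packet h N : nice h ->
  cint (fun t => packet N t * h t) =
  \sum_(0 <= n < N) (pw r (n%:R : R))%:C * cint (fun t => wg n t * h t).
Proof.
move=> nh; elim: N => [|N IH].
  rewrite big_geq//; under eq_fun do rewrite packet0 mul0r; exact: cint0.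
rewrite big_nat_recr//= -IH addrC -cintZ; last exact: nice_mul.
rewrite -cintD; last 2 first.
- by apply: niceZ; exact: nice_mul.
- by apply: nice_mul => //; apply: schwartz_nice; exact: schwartz_packet.
by congr cint; apply/funext => t; rewrite mulrDl mulrA.
Qed.

Lemma cint_packet_conj h N : nice h ->
  cint (fun t => h t * conjc (packet N t)) =
  \sum_(0 <= n < N) (pw r (n%:R : R))%:C * cint (fun t => h t * conjc (wg n t)).
Proof.
move=> nh; elim: N => [|N IH].
  rewrite big_geq//; under eq_fun do rewrite packet0; rewrite (_ : (fun t => _) = fun=> 0).
    exact: cint0.
  by apply/funext => t; apply: complexP; rewrite ?Re_mul ?Im_mul/= ?oppr0 !mulr0 ?subrr ?addr0.
rewrite big_nat_recr//= -IH addrC -cintZ; last by apply: nice_mul => //; exact: niceJ (nice_wg _).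
have cr (z : R) : conjc (z%:C) = z%:C by apply: complexP; rewrite /= ?oppr0.
have cD (z w : R[i]) : conjc (z + w) = conjc z + conjc w by exact: rmorphD.
rewrite -cintD; last 2 first.
- by apply: niceZ; apply: nice_mul => //; exact: niceJ (nice_wg _).
- by apply: nice_mul => //; apply: niceJ; apply: schwartz_nice; exact: schwartz_packet.
by congr cint; apply/funext => t; rewrite cD conjcM cr mulrDr mulrCA.
Qed.

(** The image of the fixed Gaussian is tested against [packet N]. Its squared norm is [S N], and up
    to a constant factor [S N] is also a lower bound for the matrix element; so a bounded operator
    keeps [S N] bounded. The diagonal of the Gram matrix then bounds the sum of squared
    coefficients. *)
Lemma gau_lower : x' = 0 -> y' = 0 -> x = 0 \/ y = 0 ->
  exists C : R, forall N, \sum_(0 <= n < N) pw r (n%:R : R) ^+ 2 <= C.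
Proof.
move=> x'0 y'0 xy0; set Q := @gram_diag R d.
have Q0 : 0 < Q := @gram_diag_gt0 R d.
have ng := @nice_gau R d.
pose G m n := complex.Re (overlap (@gaus R d pi) (gaus pi) x y m n).
have HG m n : 0 <= G m n /\ overlap (@gaus R d pi) (gaus pi) x y m n = (G m n)%:C.
  by rewrite /G; have [g g0 ->] := gram_real m n xy0.
have Gd n : G n n = Q.
  have [_ E] := HG n n; rewrite (overlap_diag ng ng) in E.
  by have := congr1 (@complex.Re R) E.
have a0 n : 0 <= pw r (n%:R : R) by exact: pw_ge0.
pose S N := \sum_(0 <= m < N) pw r (m%:R : R) * \sum_(0 <= n < N) pw r (n%:R : R) * G m n.
have cG m n : cint (fun t => wg m t * conjc (wg n t)) = (G m n)%:C by have [_ <-] := HG m n.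
have cS N m : cint (fun t => wg m t * conjc (packet N t)) =
    (\sum_(0 <= n < N) pw r (n%:R : R) * G m n)%:C.
  rewrite cint_packet_conj// raddf_sum; apply: eq_bigr => n _.
  by rewrite cG -rmorphM.
have G0 m n : 0 <= pw r (n%:R : R) * G m n by have [? _] := HG m n; exact: mulr_ge0.
have SE N : sqnorm (packet N) = S N.
  have np : nice (packet N) by apply: schwartz_nice; exact: schwartz_packet.
  have := cint_packet N (niceJ np).
  under eq_bigr do rewrite cS -rmorphM; rewrite -raddf_sum -/(S N) => E.
  have := congr1 (@complex.Re R) E => /= <-; rewrite /sqnorm; apply: eq_Rintegral => t _.
  rewrite Re_mul Re_conjc Im_conjc mulrN opprK.
  by case: (packet N t) => a b /=; rewrite sqr_sqrtr ?addr_ge0 ?sqr_ge0// !expr2.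
have low N : mass * Q * S N <= cmod (L2dot (T (@gau R d)) (packet N)).
  have sp := schwartz_packet N; have [A aS] := asum_term schwartz_gau sp.
  apply: le_trans (Re_le_cmod _); rewrite (HT schwartz_gau sp).
  have tE m : term (@gau R d) (packet N) m =
      (mass * pw r (m%:R : R))%:C * (((\sum_(0 <= n < N) pw r (n%:R : R) * G m n) * Q)%:C).
    rewrite /term -/(wg m) cS [(_ * Q)%:C]rmorphM; congr (_ * (_ * _)).
    transitivity (overlap (@gaus R d pi) (gaus pi) 0 0 0%N 0%N); last exact: (overlap_diag ng ng).
    rewrite /overlap x'0 y'0; congr cint; apply/funext => t.
    rewrite /wave /modul /transl !scaler0 !dotrv0r !e2pi0 !mul1r subr0 -/(gau t).
    by congr (_ * _); apply: complexP; rewrite /= ?oppr0.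
  have t0 m : 0 <= complex.Re (term (@gau R d) (packet N) m).
    rewrite tE term_Re/= mulr_ge0 ?mulr_ge0 ?(ltW Q0) ?(ltW mass0)//.
    exact: sumr_ge0.
  apply: le_trans (csum_Re_ge N aS t0).
  rewrite le_eqVlt; apply/orP; left; apply/eqP; rewrite /S mulr_sumr; apply: eq_bigr => m _.
  by rewrite tE term_Re/=; ring.
have [TL _ _] := bT.
have Lg : L2 (T (@gau R d)) by apply: TL; exact: nice_L2.
set K := mass * Q; have K0 : 0 < K by exact: mulr_gt0.
set W := sqnorm (T (@gau R d)).
exists (W * 4 / K ^+ 2 / Q) => N.
(* With [l = 2 / K] the term [S N / l] is half of [K * S N] and can be absorbed on the left, leaving
   [S N <= 4 W / K^2]. *)
have l0 : 0 < 2 / K by exact: divr_gt0.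
have Lp : L2 (packet N) by apply: nice_L2; apply: schwartz_nice; exact: schwartz_packet.
have := le_trans (low N) (L2dot_le Lg Lp l0); rewrite SE -/K -/W => H.
have S1 : Q * \sum_(0 <= n < N) pw r (n%:R : R) ^+ 2 <= S N.
  rewrite mulr_sumr /S big_nat [leRHS]big_nat; apply: ler_sum => m /= mN.
  rewrite expr2 mulrCA ler_wpM2l// mulrC -(Gd m).
  rewrite (bigD1_seq m)/= ?mem_index_iota ?iota_uniq// lerDl.
  exact: sumr_ge0.
have S2 : S N <= W * 4 / K ^+ 2.
  have Kn : K != 0 by rewrite gt_eqF.
  have E1 : S N / (2 / K) = K * S N / 2 by field.
  have H2 : K * S N / 2 <= 2 / K * W by rewrite E1 in H; lra.
  rewrite ler_pdivlMr ?exprn_gt0//.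
  have := ler_wpM2r (ltW (mulr_gt0 (ltr0n R 2) K0)) H2.
  rewrite (_ : K * S N / 2 * (2 * K) = S N * K ^+ 2); last by field.
  by rewrite (_ : 2 / K * W * (2 * K) = W * 4)//; field.
by rewrite ler_pdivlMr// mulrC (le_trans S1).
Qed.

End LowerBound.

(** * Counterexamples *)

Section Symbol.
Local Open Scope classical_set_scope.
Local Open Scope complex_scope.
Context {R : realType} {d : nat}.
Implicit Types (f g : 'rV[R]_d -> R[i]) (F : 'rV[R]_(d + d) -> R[i]).
Let mass : R := @gaus_mass R d pi.

Lemma nice_tensor f g : nice f -> nice g -> nice (tensor f g).
Proof.
move=> nf ng; have [C C0 HC] := nice_bound nf; have [D D0 HD] := nice_bound ng.
have [[mf _] [mg _]] := (nf, ng); split.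
  apply: cmeasM; first exact: (cmeas_comp mf (@measurable_lsub R d d)).
  exact: (cmeas_comp mg (@measurable_rsub R d d)).
exists (C * D) => z; rewrite /tensor cmodM -{3}[z]hsubmxK wt_row_mx mulrACA.
by apply: ler_pM; rewrite ?cmod_ge0.
Qed.

Lemma cint_tensor f g : nice f -> nice g -> cint (tensor f g) = cint f * cint g.
Proof.
move=> nf ng; rewrite cint_split; last exact: nice_tensor.
rewrite [RHS]mulrC -cintZ//; congr cint; apply/funext => x.
rewrite mulrC -cintZ//; congr cint; apply/funext => y.
by rewrite /tensor row_mxKl row_mxKr.
Qed.

Section Fixed.
Variables (r : R) (x1 x2 y1 y2 : 'rV[R]_d).
Hypotheses (r0 : 0 <= r) (xy1 : dotrv x1 y2 = 0) (xy2 : dotrv x2 y2 = 0).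

(* [(x1, y1)] and [(x2, y2)] are the phase-space steps of the two variables of
   the kernel; the symbol is the matching sum of chirped Gaussians. *)
Definition osc_symbol : ('rV[R]_(d + d) -> R[i]) -> R[i] :=
  wavef (fun n => (pw r (n%:R : R))%:C) (@The R d)
    (row_mx x1 (- y2)) (row_mx (y1 + y2) (x2 - x1)).

Definition osc_kernel : ('rV[R]_(d + d) -> R[i]) -> R[i] :=
  wavef (fun n => (mass * pw r (n%:R : R))%:C) (@Gam R d) (row_mx x1 x2) (row_mx y1 y2).

Let wave_Gam n : wave (@Gam R d) (row_mx x1 x2) (row_mx y1 y2) n =
  kernel_term (n%:R *: x1) (n%:R *: x2) (n%:R *: y1) (n%:R *: y2).
Proof. by rewrite kernel_termE /wave !scale_row_mx. Qed.

(** Term by term this is [kn_term]; the two orthogonality hypotheses remove the phases given by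
    [x1.y2] and [x2.y2]. *)
Lemma kn_kernel_osc F : nice F -> kn_kernel osc_symbol F = osc_kernel F.
Proof.
move=> nF; rewrite /kn_kernel /dist_compN /dist_F2inv /osc_symbol /osc_kernel /wavef.
congr csum; apply/funext => n.
have z a : dotrv a y2 = 0 -> dotrv (n%:R *: a) (n%:R *: y2) = 0.
  by move=> e; rewrite dotrvZl dotrvZr e !mulr0.
have -> : wave (@The R d) (row_mx x1 (- y2)) (row_mx (y1 + y2) (x2 - x1)) n =
    symbol_term (n%:R *: x1) (n%:R *: x2) (n%:R *: y1) (n%:R *: y2).
  rewrite symbol_termE; last exact: z xy1.
  by rewrite /wave !scale_row_mx scalerN scalerDr scalerBr.
rewrite (@kn_term R d F _ _ _ _ nF (z _ xy2)) wave_Gam mulrA.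
by rewrite -rmorphM/= [mass * _]mulrC.
Qed.

Lemma osc_kernel_tensor f g : nice f -> nice g -> osc_kernel (tensor g f) =
  csum (fun n => (mass * pw r (n%:R : R))%:C *
    (cint (fun t => wave (@gau R d) x1 y1 n t * g t) *
     cint (fun t => wave (@gau R d) x2 y2 n t * f t))).
Proof.
move=> nf ng; rewrite /osc_kernel /wavef; congr csum; apply/funext => n.
have nw x y : nice (wave (@gau R d) x y n) by apply: schwartz_nice; exact: schwartz_wave_gau.
rewrite -cint_tensor; last 2 first.
- exact: nice_mul.
- exact: nice_mul.
congr (_ * cint _); apply/funext => z; rewrite wave_Gam /kernel_term /tensor /wave.
by rewrite mulrACA.
Qed.

Lemma pairing_psido_osc f g : schwartz f -> schwartz g ->
  pairing (psido osc_symbol f) g = csum (fun n => (mass * pw r (n%:R : R))%:C *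
    (cint (fun t => wave (@gau R d) x1 y1 n t * conjc (g t)) *
     cint (fun t => wave (@gau R d) x2 y2 n t * f t))).
Proof.
move=> sf sg; have nf := schwartz_nice sf; have ng := niceJ (schwartz_nice sg).
exact: etrans (kn_kernel_osc (nice_tensor ng nf)) (osc_kernel_tensor nf ng).
Qed.

Let pwC n : cmod ((pw r (n%:R : R))%:C) <= 1.
Proof. by rewrite cmodr ger0_norm ?pw_ge0// pw_le1. Qed.

Let mass0 : 0 < mass := @gaus_mass_gt0 R d.

Let mpwC n : cmod ((mass * pw r (n%:R : R))%:C) <= mass * pw r (n%:R : R).
Proof. by rewrite cmodr ger0_norm// mulr_ge0 ?pw_ge0// ltW. Qed.

Lemma tempered_osc_symbol i : `|row_mx (row_mx x1 (- y2)) (row_mx (y1 + y2) (x2 - x1)) 0 i| = 1 ->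
  tempered osc_symbol.
Proof.
move=> vi; apply: (wavef_tempered (@schwartz_The R d) pwC).
move: vi; case: (split_ordP i) => j ->; rewrite ?row_mxEl ?row_mxEr => vj.
- by left; exists j.
- by right; exists j.
Qed.

(** [kn_kernel osc_symbol] is compared with [osc_kernel] on [nice] functions. Temperedness
    constrains values on Schwartz functions only, so it carries over. *)
Lemma tempered_kn_osc i : `|row_mx (row_mx x1 x2) (row_mx y1 y2) 0 i| = 1 ->
  tempered (kn_kernel osc_symbol).
Proof.
move=> vi; have [L B] : tempered osc_kernel.
  apply: (wavef_tempered (@schwartz_Gam R d) (A := mass)) => [n|].
    by apply: (le_trans (mpwC n)); rewrite ler_piMr ?pw_le1// ltW.
  move: vi; case: (split_ordP i) => j ->; rewrite ?row_mxEl ?row_mxEr => vj.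
  - by left; exists j.
  - by right; exists j.
have E F : schwartz F -> kn_kernel osc_symbol F = osc_kernel F.
  by move=> sF; apply: kn_kernel_osc; exact: schwartz_nice.
split=> [a f g sf sg|]; first by rewrite !E ?L//; exact: schwartz_lin.
by have [C [N H]] := B; exists C, N => f sf; rewrite E// H.
Qed.

Section Norm.
Variables (phi : 'rV[R]_(d + d) -> R[i]) (s : R).
Variables (q : 'I_((d + d) + (d + d)) -> \bar R) (c : 'S_((d + d) + (d + d))).
Hypotheses (sphi : schwartz phi) (r1 : r <= 1) (s0 : s <= 0).
Hypothesis (q2 : forall k, decay_ok 2 (q k)).
Variables i j : 'I_((d + d) + (d + d)).
Hypotheses (ij : i != j) (qi : decay_ok (r - s) (q (c i))).

Lemma modulation_norm_osc_symbol
  (v := row_mx (row_mx x1 (- y2)) (row_mx (y1 + y2) (x2 - x1))) :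
  `|v 0 i| = 1 -> v 0 j = 0 \/ `|v 0 j| = 1 ->
  (forall k, k != i -> k != j -> v 0 k = 0) -> (v 0 j != 0 -> (c j < c i)%N) ->
  in_modulation phi c q (weight s) osc_symbol.
Proof.
move=> vi vj v0 cij; split; first exact: tempered_osc_symbol vi.
apply: (wave_modulation_norm (@schwartz_The R d) sphi ij vi vj v0 r0 r1 ler01) => // n.
by rewrite mul1r cmodr ger0_norm ?pw_ge0.
Qed.

Lemma modulation_norm_osc_kernel (v := row_mx (row_mx x1 x2) (row_mx y1 y2)) :
  `|v 0 i| = 1 -> v 0 j = 0 \/ `|v 0 j| = 1 ->
  (forall k, k != i -> k != j -> v 0 k = 0) -> (v 0 j != 0 -> (c j < c i)%N) ->
  in_modulation phi c q (weight s) (kn_kernel osc_symbol).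
Proof.
move=> vi vj v0 cij; split; first exact: tempered_kn_osc vi.
have gE z : gabor phi (kn_kernel osc_symbol) z = gabor phi osc_kernel z.
  apply: kn_kernel_osc; apply: niceJ; apply: nice_modul.
  by apply: nice_transl; exact: schwartz_nice.
rewrite /modulation_norm; under eq_fun do rewrite gE.
exact: (wave_modulation_norm (@schwartz_Gam R d) sphi ij vi vj v0 r0 r1 (ltW mass0) mpwC).
Qed.

End Norm.

Section NotSchatten.
Variables (p : R) (k : 'I_d).
Hypothesis p0 : 0 < p.
Let ek : 'rV[R]_d := delta_mx 0 k.

Let xy_unit (x y : 'rV[R]_d) : x = ek \/ y = ek ->
  (exists i, `|x 0 i| = 1) \/ (exists i, `|y 0 i| = 1).
Proof. by case=> ->; [left|right]; exists k; rewrite mxE !eqxx normr1. Qed.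

(** The factor [a] lets the second variable move faster: [a = 1] makes the symbol frequency
    [x2 - x1] vanish, [a = 2] makes it move at unit speed. *)
Lemma not_schatten_time (a : R) : r * p <= 1 -> 1 <= `|a| ->
  x1 = ek -> x2 = a *: ek -> y1 = 0 -> y2 = 0 -> ~ in_schatten p (psido osc_symbol).
Proof.
move=> rp a1 e1 e2 e3 e4 [T [bT HT]].
have H f g : schwartz f -> schwartz g -> L2dot (T f) g = _ :=
  fun sf sg => etrans (HT f g sf sg) (pairing_psido_osc sf sg).
have [c c0 low] := box_lower bT r0 mass0 (xy_unit (or_introl e1)) H (or_introl (conj e3 e4)).
have o1 : orthonormal_seq (fun n => wave box x2 (- y2) (2 * n)).
  apply: (@orthonormal_wave_box R d _ _ k); left; rewrite e2 e4 oppr0; split=> //.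
  by rewrite !mxE !eqxx mulr1.
have o2 : orthonormal_seq (fun n => wave box x1 y1 (2 * n)).
  apply: (@orthonormal_wave_box R d _ _ k); left; rewrite e1 e3; split=> //.
  by rewrite !mxE !eqxx normr1.
by rewrite (schatten_norm_pinfty p0 rp c0 o1 o2 low).
Qed.

(** The opposite signs of [y1] and [y2] turn the products of overlaps into squared moduli, and also
    cancel the component [y1 + y2] of the symbol. *)
Lemma not_schatten_freq : r * p <= 1 ->
  x1 = 0 -> x2 = 0 -> y1 = ek -> y2 = - ek -> ~ in_schatten p (psido osc_symbol).
Proof.
move=> rp e1 e2 e3 e4 [T [bT HT]].
have H f g : schwartz f -> schwartz g -> L2dot (T f) g = _ :=
  fun sf sg => etrans (HT f g sf sg) (pairing_psido_osc sf sg).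
have DC : [/\ x1 = 0, x2 = 0 & y2 = - y1] by rewrite e1 e2 e3 e4.
have [c c0 low] := box_lower bT r0 mass0 (xy_unit (or_intror e3)) H (or_intror DC).
have oE : exists2 e : R, `|e| = 1 & ek = e *: delta_mx 0 k.
  by exists 1; rewrite ?normr1// scale1r.
have o1 : orthonormal_seq (fun n => wave box x2 (- y2) (2 * n)).
  by apply: (@orthonormal_wave_box R d _ _ k); right; rewrite e2 e4 opprK.
have o2 : orthonormal_seq (fun n => wave box x1 y1 (2 * n)).
  by apply: (@orthonormal_wave_box R d _ _ k); right; rewrite e1 e3.
by rewrite (schatten_norm_pinfty p0 rp c0 o1 o2 low).
Qed.

(** For [r = 1/2] the squared coefficients are harmonic, so boundedness on L^2 already fails. *)
Lemma not_schatten_gau : r = 2^-1 -> x2 = 0 -> y2 = 0 ->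
  (x1 = ek /\ y1 = 0) \/ (x1 = 0 /\ y1 = ek) -> ~ in_schatten p (psido osc_symbol).
Proof.
move=> rE e2 e4 e13 [T [bT HT _]].
have H f g : schwartz f -> schwartz g -> L2dot (T f) g = _ :=
  fun sf sg => etrans (HT f g sf sg) (pairing_psido_osc sf sg).
have u : x1 = ek \/ y1 = ek by case: e13 => -[]; [left|right].
have z : x1 = 0 \/ y1 = 0 by case: e13 => -[]; [right|left].
have [C HC] := gau_lower bT r0 mass0 (xy_unit u) H e2 e4 z.
apply: (@harmonic_unbounded R C) => N; apply: le_trans (HC N).
rewrite le_eqVlt; apply/orP; left; apply/eqP; apply: eq_bigr => n _.
by rewrite expr2 -pwD rE; congr (pw _ _); lra.
Qed.

End NotSchatten.

End Fixed.

End Symbol.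

(** * The order of integration imposed by a slice permutation *)

Section Indices.
Local Open Scope classical_set_scope.
Context {R : realType} {d : nat}.
Implicit Types (k l : 'I_d) (i j : 'I_((d + d) + (d + d))).

(* Coordinates of the Gabor transform of a function of two variables: the
   positions of both variables come first, then their frequencies. *)
Definition pos1 k : 'I_((d + d) + (d + d)) := lshift (d + d) (lshift d k).
Definition pos2 k : 'I_((d + d) + (d + d)) := lshift (d + d) (rshift d k).
Definition freq1 k : 'I_((d + d) + (d + d)) := rshift (d + d) (lshift d k).
Definition freq2 k : 'I_((d + d) + (d + d)) := rshift (d + d) (rshift d k).

Lemma index_split (P : 'I_((d + d) + (d + d)) -> Prop) :
  (forall k, P (pos1 k)) -> (forall k, P (pos2 k)) ->
  (forall k, P (freq1 k)) -> (forall k, P (freq2 k)) -> forall i, P i.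
Proof.
move=> h1 h2 h3 h4 i.
case: (split_ordP i) => j ->; case: (split_ordP j) => k ->.
- exact: h1.
- exact: h2.
- exact: h3.
- exact: h4.
Qed.

Definition row4 (x1 x2 y1 y2 : 'rV[R]_d) := row_mx (row_mx x1 x2) (row_mx y1 y2).

Lemma row4E (x1 x2 y1 y2 : 'rV[R]_d) k :
  (row4 x1 x2 y1 y2 0 (pos1 k) = x1 0 k) * (row4 x1 x2 y1 y2 0 (pos2 k) = x2 0 k) *
  (row4 x1 x2 y1 y2 0 (freq1 k) = y1 0 k) * (row4 x1 x2 y1 y2 0 (freq2 k) = y2 0 k).
Proof. by rewrite /row4 !(row_mxEl, row_mxEr). Qed.

Lemma index_eqE l k :
  ((pos1 l == pos1 k) = (l == k)) * ((pos1 l == pos2 k) = false) *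
  ((pos1 l == freq1 k) = false) * ((pos1 l == freq2 k) = false) *
  ((pos2 l == pos1 k) = false) * ((pos2 l == pos2 k) = (l == k)) *
  ((pos2 l == freq1 k) = false) * ((pos2 l == freq2 k) = false) *
  ((freq1 l == pos1 k) = false) * ((freq1 l == pos2 k) = false) *
  ((freq1 l == freq1 k) = (l == k)) * ((freq1 l == freq2 k) = false) *
  ((freq2 l == pos1 k) = false) * ((freq2 l == pos2 k) = false) *
  ((freq2 l == freq1 k) = false) * ((freq2 l == freq2 k) = (l == k)).
Proof. by rewrite -!val_eqE /=; have := ltn_ord l; have := ltn_ord k; do !split; lia. Qed.

Variable c : 'S_((d + d) + (d + d)).
Hypothesis hc : slice_perm c.

(** Coordinates of the first variable come before those of the second in the mixed norm. A moving
    coordinate of the second variable may therefore be accompanied by one of the first, which gets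
    sheared. *)
Lemma slice_inner k : (c (pos1 k) < 2 * d)%N /\ (c (freq1 k) < 2 * d)%N.
Proof.
have [h _] := hc.
have in1 i : (i < d)%N || (2 * d <= i < 3 * d)%N -> (c i < 2 * d)%N.
  move=> hi; have : c i \in [set i : 'I_((d + d) + (d + d)) | (i < 2 * d)%N]%SET.
    by rewrite -h; apply: imset_f; rewrite inE.
  by rewrite inE.
split; apply: in1 => /=; have := ltn_ord k; lia.
Qed.

Lemma slice_outer k : (2 * d <= c (pos2 k))%N /\ (2 * d <= c (freq2 k))%N.
Proof.
have [_ h] := hc.
have in1 i : (d <= i < 2 * d)%N || (3 * d <= i)%N -> (2 * d <= c i)%N.
  move=> hi; have : c i \in [set i : 'I_((d + d) + (d + d)) | (2 * d <= i)%N]%SET.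
    by rewrite -h; apply: imset_f; rewrite inE.
  by rewrite inE.
split; apply: in1 => /=; have := ltn_ord k; lia.
Qed.

Lemma outer_index i : (2 * d <= c i)%N -> exists k, i = pos2 k \/ i = freq2 k.
Proof.
move: i; apply: index_split => k h.
- by have [] := slice_inner k; rewrite ltnNge h.
- by exists k; left.
- by have [_] := slice_inner k; rewrite ltnNge h.
- by exists k; right.
Qed.

Lemma inner_index i : (c i < 2 * d)%N -> exists k, i = pos1 k \/ i = freq1 k.
Proof.
move: i; apply: index_split => k h.
- by exists k; left.
- by have [] := slice_outer k; rewrite leqNgt h.
- by exists k; right.
- by have [_] := slice_outer k; rewrite leqNgt h.
Qed.

End Indices.

(** * Choice of steps for each coordinate *)

Section Main.
Local Open Scope classical_set_scope.
Local Open Scope complex_scope.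
Context {R : realType} {d : nat}.
Variables (phi : 'rV[R]_(d + d) -> R[i]) (p s : R).
Variables (q : 'I_((d + d) + (d + d)) -> \bar R) (c : 'S_((d + d) + (d + d))).
Hypotheses (sphi : schwartz phi) (p1 : 1 <= p) (p2 : p <= 2) (s0 : s <= 0).
Hypotheses (hc : slice_perm c) (q2 : forall k, decay_ok 2 (q k)).

Let p0 : 0 < p. Proof. exact: lt_le_trans p1. Qed.

Let unit0 k : (delta_mx 0 k : 'rV[R]_d) 0 k = 1.
Proof. by rewrite mxE !eqxx. Qed.

Lemma outer_counterexample i : (2 * d <= c i)%N -> decay_ok (p^-1 - s) (q (c i)) ->
  (exists tau, [/\ tempered tau, in_modulation phi c q (weight s) (kn_kernel tau)
       & ~ in_schatten p (psido tau)]) /\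
  (exists tau, in_modulation phi c q (weight s) tau /\ ~ in_schatten p (psido tau)).
Proof.
move=> i0o qi.
have r0 : 0 <= p^-1 by rewrite invr_ge0 ltW.
have r1 : p^-1 <= 1 by rewrite invf_le1.
have rp : p^-1 * p <= 1 by rewrite mulVf// gt_eqF.
have [k ik] := outer_index hc i0o; pose ek : 'rV[R]_d := delta_mx 0 k.
have [in1 in2] := slice_inner hc k.
have dot0 (x : 'rV[R]_d) : dotrv x 0 = 0 by exact: dotrv0r.
have dot0' (x : 'rV[R]_d) : dotrv 0 x = 0 by exact: dotrv0l.
have time a := @not_schatten_time R d p^-1 ek (a *: ek) 0 0 r0 (dot0 _) (dot0 _) p k p0 a rp.
have freq := @not_schatten_freq R d p^-1 0 0 ek (- ek) r0 (dot0' _) (dot0' _) p k p0 rp erefl erefl erefl erefl.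
case: ik => ik; rewrite ik in qi i0o.
- split.
  (* Both variables move in position; [pos1] is inner and sheared along [pos2]. *)
  + exists (osc_symbol p^-1 ek (1 *: ek) 0 0); split.
    * apply: (@tempered_osc_symbol _ _ _ _ _ _ _ r0 (pos1 k)).
      by rewrite -/(row4 _ _ _ _) row4E unit0 normr1.
    * apply: (@modulation_norm_osc_kernel _ _ _ _ _ _ _ r0 (dot0 _) (dot0 _) _ _ _ _ sphi r1 s0 q2 (pos2 k) (pos1 k)) => //.
      -- by rewrite index_eqE.
      -- by rewrite -/(row4 _ _ _ _) row4E scale1r unit0 normr1.
      -- by right; rewrite -/(row4 _ _ _ _) row4E unit0 normr1.
      -- by apply: index_split => l; rewrite !index_eqE -/(row4 _ _ _ _) row4E !mxE; case: (l == k) => //= _ _; rewrite ?mulr0.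
      -- by move=> _; exact: leq_trans in1 i0o.
    * by apply: time; rewrite ?normr1.
  (* Opposite frequency steps move the symbol along [pos2] alone, since [-y2 = ek] and
     [y1 + y2 = 0]. *)
  + exists (osc_symbol p^-1 0 0 ek (- ek)); split => //.
    apply: (@modulation_norm_osc_symbol _ _ _ _ _ _ _ r0 _ _ _ _ sphi r1 s0 q2 (pos2 k) (pos1 k)) => //.
    * by rewrite index_eqE.
    * by rewrite -/(row4 _ _ _ _) row4E opprK unit0 normr1.
    * by left; rewrite -/(row4 _ _ _ _) row4E mxE.
    * by apply: index_split => l; rewrite !index_eqE -/(row4 _ _ _ _) row4E !mxE; case: (l == k) => //= _ _; rewrite ?subrr ?oppr0.
    * by rewrite -/(row4 _ _ _ _) row4E mxE eqxx.
- split.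
  (* As a kernel the same operator moves along [freq1] and [freq2]; the inner [freq1] is sheared
     along [freq2]. *)
  + exists (osc_symbol p^-1 0 0 ek (- ek)); split => //.
    * apply: (@tempered_osc_symbol _ _ _ _ _ _ _ r0 (pos2 k)).
      by rewrite -/(row4 _ _ _ _) row4E opprK unit0 normr1.
    * apply: (@modulation_norm_osc_kernel _ _ _ _ _ _ _ r0 (dot0' _) (dot0' _) _ _ _ _ sphi r1 s0 q2 (freq2 k) (freq1 k)) => //.
      -- by rewrite index_eqE.
      -- by rewrite -/(row4 _ _ _ _) row4E mxE unit0 normrN normr1.
      -- by right; rewrite -/(row4 _ _ _ _) row4E unit0 normr1.
      -- by apply: index_split => l; rewrite !index_eqE -/(row4 _ _ _ _) row4E !mxE; case: (l == k) => //= _ _; rewrite ?oppr0.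
      -- by move=> _; exact: leq_trans in2 i0o.
  (* The symbol must move along [freq2], so [x2 - x1] has to be [ek], while [x1] must move too for
     the operator to be nearly diagonal. The accompanying coordinate [pos1] is inner. *)
  + exists (osc_symbol p^-1 ek (2 *: ek) 0 0); split; last first.
      by apply: time; rewrite // ger0_norm// ler1n.
    apply: (@modulation_norm_osc_symbol _ _ _ _ _ _ _ r0 _ _ _ _ sphi r1 s0 q2 (freq2 k) (pos1 k)) => //.
    * by rewrite index_eqE.
    * by rewrite -/(row4 _ _ _ _) row4E !mxE !eqxx /= mulr1 -addrA subrr addr0 normr1.
    * by right; rewrite -/(row4 _ _ _ _) row4E unit0 normr1.
    * by apply: index_split => l; rewrite !index_eqE -/(row4 _ _ _ _) row4E !mxE; case: (l == k) => //= _ _; rewrite ?mulr0 ?subrr ?oppr0 ?addr0.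
    * by move=> _; exact: leq_trans in1 i0o.
Qed.

Lemma inner_counterexample i : (c i < 2 * d)%N -> decay_ok (2^-1 - s) (q (c i)) ->
  (exists tau, [/\ tempered tau, in_modulation phi c q (weight s) (kn_kernel tau)
       & ~ in_schatten p (psido tau)]) /\
  (exists tau, in_modulation phi c q (weight s) tau /\ ~ in_schatten p (psido tau)).
Proof.
move=> i0o qi.
have r0 : 0 <= 2^-1 :> R by rewrite invr_ge0.
have r1 : 2^-1 <= 1 :> R by rewrite invf_le1// ler1n.
have rp : 2^-1 * p <= 1 by move: p2 => ?; lra.
have [k ik] := inner_index hc i0o; pose ek : 'rV[R]_d := delta_mx 0 k.
have dot0 (x : 'rV[R]_d) : dotrv x 0 = 0 by exact: dotrv0r.
have gauss x1 y1 := @not_schatten_gau R d 2^-1 x1 0 y1 0 r0 (dot0 _) (dot0 _) p k erefl erefl erefl.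
case: ik => ik; rewrite ik in qi i0o.
- split.
  + exists (osc_symbol 2^-1 ek 0 0 0); split.
    * apply: (@tempered_osc_symbol _ _ _ _ _ _ _ r0 (pos1 k)).
      by rewrite -/(row4 _ _ _ _) row4E unit0 normr1.
    * apply: (@modulation_norm_osc_kernel _ _ _ _ _ _ _ r0 (dot0 _) (dot0 _) _ _ _ _ sphi r1 s0 q2 (pos1 k) (pos2 k)) => //.
      -- by rewrite index_eqE.
      -- by rewrite -/(row4 _ _ _ _) row4E unit0 normr1.
      -- by left; rewrite -/(row4 _ _ _ _) row4E mxE.
      -- by apply: index_split => l; rewrite !index_eqE -/(row4 _ _ _ _) row4E !mxE; case: (l == k).
      -- by rewrite -/(row4 _ _ _ _) row4E mxE eqxx.
    * by apply: gauss; left.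
  (* With [x2 = 0] the symbol would also move along the outer coordinate [freq2], which cannot be
     sheared along the inner [pos1]. Taking [x2 = x1] cancels it; the operator is then nearly
     diagonal, and [r * p = p / 2 <= 1]. *)
  + exists (osc_symbol 2^-1 ek (1 *: ek) 0 0); split; last first.
      by apply: (@not_schatten_time R d _ _ _ _ _ r0 (dot0 _) (dot0 _) p k p0 1); rewrite ?normr1.
    apply: (@modulation_norm_osc_symbol _ _ _ _ _ _ _ r0 _ _ _ _ sphi r1 s0 q2 (pos1 k) (pos2 k)) => //.
    * by rewrite index_eqE.
    * by rewrite -/(row4 _ _ _ _) row4E unit0 normr1.
    * by left; rewrite -/(row4 _ _ _ _) row4E !mxE oppr0.
    * by apply: index_split => l; rewrite !index_eqE -/(row4 _ _ _ _) row4E !mxE; case: (l == k) => //= _ _; rewrite ?mul1r ?subrr ?oppr0 ?addr0.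
    * by rewrite -/(row4 _ _ _ _) row4E !mxE oppr0 eqxx.
- split.
  + exists (osc_symbol 2^-1 0 0 ek 0); split.
    * apply: (@tempered_osc_symbol _ _ _ _ _ _ _ r0 (freq1 k)).
      by rewrite -/(row4 _ _ _ _) row4E addr0 unit0 normr1.
    * apply: (@modulation_norm_osc_kernel _ _ _ _ _ _ _ r0 (dot0 _) (dot0 _) _ _ _ _ sphi r1 s0 q2 (freq1 k) (freq2 k)) => //.
      -- by rewrite index_eqE.
      -- by rewrite -/(row4 _ _ _ _) row4E unit0 normr1.
      -- by left; rewrite -/(row4 _ _ _ _) row4E mxE.
      -- by apply: index_split => l; rewrite !index_eqE -/(row4 _ _ _ _) row4E !mxE; case: (l == k).
      -- by rewrite -/(row4 _ _ _ _) row4E mxE eqxx.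
    * by apply: gauss; right.
  (* A frequency step of the first variable alone appears unchanged in the symbol, so the operator
     used for kernels serves again. *)
  + exists (osc_symbol 2^-1 0 0 ek 0); split; last by apply: gauss; right.
    apply: (@modulation_norm_osc_symbol _ _ _ _ _ _ _ r0 _ _ _ _ sphi r1 s0 q2 (freq1 k) (freq2 k)) => //.
    * by rewrite index_eqE.
    * by rewrite -/(row4 _ _ _ _) row4E addr0 unit0 normr1.
    * by left; rewrite -/(row4 _ _ _ _) row4E subr0 mxE.
    * by apply: index_split => l; rewrite !index_eqE -/(row4 _ _ _ _) row4E !mxE; case: (l == k) => //= _ _; rewrite ?subrr ?oppr0 ?addr0.
    * by rewrite -/(row4 _ _ _ _) row4E subr0 mxE eqxx.
Qed.

End Main.

Theorem theorem5p4 (R : realType) (d : nat) (hd : (0 < d)%N)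
  (phi : 'rV[R]_(d + d) -> R[i])
  (hphi : schwartz phi) (hphi0 : exists t, phi t != 0)
  (p s : R) (hp1 : 1 <= p) (hp2 : p <= 2) (hs : s <= 0)
  (q : 'I_((d + d) + (d + d)) -> \bar R)
  (hq1 : forall i : 'I_((d + d) + (d + d)), (i < 2 * d)%N -> (2%:E <= q i)%E)
  (hq2 : forall i : 'I_((d + d) + (d + d)), (2 * d <= i)%N -> (p%:E <= q i)%E)
  (c : 'S_((d + d) + (d + d))) (hc : slice_perm c)
  (habc : s < 0 \/
          (exists i : 'I_((d + d) + (d + d)), (i < 2 * d)%N /\ (2%:E < q i)%E) \/
          (exists i : 'I_((d + d) + (d + d)), (2 * d <= i)%N /\ (p%:E < q i)%E)) :
  (exists tau : ('rV[R]_(d + d) -> R[i]) -> R[i],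
     [/\ tempered tau,
         in_modulation phi c q (weight s) (kn_kernel tau)
       & ~ in_schatten p (psido tau)]) /\
  (exists tau : ('rV[R]_(d + d) -> R[i]) -> R[i],
     in_modulation phi c q (weight s) tau /\ ~ in_schatten p (psido tau)).
Proof.
have p0 : 0 < p by exact: lt_le_trans hp1.
have ok (a : R) (e : \bar R) : 0 < a -> (a^-1%:E < e)%E -> decay_ok a e.
  move=> a0 H; split; first exact: ltW.
  case: e H => [t| |]//; last by left.
  rewrite lte_fin => at_; right; exists t => //; split.
    by apply: lt_trans at_; rewrite invr_gt0.
  by rewrite -(mulfV (lt0r_neq0 a0)) ltr_pM2l.
have q2 k : decay_ok 2 (q k).
  apply: ok => //; have [k1|k1] := ltnP k (2 * d).
    by apply: lt_le_trans (hq1 k k1); rewrite lte_fin; lra.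
  by apply: lt_le_trans (hq2 k k1); rewrite lte_fin; lra.
(* At [s = 0] and [e = b] the product [(b^-1 - s) e] is exactly 1; strictness of either inequality
   pushes it above 1. *)
have bd (b : R) (e : \bar R) : 0 < b -> (b%:E <= e)%E -> s < 0 \/ (b%:E < e)%E ->
    decay_ok (b^-1 - s) e.
  move=> b0 be H; have bi : 0 < b^-1 by rewrite invr_gt0.
  have a0 : 0 < b^-1 - s by lra.
  apply: ok => //; case: H => [s1|]; last first.
    by apply: le_lt_trans; rewrite lee_fin -[leRHS]invrK lef_pV2 ?posrE//; lra.
  by apply: lt_le_trans be; rewrite lte_fin -[ltRHS]invrK ltf_pV2 ?posrE//; lra.
have outer (i : 'I_((d + d) + (d + d))) : (2 * d <= i)%N -> s < 0 \/ (p%:E < q i)%E -> decay_ok (p^-1 - s) (q i).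
  by move=> io; apply: bd => //; exact: hq2.
have inner (i : 'I_((d + d) + (d + d))) : (i < 2 * d)%N -> (2%:E < q i)%E -> decay_ok (2^-1 - s) (q i).
  by move=> ii q2i; apply: bd => //; [exact: hq1|right].
have rot (i : 'I_((d + d) + (d + d))) : c ((c^-1)%g i) = i by rewrite permKV.
case: habc => [s1|[[i [ii qi]]|[i [io qi]]]].
(* For [s < 0] any outer slot of the mixed norm will do. [freq1 (Ordinal hd)] is the index [2 * d],
   the first such slot, and the inverse of [c] finds the coordinate placed there. *)
- have i0o : (2 * d <= freq1 (Ordinal hd))%N by rewrite /= mul2n -addnn leq_addr.
  apply: (outer_counterexample hphi hp1 hs hc q2 (i := (c^-1)%g (freq1 (Ordinal hd)))); rewrite rot//.
  by apply: outer => //; left.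
- by apply: (inner_counterexample hphi hp1 hp2 hs hc q2 (i := (c^-1)%g i)); rewrite rot//; exact: inner.
- apply: (outer_counterexample hphi hp1 hs hc q2 (i := (c^-1)%g i)); rewrite rot//.
  by apply: outer => //; right.
Qed.
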